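(* Assume that the reproducing kernel $k$ of $W$ is $C_0$-universal, that $\rho$ and $\gamma$ are non-negative, and that $V$ is continuously embedded in $C_0^2(\mathbb{R}^n,\mathbb{R}^n)$. Let $\mu_0\in\mathcal{V}_d$ be compactly supported, let $K\subset\mathbb{R}^n$ be compact with $\mathrm{supp}(|\mu_0|)\subset K$, let $\mu_{tar}\in\mathcal{V}_d$, $\lambda>0$, and for each $N\ge1$ let $\mu_{K,N}$ be a minimizer of $\|\nu-\mu_0\|_{W^*}$ over $\{\nu\in\mathcal{V}_d^N : \mathrm{supp}(|\nu|)\subset K\}$. Define on $L^2([0,1],V)$ $$E(v)=\frac12\int_0^1\|v_t\|_V^2dt+\lambda\|(\varphi_1^v)_\#\mu_0-\mu_{tar}\|_{W^*}^2,\qquad E_N(v)=\frac12\int_0^1\|v_t\|_V^2dt+\lambda\|(\varphi_1^v)_\#\mu_{K,N}-\mu_{tar}\|_{W^*}^2 .$$ Then the sequence of functionals $E_N$ $\Gamma$-converges to $E$ for the weak topology on $L^2([0,1],V)$. Consequently, if $v^N$ is a global minimizer of $E_N$ for each $N\ge1$, then $(v^N)$ is bounded in $L^2([0,1],V)$ and every cluster point of $(v^N)$ for the weak topology of $L^2([0,1],V)$ is a global minimum of $E$.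
   Context: Let $0\le d\le n$. $\widetilde{G}^n_d$ is the (compact) manifold of oriented $d$-dimensional linear subspaces of $\mathbb{R}^n$, identified with a subset of the unit sphere of $\Lambda^d(\mathbb{R}^n)$ by $T\mapsto \frac{u_1\wedge\cdots\wedge u_d}{|u_1\wedge\cdots\wedge u_d|}$ for any basis $(u_i)$ of $T$ consistent with its orientation (inner product $\langle \xi_1\wedge\cdots\wedge\xi_d,\eta_1\wedge\cdots\wedge\eta_d\rangle=\det(\xi_i\cdot\eta_j)_{i,j}$). An invertible linear map $A$ acts by $A\cdot T=\frac{Au_1\wedge\cdots\wedge Au_d}{|Au_1\wedge\cdots\wedge Au_d|}$. $\mathcal{V}_d$ is the set of oriented $d$-varifolds, i.e. nonnegative finite Radon measures on $\mathbb{R}^n\times\widetilde{G}^n_d$; $|\mu|(A)=\mu(A\times\widetilde{G}^n_d)$; $(\mu|\omega)=\int\omega\,d\mu$. $\mathcal{V}_d^N=\{\sum_{i=1}^N r_i\delta_{(x_i,T_i)} : r_i\ge0,\ x_i\in\mathbb{R}^n,\ T_i\in\widetilde{G}^n_d\}$. Pushforward: for a diffeomorphism $\phi$ of $\mathbb{R}^n$, $(\phi_\#\mu|\omega)=\int\omega(\phi(x),d_x\phi\cdot T)\,J_T\phi(x)\,d\mu(x,T)$, where $J_T\phi(x)=\sqrt{\det\big((d_x\phi(e_i)\cdot d_x\phi(e_j))_{i,j=1,\dots,d}\big)}$ for an orthonormal basis $(e_i)$ of $T$. $V$ is a reproducing kernel Hilbert space (RKHS) of vector fields on $\mathbb{R}^n$;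 $L^2([0,1],V)$ is the space of square-integrable $v$ with $v_t\in V$; the flow is $\varphi_0^v=\mathrm{id}$, $\dot\varphi_t^v=v_t\circ\varphi_t^v$. $C_0^2(\mathbb{R}^n,\mathbb{R}^n)$ is the Banach space of $C^2$ vector fields vanishing at infinity together with their derivatives up to order 2, with the sum of sup norms. Kernels: $k^{pos}(x,y)=\rho(|x-y|^2)$ and $k^G(S,T)=\gamma(\langle S,T\rangle)$ are continuous positive definite kernels on $\mathbb{R}^n$ and $\widetilde{G}^n_d$ with $\rho,\gamma$ continuous, $\rho(0)>0$, $\gamma(1)>0$, and $k^{pos}(x,\cdot)\in C_0(\mathbb{R}^n)$ for all $x$ ($C_0$: continuous functions vanishing at infinity). $W$ is the RKHS of $k((x,T),(x',T'))=k^{pos}(x,x')k^G(T,T')$; $\|\mu\|_{W^*}=\sup_{\omega\in W,\|\omega\|_W\le1}|(\mu|\omega)|$. $k$ is $C_0$-universal if $W$ is dense in $C_0(\mathbb{R}^n\times\widetilde{G}^n_d)$ for uniform convergence. $\Gamma$-convergence of $E_N$ to $E$ for the weak topology means: (i) whenever $v^N\to\bar v$ weakly, $E(\bar v)\le\liminf_N E_N(v^N)$; (ii) for every $\bar v$ there is a sequence $v^N\to\bar v$ weakly with $E(\bar v)\ge\limsup_N E_N(v^N)$. *)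

(* Defs.v *)
From HB Require Import structures.
From mathcomp Require Import all_boot all_order all_fingroup all_algebra.
From mathcomp Require Import all_classical all_reals all_analysis.

Set Implicit Arguments.
Unset Strict Implicit.
Unset Printing Implicit Defensive.

Import Order.TTheory GRing.Theory Num.Theory.
Import numFieldNormedType.Exports.
Import numFieldTopology.Exports.

Local Open Scope classical_set_scope.
Local Open Scope ring_scope.

Section euclidean.
Context {R : realType} {m : nat}.
Implicit Types x y : 'rV[R]_m.

(* The library norm `|x| of a row vector is the sup norm. *)
Definition dot x y : R := (x *m y^T) 0 0.
Definition enorm x : R := Num.sqrt (dot x x).
Definition unitize x : 'rV[R]_m := (enorm x)^-1 *: x.

End euclidean.

Section exterior.
Context (R : realType) (n d : nat).

Definition incr_tuple := {t : d.-tuple 'I_n | sorted ltn (map val t)}.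

Definition ext_dim := #|{: incr_tuple}|.

(* Coordinates of the d-th exterior power of R^n in the basis
   e_{t_1} /\ ... /\ e_{t_d}, t increasing; this basis is orthonormal for the
   inner product det (xi_i . eta_j), see dot_wedge. *)
Definition ext := 'rV[R]_ext_dim.

Definition ext_index (k : 'I_ext_dim) : 'I_d -> 'I_n :=
  tnth (val (enum_val k : incr_tuple)).

(* The wedge product of the rows of U. *)
Definition wedge (U : 'M[R]_(d, n)) : ext :=
  \row_k \det (colsub (ext_index k) U).

(* The d-th exterior power of the linear map u |-> u *m A: its k-th row is the
   wedge product of the images of the vectors e_{t_1}, ..., e_{t_d}. *)
Definition ext_map (A : 'M[R]_n) : 'M[R]_ext_dim :=
  \matrix_k wedge (rowsub (ext_index k) A).

End exterior.

Section cauchy_binet.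
Context (R : realType) (n d : nat).

Let incr_comp (p : 'I_(ext_dim n d) * {perm 'I_d}) : {ffun 'I_d -> 'I_n} :=
  [ffun i => ext_index p.1 (p.2 i)].

Let ltn_val_sorted (t : incr_tuple n d) :
  sorted ltn (map (@nat_of_ord n) (val t)).
Proof. exact: (valP t). Qed.

Let uniq_incr (t : incr_tuple n d) : uniq (val t).
Proof.
rewrite -(map_inj_uniq val_inj); apply: sorted_uniq (ltn_val_sorted t).
  exact: ltn_trans.
exact: ltnn.
Qed.

Let ext_index_inj k : injective (@ext_index n d k).
Proof. by move=> i j /tuple_uniqP; apply; exact: uniq_incr. Qed.

Let incr_comp_inj : injective incr_comp.
Proof.
move=> [k s] [k' s'] /ffunP e.
have {}e i : ext_index k (s i) = ext_index k' (s' i).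
  by have := e i; rewrite !ffunE.
have kk' : k = k'.
  apply/enum_val_inj/val_inj/val_inj/(inj_map val_inj) => /=.
  apply: (irr_sorted_eq ltn_trans ltnn); [exact: ltn_val_sorted..|].
  have mem (l : 'I_(ext_dim n d)) (x : 'I_n) :
      (x \in val (enum_val l : incr_tuple n d)) = [exists i, ext_index l i == x].
    apply/tnthP/existsP => [[i ->]|[i /eqP <-]]; first by exists i.
    by exists i.
  apply: eq_mem_map => x; rewrite !mem.
  apply/existsP/existsP => -[i /eqP <-].
    by exists (s' (s^-1%g i)); rewrite -e permKV.
  by exists (s (s'^-1%g i)); rewrite e permKV.
move: e; rewrite -kk' => e; congr pair.
by apply/permP => i; apply: (@ext_index_inj k); rewrite e.
Qed.

Let incr_comp_surj (f : {ffun 'I_d -> 'I_n}) :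
  injectiveb f -> exists p, incr_comp p = f.
Proof.
move=> /injectiveP fI.
pose t := sort (fun i j : 'I_n => i <= j)%N (codom f).
have szt : size t = d by rewrite size_sort size_codom card_ord.
have st : sorted ltn (map val t).
  rewrite ltn_sorted_uniq_leq (map_inj_uniq val_inj) sort_uniq.
  rewrite (map_inj_uniq fI) enum_uniq /= sorted_map.
  by apply: sort_sorted => i j; exact: leq_total.
have szt' : size t == d by apply/eqP.
pose u : incr_tuple n d := exist (fun t : d.-tuple 'I_n => sorted ltn (map val t))
  (Tuple szt') st.
have ft i : f i \in t by rewrite mem_sort codom_f.
have ltd i : (index (f i) t < d)%N by rewrite -[X in (_ < X)%N]szt index_mem.
pose g i := Ordinal (ltd i).
have eg i : ext_index (enum_rank u) (g i) = f i.
  rewrite /ext_index enum_rankK (tnth_nth (f i)) /=.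
  by rewrite nth_index.
have gI : injective g by move=> i j e; apply: fI; rewrite -!eg e.
exists (enum_rank u, perm gI); apply/ffunP => i.
by rewrite ffunE /= permE eg.
Qed.

Lemma det_mulmx_rect (A : 'M[R]_(d, n)) (B : 'M[R]_(n, d)) :
  \det (A *m B) = \sum_(k < ext_dim n d)
    \det (colsub (ext_index k) A) * \det (rowsub (ext_index k) B).
Proof.
pose G (f : {ffun 'I_d -> 'I_n}) :=
  (\prod_i A i (f i)) * \det (rowsub f B).
transitivity (\sum_f G f).
  transitivity (\sum_(f : {ffun 'I_d -> 'I_n}) \sum_(s : 'S_d)
      (-1) ^+ s * \prod_i (A i (f i) * B (f i) (s i))).
    rewrite exchange_big /=; apply: eq_bigr => s _.
    rewrite -big_distrr /= -(bigA_distr_bigA (fun i k => A i k * B k (s i))); congr (_ * _).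
    by apply: eq_bigr => i _; rewrite mxE.
  apply: eq_bigr => f _; rewrite /G /determinant big_distrr /=.
  apply: eq_bigr => s _; rewrite big_split /= mulrCA; congr (_ * (_ * _)).
  by apply: eq_bigr => i _; rewrite mxE.
rewrite (bigID (fun f : {ffun 'I_d -> 'I_n} => injectiveb f)) /=.
rewrite [X in _ + X]big1 ?addr0; last first.
  move=> f /injectivePn[i [j ij fij]]; rewrite /G.
  rewrite (determinant_alternate ij) ?mulr0// => l.
  by rewrite !mxE fij.
rewrite (reindex_omap incr_comp
  (fun f => [pick p | incr_comp p == f])) /=; last first.
  move=> f /incr_comp_surj[p pf]; case: pickP => [q /eqP<-//|/(_ p)].
  by rewrite pf eqxx.
rewrite (eq_bigl xpredT); last first.
  move=> p; apply/andP; split.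
    apply/injectiveP => i j; rewrite !ffunE => /ext_index_inj.
    exact: perm_inj.
  by case: pickP => [q /eqP/incr_comp_inj->//|/(_ p)]; rewrite eqxx.
rewrite -(pair_bigA _ (fun k s => G (incr_comp (k, s)))) /=.
apply: eq_bigr => k _; rewrite [X in _ = X * _]/determinant big_distrl /=.
apply: eq_bigr => s _; rewrite /G.
have -> : rowsub (incr_comp (k, s)) B = row_perm s (rowsub (ext_index k) B).
  by apply/matrixP => i j; rewrite !mxE ffunE.
rewrite row_permE det_mulmx det_perm mulrCA mulrA; congr (_ * _ * _).
by apply: eq_bigr => i _; rewrite mxE ffunE.
Qed.

Lemma dot_wedge (U V : 'M[R]_(d, n)) :
  dot (wedge U) (wedge V) = \det (U *m V^T).
Proof.
rewrite /dot mxE det_mulmx_rect; apply: eq_bigr => k _.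
rewrite !mxE; congr (_ * _); rewrite -det_tr; congr (\det _).
by apply/matrixP => i j; rewrite !mxE.
Qed.

Lemma wedge_mulmx (U : 'M[R]_(d, n)) (A : 'M[R]_n) :
  wedge (U *m A) = wedge U *m ext_map d A.
Proof.
apply/rowP => l; rewrite !mxE.
have -> : colsub (ext_index l) (U *m A) = U *m colsub (ext_index l) A.
  by apply/matrixP => i j; rewrite !mxE; apply: eq_bigr => m _; rewrite !mxE.
rewrite det_mulmx_rect; apply: eq_bigr => k _; rewrite !mxE.
by congr (_ * \det _); apply/matrixP => i j; rewrite !mxE.
Qed.

End cauchy_binet.

HB.mixin Record NormedModule_isHilbert (R : realType) H
    of CompleteNormedModule R H := {
  inner : {dot H for @idfun R} ;
  inner_normE : forall x : H, inner x x = `|x| ^+ 2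
}.

#[short(type="hilbertType")]
HB.structure Definition Hilbert (R : realType) :=
  {H of CompleteNormedModule R H & NormedModule_isHilbert R H}.

Section grassmannian.
Context (R : realType) (n : nat) (d : 'I_n.+1).

(* For d >= 1 the second sign is redundant: it amounts to replacing a vector of
   the basis by its opposite. For d = 0, where the only basis is empty, it
   provides the second orientation of {0}. *)
Definition oriented_planes : set (ext R n d) :=
  [set T | exists U : 'M[R]_(d, n), row_free U /\
     (T = unitize (wedge U) \/ T = - unitize (wedge U))].

Definition oGrass : Type := set_type oriented_planes.

HB.instance Definition _ := Topological.copy oGrass (set_type oriented_planes).

Fact oGrass_point_subproof :
  unitize (wedge (pid_mx d : 'M[R]_(d, n))) \in oriented_planes.
Proof.
rewrite inE; exists (pid_mx d); split; last by left.
by rewrite /row_free rank_pid_mx// -ltnS.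
Qed.

HB.instance Definition _ :=
  isPointed.Build oGrass
    (exist (fun T => T \in oriented_planes) _ oGrass_point_subproof).

(* The matrix A acts on vectors by u |-> u *m A. The set of unit simple vectors
   is stable under this operation when A is invertible; the default value T of
   insubd is used only if A is singular. *)
Definition oGrass_act (A : 'M[R]_n) (T : oGrass) : oGrass :=
  insubd (T : oriented_planes) (unitize (set_val T *m ext_map d A)).

(* The rows of U form an orthonormal basis of the plane T, regardless of the
   orientation. *)
Definition orthonormal_basis (T : oGrass) : set 'M[R]_(d, n) :=
  [set U | U *m U^T = 1%:M /\ (set_val T = wedge U \/ set_val T = - wedge U)].

Definition tangent_jacobian (A : 'M[R]_n) (T : oGrass) : R :=
  let U := xget 0 (orthonormal_basis T) in
  Num.sqrt (\det ((U *m A) *m (U *m A)^T)).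

End grassmannian.

Section varifolds.
Context (R : realType) (n : nat) (d : 'I_n.+1).

Definition position_plane : Type := ('rV[R]_n * oGrass R d)%type.

HB.instance Definition _ := Topological.copy position_plane
  ('rV[R]_n * oGrass R d)%type.
HB.instance Definition _ := Pointed.copy position_plane
  ('rV[R]_n * oGrass R d)%type.

Local Notation borel := (g_sigma_algebraType (@open position_plane)).

(* R^n x oGrass is Polish, so its finite Borel measures are Radon measures. *)
Definition varifold := {finite_measure set borel -> \bar R}.

Definition mass (mu : varifold) (A : set 'rV[R]_n) : \bar R := mu (A `*` setT).

Definition msupport (T : topologicalType) (m : set T -> \bar R) : set T :=
  [set x | forall U, open_nbhs x U -> (0 < m U)%E].

Definition discrete_varifolds (N : nat) : set varifold :=
  [set mu : varifold | exists (r : 'I_N -> R) (x : 'I_N -> 'rV[R]_n) (T : 'I_N -> oGrass R d),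
     (forall i, 0 <= r i) /\
     forall A : set borel, measurable A ->
       mu A = (\sum_(i < N) (r i)%:E * \d_((x i, T i) : borel) A)%E].

Definition pairing (mu : varifold) (omega : position_plane -> R) : R :=
  \int[mu]_z omega z.

(* The pushforward varifold, through its pairing with test functions. *)
Definition pushforward_pairing (phi : 'rV[R]_n -> 'rV[R]_n) (mu : varifold)
    (omega : position_plane -> R) : R :=
  \int[mu]_z (omega (phi z.1, oGrass_act ('J phi z.1) z.2) *
              tangent_jacobian ('J phi z.1) z.2).

End varifolds.

Section function_spaces.
Context {R : realType}.

Definition C0 {T : topologicalType} {U : normedModType R} : set (T -> U) :=
  [set f | continuous f /\
     forall e, 0 < e -> exists K, compact K /\ forall x, ~ K x -> `|f x| < e].

Definition sup_norm {T : Type} {U : normedModType R} (f : T -> U) : R :=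
  sup [set `|f x| | x in setT].

Context {n : nat}.
Implicit Types f : 'rV[R]_n -> 'rV[R]_n.

(* The derivative of the Jacobian matrix in the direction e_i. *)
Definition jacobian_diff f (i : 'I_n) (x : 'rV[R]_n) : 'M[R]_n :=
  'd (jacobian f) x (delta_mx 0 i).

Definition C0_2 : set ('rV[R]_n -> 'rV[R]_n) :=
  [set f | [/\ forall x, differentiable f x,
               forall x, differentiable (jacobian f) x,
               C0 f, C0 (jacobian f) &
               forall i, C0 (jacobian_diff f i)]].

(* The norms of matrices are the library's max norms; another choice yields an
   equivalent norm. *)
Definition C0_2_norm f : R :=
  sup_norm f + sup_norm (jacobian f) + \sum_(i < n) sup_norm (jacobian_diff f i).

Definition continuously_embedded_C0_2 (V : normedModType R)
    (ev : V -> 'rV[R]_n -> 'rV[R]_n) : Prop :=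
  (forall v, C0_2 (ev v)) /\ exists C, forall v, C0_2_norm (ev v) <= C * `|v|.

End function_spaces.

Section rkhs.
Context {R : realType} {X : Type}.

(* H is identified with a vector space of functions X -> U through the map ev,
   which sends an element of H to the function that it denotes. *)
Definition is_rkhs {U : normedModType R} {H : hilbertType R} (ev : H -> X -> U) :=
  [/\ forall x, linear (ev^~ x), injective ev & forall x, continuous (ev^~ x)].

Definition is_rkhs_of (k : X -> X -> R) {H : hilbertType R} (ev : H -> X -> R) :=
  [/\ forall x, linear (ev^~ x : H -> R^o), injective ev &
      forall x, exists kx : H, ev kx = k x /\ forall h, ev h x = inner kx h].

Definition positive_definite (k : X -> X -> R) :=
  (forall x y, k x y = k y x) /\
  forall m (x : 'I_m -> X) (a : 'I_m -> R),
    0 <= \sum_i \sum_j a i * a j * k (x i) (x j).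

Definition dual_norm {H : hilbertType R} (ev : H -> X -> R)
    (l : (X -> R) -> R) : R :=
  sup [set `|l (ev h)| | h in [set h : H | `|h| <= 1]].

End rkhs.

Definition C0_universal {R : realType} {X : topologicalType} {H : hilbertType R}
    (ev : H -> X -> R) : Prop :=
  (forall h, C0 (ev h)) /\
  forall f : X -> R, C0 f ->
    forall e, 0 < e -> exists h, forall x, `|ev h x - f x| < e.

Section kernels.
Context {R : realType} {n : nat} {d : 'I_n.+1}.

Definition kpos (rho : R -> R) (x y : 'rV[R]_n) : R := rho (enorm (x - y) ^+ 2).

Definition kG (gamma : R -> R) (S T : oGrass R d) : R :=
  gamma (dot (set_val S) (set_val T)).

Definition kprod (rho gamma : R -> R) (z w : position_plane R d) : R :=
  kpos rho z.1 w.1 * kG gamma z.2 w.2.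

End kernels.

Section L2.
Context {R : realType}.
Local Notation leb := (@lebesgue_measure R).
Local Notation I01 := (`[0, 1]%classic : set R).

Definition simple_fun {V : normedModType R} (f : R -> V) : Prop :=
  finite_set (range f) /\ forall y, measurable (f @^-1` [set y]).

Definition strongly_measurable {V : normedModType R} (f : R -> V) : Prop :=
  exists s : nat -> R -> V, (forall k, simple_fun (s k)) /\
    forall t, I01 t -> s^~ t @ \oo --> f t.

Variable V : hilbertType R.

(* Elements of L^2 are represented by functions, not by classes of functions
   modulo equality almost everywhere. Each class contains a function that is
   everywhere a limit of Borel simple functions. Values outside [0, 1] are
   irrelevant. *)
Definition L2 : set (R -> V) :=
  [set v | strongly_measurable v /\
     (\int[leb]_(t in I01) (`|v t| ^+ 2)%:E < +oo)%E].

Definition L2_dot (v w : L2) : R :=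
  \int[leb]_(t in I01) inner (set_val v t) (set_val w t).

Definition L2_sqnorm (v : L2) : R := \int[leb]_(t in I01) (`|set_val v t| ^+ 2).

Definition L2_norm (v : L2) : R := Num.sqrt (L2_sqnorm v).

(* The coarsest topology for which all the linear forms L2_dot ^~ w are
   continuous. *)
Definition weakL2 : Type :=
  initial_topology (fun v => L2_dot v : {ptws L2 -> R}).

HB.instance Definition _ := Topological.on weakL2.

End L2.
Arguments L2 {R} V _.

Section flow.
Context {R : realType} {n : nat}.

(* Solutions in the sense of Caratheodory of d/dt phi_t = u_t o phi_t with
   phi_0 = id, for a vector field that is merely integrable in time. *)
Definition is_flow (u phi : R -> 'rV[R]_n -> 'rV[R]_n) : Prop :=
  forall x i,
    (@lebesgue_measure R).-integrable `[0, 1]%classic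
      (fun s => (u s (phi s x) 0 i)%:E) /\
    forall t, 0 <= t <= 1 ->
      phi t x 0 i = x 0 i +
        \int[@lebesgue_measure R]_(s in `[0, t]%classic) u s (phi s x) 0 i.

(* Only the times in [0, 1] are meaningful. *)
Definition flow (u : R -> 'rV[R]_n -> 'rV[R]_n) : R -> 'rV[R]_n -> 'rV[R]_n :=
  xget ((fun _ => id) : R -> 'rV[R]_n -> 'rV[R]_n) [set phi | is_flow u phi].

End flow.

Definition is_minimizer {R : realType} {T : Type} (F : T -> R) (S : set T) (x : T) :=
  S x /\ forall y, S y -> F x <= F y.

Definition Gamma_cvg {R : realType} {T : topologicalType}
    (FN : nat -> T -> R) (F : T -> R) : Prop :=
  (forall (u : nat -> T) (v : T), u @ \oo --> v ->
     ((F v)%:E <= limn_einf (fun N => (FN N (u N))%:E))%E) /\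
  (forall v : T, exists u : nat -> T, u @ \oo --> v /\
     (limn_esup (fun N => (FN N (u N))%:E) <= (F v)%:E)%E).

Section energy.
Context {R : realType} {n : nat} {d : 'I_n.+1} {V W : hilbertType R}.
Variables (evV : V -> 'rV[R]_n -> 'rV[R]_n) (evW : W -> position_plane R d -> R).

Definition varifold_dist (mu nu : varifold R d) : R :=
  dual_norm evW (fun omega => pairing mu omega - pairing nu omega).

Definition energy (lambda : R) (mu mutar : varifold R d) (v : weakL2 V) : R :=
  2^-1 * L2_sqnorm v +
  lambda * dual_norm evW (fun omega =>
    pushforward_pairing (flow (fun t => evV (set_val (v : L2 V) t)) 1) mu omega
    - pairing mutar omega) ^+ 2.

End energy.

(* Main.v *)
Require Import Defs.
From HB Require Import structures.
From mathcomp Require Import all_boot all_order all_fingroup all_algebra.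
From mathcomp Require Import all_classical all_reals all_analysis.
From mathcomp Require Import measurable_realfun.
From mathcomp Require Import ring lra.

Set Implicit Arguments.
Unset Strict Implicit.
Unset Printing Implicit Defensive.

Import Order.TTheory GRing.Theory Num.Theory.
Import numFieldNormedType.Exports.
Import numFieldTopology.Exports.

Local Open Scope classical_set_scope.
Local Open Scope ring_scope.

(* The integrand of the pushforward varifold is z |-> <theta_v(z), omega>_W, where
   theta_v(x, T) = J_T phi(x) k((phi(x), d_x phi . T), .) and phi = phi_1^v, so the data
   terms are compared through the maps theta_v with values in W, uniformly in
   |omega|_W <= 1.

   Flows. If u is close to v for the weak topology and bounded in L^2, then phi_1^u is
   close to phi_1^v uniformly on K: each coordinate of int_0^t (u - v)_s(phi_s^v(x)) ds is
   the L^2 product of u - v with a fixed element, and Gronwall's inequality does the rest.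
   The Jacobians are controlled without the variational equation: a Gronwall argument
   bounds the second difference phi(x + h) + phi(x - h) - 2 phi(x) by C |h|^2, which yields
   differentiability with a quadratic remainder, and then uniform closeness of the maps
   implies that of their Jacobians.

   Measures. A partition of unity subordinate to small oscillations of z |-> k(z, .)
   produces discrete varifolds supported in K and close to mu_0 in W^*, so that mu_{K,N}
   converges to mu_0 in W^*. By universality the masses of mu_{K,N} are bounded and the
   pairings with C_0 functions converge, whence convergence of the pairings with
   <theta_v, omega>, uniformly in omega.

   Therefore the data term of E_N at u converges to that of E at v when N tends to infinity
   and u tends weakly to v in a bounded set. As E_N(u) >= |u|^2 / 2, the functions u of
   large norm do no harm in the lower bound, and constant sequences are recovery
   sequences. *)

(** Two obstacles shape the estimates. Weak convergence makes small only the integrals of u - v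
    against fixed elements, so u - v may enter only along the trajectories of the fixed field v;
    whatever depends on the trajectories of u must be absorbed by Gronwall, at a rate that depends
    on a bound of the L^2 norm alone. Moreover the elements of W are merely continuous, so there is
    no Lipschitz estimate for omega o phi_u - omega o phi_v. Equicontinuity over the unit ball of W
    comes instead from the continuity of z |-> k(z, .), made uniform by the compactness of K and of
    the Grassmannian.

    The weak topology is handled by neighbourhoods rather than sequences. Estimates of flows near v
    carry the proviso [admissible B M u], and N0 is chosen before the neighbourhood of v. The
    proviso disappears in [energy_lower], whose neighbourhoods serve convergent sequences and
    cluster points of minimizers alike; the latter are reached without extracting subsequences. *)

HB.instance Definition _ (R : realType) (m n : nat) :=
  Uniform_isComplete.Build 'M[R]_(m, n) cauchy_cvg.

(** * Hilbert spaces *)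

Section geometric_sequences.
Context {R : realType} {U : completeNormedModType R}.

(** The explicit remainder is what turns dyadic difference quotients and Picard iterates into
    estimates on their limits. *)
Lemma geometric_increments_cvg (a : nat -> U) (B : R) :
  (forall k, `|a k.+1 - a k| <= B * 2^-1 ^+ k) ->
  exists l : U, a @ \oo --> l /\ forall k, `|l - a k| <= 2 * B * 2^-1 ^+ k.
Proof.
move=> aB.
have B0 : 0 <= B.
  by have := aB 0%N; rewrite expr0 mulr1; apply: le_trans.
have tail j k : `|a (k + j)%N - a k| <= 2 * B * 2^-1 ^+ k.
  (* The exact partial sum of the series, for which the induction on j closes. *)
  suff: `|a (k + j)%N - a k| <= 2 * B * (2^-1 ^+ k - 2^-1 ^+ (k + j)).
    move=> /le_trans; apply; rewrite ler_wpM2l ?mulr_ge0// lerBlDr lerDl.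
    by rewrite exprn_ge0.
  elim: j => [|j IH]; first by rewrite addn0 !subrr normr0 mulr0.
  rewrite addnS.
  have -> : a (k + j).+1 - a k = (a (k + j).+1 - a (k + j)%N) + (a (k + j)%N - a k).
    by rewrite addrA subrK.
  apply: le_trans (ler_normD _ _) _.
  apply: le_trans (lerD (aB _) IH) _.
  rewrite exprS; set x := 2^-1 ^+ (k + j); set y := 2^-1 ^+ k.
  lra.
have cv : cvg (a @ \oo).
  apply: cauchy_cvg; apply: cauchy_exP => _/posnumP[e].
  have : geometric (2 * B) (2^-1 : R) @ \oo --> (0 : R).
    by apply: cvg_geometric; rewrite ger0_norm ?invr_ge0// invf_lt1// ltr1n.
  move=> /cvgrPdist_lt/(_ e%:num (gt0 e))[k _ kP].
  have {kP} := kP k (leqnn _).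
  rewrite /geometric/= sub0r normrN => kP.
  exists (a k); exists k => // m /= km; rewrite -ball_normE /ball_/= distrC.
  rewrite -(subnKC km); apply: le_lt_trans (tail _ _) _.
  exact: le_lt_trans (ler_norm _) kP.
exists (lim (a @ \oo)); split=> // k.
have cvk : `|a (j + k)%N - a k| @[j --> \oo] --> `|lim (a @ \oo) - a k|.
  by apply: cvg_norm; apply: cvgB; [rewrite (cvg_shiftn k a)|exact: cvg_cst].
have <- := cvg_lim (@Rhausdorff R) cvk.
apply: limr_le; first by apply/cvg_ex; eexists; exact: cvk.
by apply: nearW => j; rewrite addnC.
Qed.

End geometric_sequences.

Section hilbert.
Context {R : realType} {H : hilbertType R}.
Implicit Types x y z : H.

Lemma innerC x y : inner x y = inner y x.
Proof. by rewrite hermC/= expr0 mul1r. Qed.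

Lemma innerDl x y z : inner (x + y) z = inner x z + inner y z.
Proof. exact: linearDl. Qed.

Lemma innerZl a x y : inner (a *: x) y = a * inner x y.
Proof. exact: linearZl_LR. Qed.

Lemma innerDr x y z : inner z (x + y) = inner z x + inner z y.
Proof. by rewrite innerC innerDl !(innerC z). Qed.

Lemma innerZr a x y : inner y (a *: x) = a * inner y x.
Proof. by rewrite innerC innerZl innerC. Qed.

Lemma innerNl x y : inner (- x) y = - inner x y.
Proof. by rewrite -scaleN1r innerZl mulN1r. Qed.

Lemma innerNr x y : inner y (- x) = - inner y x.
Proof. by rewrite innerC innerNl innerC. Qed.

Lemma innerBl x y z : inner (x - y) z = inner x z - inner y z.
Proof. by rewrite innerDl innerNl. Qed.

Lemma inner0l x : inner 0 x = 0.
Proof. by rewrite -(scale0r 0) innerZl mul0r. Qed.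

Lemma sqr_normD x y : `|x + y| ^+ 2 = `|x| ^+ 2 + 2 * inner x y + `|y| ^+ 2.
Proof. by rewrite -!inner_normE !innerDl !innerDr (innerC y x); ring. Qed.

Lemma sqr_normB x y : `|x - y| ^+ 2 = `|x| ^+ 2 - 2 * inner x y + `|y| ^+ 2.
Proof. by rewrite sqr_normD innerNr normrN mulrN. Qed.

Lemma inner_le x y : `|inner x y| <= `|x| * `|y|.
Proof.
have [->|x0] := eqVneq x 0; first by rewrite inner0l !normr0 mul0r.
have nx : 0 < `|x| by rewrite normr_gt0.
have nx2 : `|x| ^+ 2 != 0 by rewrite expf_neq0// gt_eqF.
rewrite -(ler_pXn2r (_ : 0 < 2)%N)// ?nnegrE ?mulr_ge0// exprMn real_normK ?num_real//.
have := sqr_ge0 `|y - (inner x y / `|x| ^+ 2) *: x|.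
rewrite sqr_normB innerZr normrZ exprMn real_normK ?num_real//.
rewrite (innerC y x) expr_div_n.
set s := inner x y; set a := `|x| ^+ 2; set b := `|y| ^+ 2.
have a0 : 0 < a by rewrite exprn_gt0.
have -> : b - 2 * (s / a * s) + s ^+ 2 / a ^+ 2 * a = b - s ^+ 2 / a by field; rewrite gt_eqF.
by rewrite subr_ge0 ler_pdivrMr// mulrC.
Qed.

Lemma inner_AMGM x y : `|inner x y| <= 2^-1 * (`|x| ^+ 2 + `|y| ^+ 2).
Proof.
apply: le_trans (inner_le _ _) _.
have := sqr_ge0 (`|x| - `|y|); rewrite sqrrB; set a := `|x|; set b := `|y|.
by rewrite -[a * b *+ 2]mulr_natl; lra.
Qed.

(* The representing vector minimizes |h|^2 / 2 - l h, whose minimizing sequences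
   are Cauchy by the parallelogram identity. *)
Lemma riesz (l : H -> R) (C : R) :
  (forall a x y, l (a *: x + y) = a * l x + l y) ->
  (forall x, `|l x| <= C * `|x|) ->
  exists k : H, forall x, l x = inner k x.
Proof.
move=> lin lC.
have l0 : l 0 = 0 by have := lin 1 0 0; rewrite scaler0 addr0; lra.
have lD x y : l (x + y) = l x + l y by have := lin 1 x y; rewrite scale1r mul1r.
have lZ a x : l (a *: x) = a * l x by have := lin a x 0; rewrite l0 !addr0.
have lB x y : l (x - y) = l x - l y by rewrite lD -scaleN1r lZ mulN1r.
pose J x : R := 2^-1 * `|x| ^+ 2 - l x.
have J_ge x : - (2^-1 * C ^+ 2) <= J x.
  have := lC x; rewrite ler_norml => /andP[_ h].
  have := sqr_ge0 (`|x| - C); rewrite sqrrB -[_ *+ 2]mulr_natl /J; nra.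
pose S := range J.
have Sinf : has_inf S.
  by split; [exists (J 0), 0|exists (- (2^-1 * C ^+ 2)) => _ [x _ <-]].
have mJ x : inf S <= J x by apply: ge_inf; [exact: (proj2 Sinf)|exists x].
(* The parallelogram identity turns a defect of 4^-k into a distance of order 2^-k; the constant 3
   below comes from 4 (1/4 + 1) = 5 <= 3^2. *)
have /choice[a aP] (k : nat) : exists x, J x < inf S + 4^-1 ^+ k.
  have : inf S < inf S + 4^-1 ^+ k by rewrite ltrDl exprn_gt0// invr_gt0.
  by move=> /(inf_lt (proj1 Sinf)) [_ [x _ <-]] ?; exists x.
have par x y e e' : J x < inf S + e -> J y < inf S + e' ->
    `|x - y| ^+ 2 <= 4 * (e + e').
  move=> xe ye; have := mJ (2^-1 *: (x + y)).
  rewrite /J lZ lD normrZ exprMn sqr_normB sqr_normD.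
  rewrite ger0_norm ?invr_ge0//.
  move: xe ye; rewrite /J; lra.
have [|k [ak _]] := @geometric_increments_cvg R H a 3.
  move=> k; rewrite -(ler_pXn2r (_ : 0 < 2)%N)// ?nnegrE ?mulr_ge0// ?exprn_ge0//.
  apply: le_trans (par _ _ _ _ (aP _) (aP _)) _.
  rewrite exprMn -exprM mulnC exprM exprS.
  have -> : (2^-1 : R) ^+ 2 = 4^-1 by rewrite exprVn -natrX.
  set x := _ ^+ k; have x0 : 0 <= x by rewrite exprn_ge0.
  lra.
have Jk : J k = inf S.
  apply/eqP; rewrite eq_le mJ andbT.
  have lk : l \o a @ \oo --> l k.
    apply/cvgrPdist_le => e e0.
    have C1 : 0 < `|C| + 1 by rewrite ltr_pwDr.
    have /cvgrPdist_le/(_ (e / (`|C| + 1))) := ak.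
    rewrite divr_gt0// => /(_ isT); apply: filterS => m.
    rewrite ler_pdivlMr// mulrC /= => h; apply: le_trans h.
    rewrite -lB.
    apply: le_trans (lC _) _; rewrite ler_wpM2r//.
    by rewrite (le_trans (ler_norm _))// lerDl.
  have Ja : J \o a @ \oo --> J k.
    apply: cvgB => //; apply: cvgM; first exact: cvg_cst.
    by rewrite /= expr2; under eq_fun do rewrite expr2; apply: cvgM; exact: cvg_norm.
  have Ja' : inf S + 4^-1 ^+ k @[k --> \oo] --> inf S + (0 : R).
    apply: cvgD; first exact: cvg_cst.
    by apply: cvg_expr; rewrite ger0_norm ?invr_ge0// invf_lt1// ltr1n.
  rewrite -[inf S]addr0 -(cvg_lim (@Rhausdorff R) Ja') -(cvg_lim (@Rhausdorff R) Ja).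
  apply: ler_lim; [by apply/cvg_ex; eexists; exact: Ja|
    by apply/cvg_ex; eexists; exact: Ja'|].
  by apply: nearW => m /=; exact/ltW/aP.
exists k => x.
set d := l x - inner k x; suff : d = 0 by rewrite /d => /subr0_eq.
have q t : 0 <= 2^-1 * t ^+ 2 * `|x| ^+ 2 - t * d.
  have := mJ (k + t *: x); rewrite -Jk /J lD lZ sqr_normD innerZr normrZ exprMn.
  rewrite real_normK ?num_real// /d; lra.
(* The variation is tested at t = d / (|x|^2 + 1), where it is a negative multiple of d^2; the
   summand 1 covers x = 0. *)
have x1 : 0 < `|x| ^+ 2 + 1 by rewrite ltr_pwDr// sqr_ge0.
have := q (d / (`|x| ^+ 2 + 1)).
set X := `|x| ^+ 2 in x1 *.
have X0 : 0 <= X by rewrite sqr_ge0.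
have -> : 2^-1 * (d / (X + 1)) ^+ 2 * X - d / (X + 1) * d =
   - (d ^+ 2 * ((2^-1 * X + 1) / (X + 1) ^+ 2)) by field; rewrite gt_eqF.
rewrite oppr_ge0 => h.
have p : 0 < (2^-1 * X + 1) / (X + 1) ^+ 2.
  by rewrite divr_gt0 ?exprn_gt0//; lra.
move: h; rewrite pmulr_lle0// => h.
by apply/eqP; rewrite -sqrf_eq0 eq_le h sqr_ge0.
Qed.

End hilbert.

(** * Differentiability from bounds on second differences *)

Section second_difference.
Context {R : realType} {U : normedModType R} {W : completeNormedModType R}.
Variables (f : U -> W) (L C : R).
Hypothesis f_lip : forall x y, `|f x - f y| <= L * `|x - y|.
Hypothesis f_diff2 : forall x h, `|f (x + h) + f (x - h) - 2 *: f x| <= C * `|h| ^+ 2.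

(** Halving the step changes this quotient by a second difference at the midpoint, of size C |h|^2
    4^-(k+1) before rescaling by 2^k. The quotients therefore converge geometrically, and their
    limit is the candidate derivative. *)
Let quot (x h : U) (k : nat) : W := (2 ^+ k : R) *: (f (x + 2^-1 ^+ k *: h) - f x).

Let pow2V k : 2 ^+ k * 2^-1 ^+ k = 1 :> R.
Proof. by rewrite -exprMn divff ?expr1n// pnatr_eq0. Qed.

Let quot_cvg x h : exists l : W, quot x h @ \oo --> l /\
  `|f (x + h) - f x - l| <= C * `|h| ^+ 2.
Proof.
(* The quotient at k = 0 is f (x + h) - f x, and the factor 1/2 makes the remainder there equal to C
   |h|^2. *)
have [k|l [ql qB]] := @geometric_increments_cvg R W (quot x h) (2^-1 * C * `|h| ^+ 2).
  have := f_diff2 (x + 2^-1 ^+ k.+1 *: h) (2^-1 ^+ k.+1 *: h).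
  have -> : x + 2^-1 ^+ k.+1 *: h + 2^-1 ^+ k.+1 *: h = x + 2^-1 ^+ k *: h.
    by rewrite -addrA -scalerDl exprS -mulrDl (_ : 2^-1 + 2^-1 = 1 :> R) ?mul1r//; lra.
  rewrite addrK => d2.
  have -> : quot x h k.+1 - quot x h k = - ((2 ^+ k : R) *:
      (f (x + 2^-1 ^+ k *: h) + f x - 2 *: f (x + 2^-1 ^+ k.+1 *: h))).
    rewrite /quot [2 ^+ k.+1]exprSr -scalerA -scalerBr -scalerN; congr (_ *: _).
    rewrite scalerBr [2 *: f x]scaler_nat mulr2n !opprB !opprD !addrA addrNK.
    by rewrite addrAC.
  rewrite normrN normrZ ger0_norm ?exprn_ge0//.
  apply: le_trans (ler_wpM2l (exprn_ge0 _ _) d2) _ => //.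
  rewrite normrZ ger0_norm ?exprn_ge0// exprMn [2^-1 ^+ k.+1]exprS.
  have := pow2V k; set u := 2 ^+ k; set v := _ ^+ k => uv.
  have -> : u * (C * ((2^-1 * v) ^+ 2 * `|h| ^+ 2)) =
     4^-1 * (u * v) * v * (C * `|h| ^+ 2) by field.
  have C0 : 0 <= C * `|h| ^+ 2 by apply: le_trans (normr_ge0 _) (f_diff2 x h).
  have v0 : 0 <= v by rewrite exprn_ge0.
  rewrite uv mulr1; nra.
exists l; split=> //; have := qB 0%N.
rewrite /quot !expr0 !scale1r mulr1 distrC.
by rewrite (_ : 2 * (2^-1 * C * `|h| ^+ 2) = C * `|h| ^+ 2)//; field.
Qed.

Let D x h : W := projT1 (cid (quot_cvg x h)).

Let quotD x h : quot x h @ \oo --> D x h.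
Proof. by rewrite /D; case: cid => l []. Qed.

Let D_approx x h : `|f (x + h) - f x - D x h| <= C * `|h| ^+ 2.
Proof. by rewrite /D; case: cid => l []. Qed.

Let D_le x h : `|D x h| <= L * `|h|.
Proof.
have cn : `|quot x h k| @[k --> \oo] --> `|D x h| by exact: cvg_norm (@quotD x h).
rewrite -(cvg_lim (@Rhausdorff R) cn); apply: limr_le.
  by apply/cvg_ex; eexists; exact: cn.
apply: nearW => k; rewrite /quot normrZ ger0_norm ?exprn_ge0//.
apply: le_trans (ler_wpM2l (exprn_ge0 _ _) (f_lip _ _)) _ => //.
rewrite addrAC subrr add0r normrZ ger0_norm ?exprn_ge0//.
by rewrite mulrCA [2 ^+ k * _]mulrA pow2V mul1r.
Qed.

Let D_add x h k : D x (h + k) = D x h + D x k.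
Proof.
have c : (quot x (h + k) j - quot x h j - quot x k j) @[j --> \oo] -->
    D x (h + k) - D x h - D x k.
  by apply: cvgB => //; apply: cvgB.
suff c0 : (quot x (h + k) j - quot x h j - quot x k j) @[j --> \oo] --> (0 : W).
  have := cvg_unique (@norm_hausdorff _ _) c c0.
  by move=> /(_ _)/eqP; rewrite -addrA -opprD subr_eq0 => /eqP.
pose B := C * (`|h + k| ^+ 2 + `|h - k| ^+ 2).
apply/cvgr0Pnorm_le => e e0.
have : geometric B (2^-1 : R) @ \oo --> (0 : R).
  by apply: cvg_geometric; rewrite ger0_norm ?invr_ge0// invf_lt1// ltr1n.
move=> /cvgrPdist_le/(_ e e0); apply: filterS => j.
rewrite sub0r normrN /geometric/= => /(le_trans (ler_norm _)); apply: le_trans.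
rewrite /quot -!scalerBr normrZ ger0_norm ?exprn_ge0//.
pose s : R := 2^-1 ^+ j.
(* The pairs x + s (h + k), x and x + s h, x + s k share the midpoint m, so the defect of additivity
   is the difference of two second differences at m, of order s^2 and divided by s. *)
pose m := x + (s / 2) *: (h + k).
have sE : s = s / 2 + s / 2 by rewrite -splitr.
have e1 : x + s *: (h + k) = m + (s / 2) *: (h + k).
  by rewrite /m -addrA -scalerDl -sE.
have e2 : x = m - (s / 2) *: (h + k) by rewrite /m addrK.
have e3 : x + s *: h = m + (s / 2) *: (h - k).
  rewrite /m -addrA -scalerDr addrA (addrAC h k h) addrK.
  by rewrite scalerDr -scalerDl -sE.
have e4 : x + s *: k = m - (s / 2) *: (h - k).
  rewrite /m -addrA -scalerBr opprB (addrC k (- h)) addrA (addrAC h k) subrr add0r.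
  by rewrite scalerDr -scalerDl -sE.
have d1 := f_diff2 m ((s / 2) *: (h + k)); have d2 := f_diff2 m ((s / 2) *: (h - k)).
rewrite -e1 -e2 in d1; rewrite -e3 -e4 in d2.
rewrite -/s.
have -> : f (x + s *: (h + k)) - f x - (f (x + s *: h) - f x) - (f (x + s *: k) - f x) =
   (f (x + s *: (h + k)) + f x - 2 *: f m) - (f (x + s *: h) + f (x + s *: k) - 2 *: f m).
  by rewrite !opprB !addrA !addrNK opprD addrA (addrAC (f (x + s *: (h + k)))).
apply: le_trans (ler_wpM2l (exprn_ge0 _ _) (ler_normB _ _)) _ => //.
apply: le_trans (ler_wpM2l (exprn_ge0 _ _) (lerD d1 d2)) _ => //.
rewrite (normrZ _ (h + k)) (normrZ _ (h - k)) (@ger0_norm _ (s / 2)) ?divr_ge0 ?exprn_ge0// !exprMn.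
have := pow2V j; rewrite -/s; set u := 2 ^+ j => us.
have -> : u * (C * (s ^+ 2 * 2^-1 ^+ 2 * `|h + k| ^+ 2) +
  C * (s ^+ 2 * 2^-1 ^+ 2 * `|h - k| ^+ 2)) =
   4^-1 * (u * s) * s * B by rewrite /B; field.
have B0 : 0 <= B.
  rewrite /B mulrDr; apply: addr_ge0; last exact: le_trans (normr_ge0 _) (f_diff2 x (h-k)).
  exact: le_trans (normr_ge0 _) (f_diff2 x (h+k)).
have s0 : 0 <= s by rewrite exprn_ge0.
rewrite us mulr1; nra.
Qed.

(* An additive map that is bounded near 0 is homogeneous: a |-> D (a h) - a D h
   is additive and 1-periodic, hence bounded on R and therefore zero. *)
Let D_scale x (a : R) h : D x (a *: h) = a *: D x h.
Proof.
have D0 : D x 0 = 0.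
  by have /eqP := D_add x 0 0; rewrite addr0 addrC -subr_eq subrr eq_sym => /eqP.
have Dn b : D x (- b) = - D x b.
  by apply/eqP; rewrite -addr_eq0 -D_add addNr D0.
pose g (a : R) := D x (a *: h) - a *: D x h.
have gD a1 b1 : g (a1 + b1) = g a1 + g b1.
  by rewrite /g !scalerDl D_add opprD addrACA.
have g1 : g 1 = 0 by rewrite /g !scale1r subrr.
have gN a1 : g (- a1) = - g a1.
  by rewrite /g !scaleNr Dn opprD.
have gM (m : nat) a1 : g (a1 *+ m) = g a1 *+ m.
  elim: m => [|m IH]; first by rewrite !mulr0n /g !scale0r D0 subrr.
  by rewrite !mulrSr gD IH.
have gZ (m : int) : g m%:~R = 0.
  case: m => m; first by rewrite -pmulrn gM g1 mul0rn.
  by rewrite NegzE mulrNz gN -pmulrn gM g1 mul0rn oppr0.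
have gB a1 : `|g a1| <= 2 * (`|L| * `|h|).
  rewrite -[a1](subrK (Num.floor a1)%:~R) gD gZ addr0.
  set r := a1 - _.
  have r1 : `|r| <= 1.
    rewrite ger0_norm ?subr_ge0 ?floor_le_tmp// /r lerBlDl.
    have := floorD1_gt a1; rewrite intrD => /ltW; lra.
  rewrite /g; apply: le_trans (ler_normB _ _) _.
  rewrite mulrDl !mul1r; apply: lerD.
    apply: le_trans (D_le _ _) _; rewrite normrZ.
    apply: (@le_trans _ _ (`|L| * (`|r| * `|h|))).
      by rewrite ler_wpM2r ?mulr_ge0// ler_norm.
    by rewrite ler_wpM2l// ler_piMl.
  rewrite normrZ; apply: le_trans (_ : `|D x h| <= _); first by rewrite ler_piMl.
  by apply: le_trans (D_le _ _) _; rewrite ler_wpM2r// ler_norm.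
have : `|g a| <= 0.
  apply/ler_addgt0Pr => e e0; rewrite add0r.
  have [m mB] : exists m : nat, 2 * (`|L| * `|h|) / e < m.+1%:R.
    exists (Num.trunc (2 * (`|L| * `|h|) / e)).
    by apply: truncnS_gt; rewrite divr_ge0 ?mulr_ge0// ltW.
  have := gB (a *+ m.+1); rewrite gM normrMn => /le_lt_trans.
  rewrite -[_ *+ m.+1]mulr_natl.
  move: mB; rewrite ltr_pdivrMr// => mB /(_ _ mB).
  by rewrite ltr_pM2l// => /ltW.
by rewrite normr_le0 subr_eq0 => /eqP.
Qed.

(** Meant for flows, of which only integral inequalities are known: differentiability comes with a
    remainder that is uniform in x and has the constant of the second differences. *)
Lemma diff2_differentiable x : differentiable f x /\
  forall y, `|f y - f x - 'd f x (y - x)| <= C * `|y - x| ^+ 2.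
Proof.
have lin_D : linear (D x : U -> W).
  by move=> a u v; rewrite D_add D_scale.
pose DL := GRing.isLinear.Build _ _ _ _ _ lin_D.
pose df : {linear U -> W} := HB.pack (D x : U -> W) DL.
have dfc : continuous df.
  apply: bounded_linear_continuous; apply/linear_boundedP.
  near=> M; move=> u /=; apply: le_trans (D_le x u) _.
  by rewrite ler_wpM2r//; near: M; exact: nbhs_pinfty_ge.
have fo : f \o shift x = cst (f x) + df +o_ 0 id.
  apply/eqaddoP => _/posnumP[e].
  have C1 : 0 < `|C| + 1 by rewrite ltr_pwDr.
  near=> h.
  rewrite !fctE /= /cst [h + x]addrC opprD addrA.
  apply: le_trans (D_approx x h) _.
  rewrite expr2 mulrA ler_wpM2r//.
  apply: (@le_trans _ _ ((`|C| + 1) * `|h|)).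
    by rewrite ler_wpM2r// (le_trans (ler_norm _))// lerDl.
  rewrite mulrC -ler_pdivlMr; last exact: C1.
  near: h; apply: nbhs0_le; exact: divr_gt0.
have dfE := diff_unique dfc fo.
split.
  by apply/diff_locallyP; rewrite dfE; split.
move=> y; rewrite dfE /=; have := D_approx x (y - x).
by rewrite [x + (y - x)]addrC subrK.
Unshelve. all: by end_near.
Qed.

End second_difference.

(** * Gronwall estimates in a weighted norm *)

Section integral_bounds.
Context d (T : measurableType d) (R : realType) (mu : {measure set T -> \bar R}).
Implicit Types (D : set T) (f g : T -> R).

Lemma dominated_integrable D f g : measurable D -> measurable_fun D f ->
  mu.-integrable D (EFin \o g) -> (forall s, D s -> `|f s| <= g s) ->
  mu.-integrable D (EFin \o f).
Proof.
move=> mD mf ig fg; apply: (le_integrable mD _ _ ig); first exact/measurable_EFinP.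
by move=> s Ds /=; rewrite lee_fin (le_trans (fg s Ds))// ler_norm.
Qed.

Lemma norm_Rintegral_le D f g : measurable D -> measurable_fun D f ->
  mu.-integrable D (EFin \o g) -> (forall s, D s -> `|f s| <= g s) ->
  `|\int[mu]_(s in D) f s| <= \int[mu]_(s in D) g s.
Proof.
move=> mD mf ig fg; have fi := dominated_integrable mD mf ig fg.
apply: le_trans (le_normr_Rintegral mD fi) _.
apply: le_Rintegral => //.
exact: (integrable_norm fi).
Qed.

Lemma integrable_RD D f g : measurable D ->
  mu.-integrable D (EFin \o f) -> mu.-integrable D (EFin \o g) ->
  mu.-integrable D (EFin \o (fun x => f x + g x)).
Proof.
move=> mD fi gi; have := integrableD mD fi gi.
by apply: eq_integrable.
Qed.

Lemma integrable_RB D f g : measurable D ->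
  mu.-integrable D (EFin \o f) -> mu.-integrable D (EFin \o g) ->
  mu.-integrable D (EFin \o (fun x => f x - g x)).
Proof.
move=> mD fi gi; have := integrableB mD fi gi.
by apply: eq_integrable.
Qed.

Lemma integrable_RZ D a f : measurable D ->
  mu.-integrable D (EFin \o f) -> mu.-integrable D (EFin \o (fun x => a * f x)).
Proof.
move=> mD fi; have := integrableZl mD a fi.
by apply: eq_integrable.
Qed.

End integral_bounds.

Section intervals.
Context {R : realType}.
Local Notation leb := (@lebesgue_measure R).
Implicit Types (f g : R -> R) (a b t : R).

Lemma subitv_I01 a b : 0 <= a -> b <= 1 -> `[a, b]%classic `<=` (`[0, 1]%classic : set R).
Proof.
by move=> a0 b1 s /=; rewrite !in_itv/= => /andP[? ?]; rewrite (le_trans a0)//= (le_trans _ b1).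
Qed.

Lemma integrable_subitv a b f : 0 <= a -> b <= 1 ->
  leb.-integrable `[0, 1]%classic (EFin \o f) -> leb.-integrable `[a, b]%classic (EFin \o f).
Proof. by move=> a0 b1; apply: integrableS => //; exact: subitv_I01. Qed.

Lemma measurable_subitv a b f : 0 <= a -> b <= 1 ->
  measurable_fun (`[0, 1]%classic : set R) f -> measurable_fun (`[a, b]%classic : set R) f.
Proof. by move=> a0 b1; apply: measurable_funS => //; exact: subitv_I01. Qed.

Lemma Rintegral_subitv_le a b f : 0 <= a -> b <= 1 ->
  leb.-integrable `[0, 1]%classic (EFin \o f) -> (forall s, 0 <= f s) ->
  \int[leb]_(s in `[a, b]) f s <= \int[leb]_(s in `[0, 1]) f s.
Proof.
move=> a0 b1 fi f0; rewrite fine_le//.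
- by apply: integrable_fin_num => //; exact: integrable_subitv.
- exact: integrable_fin_num.
apply: ge0_subset_integral => //=.
- by case/integrableP : fi.
- by move=> s _; rewrite lee_fin.
- exact: subitv_I01.
Qed.

Lemma Rintegral_split t f : 0 <= t -> t <= 1 ->
  leb.-integrable `[0, 1]%classic (EFin \o f) ->
  \int[leb]_(s in `[0, 1]) f s =
  \int[leb]_(s in `[0, t]) f s + \int[leb]_(s in `[t, 1]) f s.
Proof.
move=> t0 t1 fi.
have fi1 : leb.-integrable `]t, 1]%classic (EFin \o f).
  apply: integrableS fi => // s /=; rewrite !in_itv/= => /andP[ts ->].
  by rewrite andbT (le_trans t0)// ltW.
rewrite -(Rintegral_itv_obnd_cbnd fi1) -(@Rintegral_itvB _ f (BLeft 0) (BRight 1) t)//.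
by rewrite addrC subrK.
Qed.

Lemma Rintegral_cst_itv a b (r : R) : a <= b ->
  \int[leb]_(s in `[a, b]) r = r * (b - a).
Proof.
move=> ab; rewrite Rintegral_cst//= lebesgue_measure_itv/= lte_fin.
by have [//|ba] := ltP a b; rewrite /= (le_anti (introT andP (conj ab ba))) subrr.
Qed.

Lemma integrable_cst_itv a b (r : R) :
  leb.-integrable `[a, b]%classic (EFin \o (fun=> r)).
Proof.
apply: measurable_bounded_integrable => //.
  by rewrite /= lebesgue_measure_itv/=; case: ifPn => // _; rewrite -EFinD ltry.
by exists `|r|; split=> [|x rx y _ /=]; [exact: num_real|exact: ltW].
Qed.

Lemma integrable_continuous_itv a b f : continuous f ->
  leb.-integrable `[a, b]%classic (EFin \o f).
Proof.
move=> fc; apply: continuous_compact_integrable; first exact: segment_compact.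
exact: continuous_subspaceT.
Qed.

Lemma continuous_expRM (k : R) : continuous (fun s : R => expR (k * s)).
Proof.
by move=> s; apply: continuous_comp; [exact: mulrl_continuous|exact: continuous_expR].
Qed.

Lemma Rintegral_expR (k a b : R) : k != 0 -> a <= b ->
  \int[leb]_(s in `[a, b]) expR (k * s) = (expR (k * b) - expR (k * a)) / k.
Proof.
move=> k0; rewrite le_eqVlt => /predU1P[<-|ab].
  by rewrite set_itv1 Rintegral_set1 subrr mul0r.
pose F s : R := expR (k * s) / k.
have dF (s : R) : is_derive s 1 F (expR (k * s)).
  have d1 : is_derive s 1 (fun s : R => k * s) k.
    apply: is_derive_eq; last by rewrite /GRing.scale/= mulr1.
  have := is_deriveM (is_derive1_comp (is_derive_expR _) d1) (is_derive_cst k^-1 s 1).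
  move=> h; apply: is_derive_eq; rewrite /GRing.scale/= mulr0 add0r mulrC.
  by rewrite mulfK.
rewrite /Rintegral (@continuous_FTC2 _ _ F)//.
- by rewrite -EFinB /F mulrBl.
- by apply: continuous_subspaceT; exact: continuous_expRM.
- split.
  + by move=> s _; case: (dF s).
  + apply: cvg_at_right_filter; apply: differentiable_continuous.
    by apply/derivable1_diffP; case: (dF a).
  + apply: cvg_at_left_filter; apply: differentiable_continuous.
    by apply/derivable1_diffP; case: (dF b).
- by move=> s _; rewrite derive1E; case: (dF s).
Qed.

End intervals.

Section gronwall.
Context {R : realType}.

(* Bielecki's trick: on functions bounded by a multiple of the weight w, the
   integral operator is a contraction of ratio 1/2. *)
Lemma weighted_gronwall (f w : R -> R) (a N0 : R) (I : set R) :
  0 <= a -> (forall t, I t -> 1 <= w t) ->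
  (forall t, I t -> f t <= N0 * w t) ->
  (forall N, 0 <= N -> (forall t, I t -> f t <= N * w t) ->
     forall t, I t -> f t <= a + 2^-1 * N * w t) ->
  forall t, I t -> f t <= 2 * a * w t.
Proof.
move=> a0 w1 fN0 step t It.
(* Since w >= 1, each pass halves the excess over 2 a, the fixed point of N |-> a + N / 2. *)
have geo k s : I s -> f s <= (2 * a + `|N0| * 2^-1 ^+ k) * w s.
  elim: k s => [|k IH] s Is.
    apply: le_trans (fN0 _ Is) _; rewrite ler_wpM2r ?(le_trans _ (w1 _ Is))//.
    by rewrite expr0 mulr1 (le_trans (ler_norm N0))// lerDr mulr_ge0.
  apply: le_trans (step _ _ IH _ Is) _.
    by rewrite addr_ge0 ?mulr_ge0 ?exprn_ge0.
  have := w1 _ Is; rewrite exprS; set x := _ ^+ k; nra.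
have w0 : 0 < w t by rewrite (lt_le_trans _ (w1 _ It)).
have c1 : (2 * a + `|N0| * 2^-1 ^+ k) * w t @[k --> \oo] --> (2 * a + `|N0| * 0) * w t.
  apply: cvgM; last exact: cvg_cst.
  apply: cvgD; first exact: cvg_cst.
  apply: cvgM; first exact: cvg_cst.
  by apply: cvg_expr; rewrite ger0_norm ?invr_ge0// invf_lt1// ltr1n.
rewrite mulr0 addr0 in c1; rewrite -(cvg_lim (@Rhausdorff R) c1).
apply: limr_ge; first by apply/cvg_ex; eexists; exact: c1.
by apply: nearW => k; exact: geo.
Qed.

End gronwall.

Section exponential_weights.
Context {R : realType}.
Local Notation leb := (@lebesgue_measure R).
Variables (c : R -> R) (M : R).
Hypothesis c_meas : measurable_fun (`[0, 1]%classic : set R) c.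
Hypothesis c_ge0 : forall s, 0 <= c s.
Hypothesis c2_int : leb.-integrable `[0, 1]%classic (EFin \o (fun s => c s ^+ 2)).
Hypothesis c2_le : \int[leb]_(s in `[0, 1]) c s ^+ 2 <= M.

(** One rate for all c with integral of c^2 at most M, where the usual weight exp (2 int c) would
    vary with c. The summand 1 keeps it positive when M = 0. *)
Definition rate : R := 4 * (M + 1).

Let M0 : 0 <= M.
Proof. by apply: le_trans c2_le; apply: Rintegral_ge0 => s _; exact: sqr_ge0. Qed.

Lemma rate_gt0 : 0 < rate.
Proof. by rewrite /rate mulr_gt0// ltr_wpDl. Qed.

Let c_wexp_int (k a b : R) : 0 <= a -> b <= 1 ->
  leb.-integrable `[a, b]%classic (EFin \o (fun s => c s * expR (k * s))).
Proof.
move=> a0 b1.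
have ec := @continuous_expRM _ k.
apply: (@dominated_integrable _ _ R leb _ (fun s : R => c s * expR (k * s))
  (fun s : R => 2^-1 * c s ^+ 2 + 2^-1 * (expR (k * s)) ^+ 2)) => //.
- apply: measurable_funM; first exact: measurable_subitv.
  by apply: measurable_funTS; exact: continuous_measurable_fun.
- apply: integrable_RD => //; apply: integrable_RZ => //; first exact: integrable_subitv.
  by apply: integrable_continuous_itv => s; exact: (continuousM (ec s) (ec s)).
- move=> s _; rewrite ger0_norm ?mulr_ge0 ?expR_ge0//.
  have := sqr_ge0 (c s - expR (k * s)); rewrite sqrrB -[_ *+ 2]mulr_natl; lra.
Qed.

(* AM-GM: [c <= c^2 / (4 (M + 1)) + (M + 1)]. The value of [rate] makes the two terms
   of the bound at most a quarter of the weight. *)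
Let AMGM_exp (k a b E : R) : k != 0 -> 0 <= a -> a <= b -> b <= 1 -> 0 <= E ->
  (forall s, a <= s <= b -> expR (k * s) <= E) ->
  \int[leb]_(s in `[a, b]) (c s * expR (k * s)) <=
  4^-1 * E + (M + 1) * ((expR (k * b) - expR (k * a)) / k).
Proof.
move=> k0 a0 ab b1 E0 eE.
have M1 : 0 < M + 1 by rewrite ltr_wpDl.
pose al := (4 * (M + 1))^-1.
have al0 : 0 < al by rewrite invr_gt0 mulr_gt0.
have ci := integrable_subitv a0 b1 c2_int.
have ec := @continuous_expRM _ k.
apply: (@le_trans _ _ (\int[leb]_(s in `[a, b])
    (al * E * c s ^+ 2 + (M + 1) * expR (k * s)))).
  apply: le_Rintegral => //; first exact: c_wexp_int.
    apply: integrable_RD => //; apply: integrable_RZ => //.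
    exact: integrable_continuous_itv.
  move=> s /=; rewrite in_itv/= => abs.
  have e0 := expR_gt0 (k * s); have := eE _ abs; set e := expR _ in e0 *.
  move=> eE'.
  apply: (@le_trans _ _ (e * (al * c s ^+ 2 + (M + 1)))); last first.
    rewrite mulrDr [e * (M + 1)]mulrC lerD2r mulrA ler_wpM2r ?sqr_ge0//.
    by rewrite mulrC ler_wpM2l// ltW.
  rewrite mulrC ler_wpM2l ?(ltW e0)//.
  have -> : al * c s ^+ 2 + (M + 1) = c s + (c s - 2 * (M + 1)) ^+ 2 * al.
    by rewrite /al; field; rewrite gt_eqF.
  by rewrite lerDl mulr_ge0 ?sqr_ge0// ltW.
rewrite RintegralD//; [|by apply: integrable_RZ|
  by apply: integrable_RZ => //; exact: integrable_continuous_itv].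
rewrite !RintegralZl//; last exact: integrable_continuous_itv.
rewrite Rintegral_expR// lerD2r.
apply: (@le_trans _ _ (al * E * M)).
  rewrite ler_wpM2l ?mulr_ge0 ?(ltW al0)//; apply: le_trans c2_le.
  by apply: Rintegral_subitv_le => // s; exact: sqr_ge0.
rewrite mulrAC ler_wpM2r// /al ler_pdivrMl ?mulr_gt0//; lra.
Qed.

Lemma forward_weight t : 0 <= t <= 1 ->
  \int[leb]_(s in `[0, t]) (c s * expR (rate * s)) <= 2^-1 * expR (rate * t).
Proof.
move=> /andP[t0 t1]; have r0 := rate_gt0.
apply: le_trans (AMGM_exp (E := expR (rate * t)) _ _ _ _ _ _) _ => //.
- by rewrite gt_eqF.
- by move=> s /andP[_ st]; rewrite ler_expR ler_pM2l.
have M1 : 0 < M + 1 by rewrite ltr_wpDl.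
rewrite mulr0 expR0 mulrA [(M + 1) * _ / _]mulrAC.
have -> : (M + 1) / rate = 4^-1 by rewrite /rate; field; rewrite gt_eqF.
have := expR_ge0 (rate * t); lra.
Qed.

(** For integral equations solved backwards from time 1, hence for lower bounds on the distance
    between trajectories. *)
Lemma backward_weight t : 0 <= t <= 1 ->
  \int[leb]_(s in `[t, 1]) (c s * expR (rate * (1 - s))) <= 2^-1 * expR (rate * (1 - t)).
Proof.
move=> /andP[t0 t1]; have r0 := rate_gt0.
have eE s : expR (rate * (1 - s)) = expR rate * expR (- rate * s).
  by rewrite -expRD; congr expR; ring.
have M1 : 0 < M + 1 by rewrite ltr_wpDl.
under eq_Rintegral do rewrite eE mulrCA.
rewrite RintegralZl//; last exact: c_wexp_int.
rewrite eE mulrCA ler_pM2l ?expR_gt0//.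
apply: le_trans (AMGM_exp (E := expR (- rate * t)) _ _ _ _ _ _) _ => //.
- by rewrite oppr_eq0 gt_eqF.
- by move=> s /andP[ts _]; rewrite ler_expR !mulNr lerN2 ler_pM2l.
rewrite invrN mulrN -mulNr opprB mulrA [(M + 1) * _ / _]mulrAC.
have -> : (M + 1) / rate = 4^-1 by rewrite /rate; field; rewrite gt_eqF.
have := expR_ge0 (- rate * t); have := expR_ge0 (- rate * 1); lra.
Qed.

(** Absolute continuity uniform in c, from c <= e c^2 + 1 / e: the first term is made small by e,
    and then the second by b - a. *)
Lemma integral_small_interval a b (e : R) : 0 <= a -> a <= b -> b <= 1 -> 0 < e ->
  \int[leb]_(s in `[a, b]) c s <= e * M + e^-1 * (b - a).
Proof.
move=> a0 ab b1 e0.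
have ci := integrable_subitv a0 b1 c2_int.
apply: (@le_trans _ _ (\int[leb]_(s in `[a, b]) (e * c s ^+ 2 + e^-1))).
  apply: le_Rintegral => //.
  - have := @c_wexp_int 0 a b a0 b1; apply: eq_integrable => // s _ /=.
    by rewrite mul0r expR0 mulr1.
  - apply: integrable_RD => //; [exact: integrable_RZ|exact: integrable_cst_itv].
  - move=> s _; have := sqr_ge0 (e * c s - 1).
    have -> : e * c s ^+ 2 + e^-1 = e^-1 * ((e * c s) ^+ 2 + 1) by field; rewrite gt_eqF.
    have -> : c s = e^-1 * (e * c s) by rewrite mulKf// gt_eqF.
    rewrite [X in _ -> _ <= _ * (X ^+ 2 + _)]mulrA mulfV ?gt_eqF// mul1r.
    move=> h; rewrite ler_pM2l ?invr_gt0//; nra.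
rewrite RintegralD//; [|exact: integrable_RZ|exact: integrable_cst_itv].
rewrite RintegralZl// Rintegral_cst_itv// lerD2r ler_wpM2l ?(ltW e0)//.
by apply: le_trans c2_le; apply: Rintegral_subitv_le => // s; exact: sqr_ge0.
Qed.

End exponential_weights.

(** * Square-integrable vector fields *)

Section strong_measurability.
Import HBSimple.
Context {R : realType} {V : hilbertType R}.
Local Notation leb := (@lebesgue_measure R).
Local Notation I01 := (`[0, 1]%classic : set R).

(** For a simple f the map is a finite gluing of the measurable functions g h; continuity in h
    carries measurability to the limit. *)
Lemma caratheodory_measurable (g : V -> R -> R) (f : R -> V) :
  strongly_measurable f -> (forall h, measurable_fun I01 (g h)) ->
  (forall s, I01 s -> continuous (g^~ s)) ->
  measurable_fun I01 (fun s => g (f s) s).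
Proof.
move=> [sf [sfs sff]] gm gc.
apply: (@measurable_fun_cvg _ _ _ _ (fun k s => g (sf k s) s)); last first.
  move=> s Is; apply: (@continuous_cvg _ _ _ _ _ _ (g^~ s) (f s)); first exact: gc.
  exact: sff.
move=> k mI Y mY; have [fin ms] := sfs k.
have -> : I01 `&` (fun s => g (sf k s) s) @^-1` Y =
  \bigcup_(h in range (sf k)) (sf k @^-1` [set h] `&` (I01 `&` g h @^-1` Y)).
  apply/seteqP; split=> [s [Is Ys]|s [h _ [/= sh [Is Ys]]]].
    by exists (sf k s); [exists s|].
  by split=> //=; rewrite sh.
apply: fin_bigcup_measurable => // h _.
by apply: measurableI; [exact: ms|exact: gm].
Qed.

Lemma strongly_measurable_norm (f : R -> V) : strongly_measurable f ->
  measurable_fun I01 (fun s => `|f s|).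
Proof.
move=> fm; apply: (@caratheodory_measurable (fun h _ => `|h|)) => // s _.
exact: norm_continuous.
Qed.

Lemma continuous_innerl (k : V) : continuous (fun h : V => inner h k).
Proof.
move=> h; apply/cvgrPdist_le => e e0.
have k1 : 0 < `|k| + 1 by rewrite ltr_wpDl.
near=> x; rewrite -innerBl; apply: le_trans (inner_le _ _) _.
apply: (@le_trans _ _ (`|h - x| * (`|k| + 1))).
  by rewrite ler_wpM2l// lerDl.
rewrite -ler_pdivlMr; last exact: k1.
by near: x; apply: cvgr_dist_le; [exact: cvg_id|exact: divr_gt0].
Unshelve. all: by end_near. Qed.

Lemma strongly_measurable_inner (f g : R -> V) :
  strongly_measurable f -> strongly_measurable g ->
  measurable_fun I01 (fun s => inner (f s) (g s)).
Proof.
move=> fm gm; apply: (@caratheodory_measurable (fun h s => inner h (g s))) => //.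
  move=> h; apply: (@caratheodory_measurable (fun k _ => inner h k)) => // s _.
  by under eq_fun do rewrite innerC; exact: continuous_innerl.
by move=> s _; exact: continuous_innerl.
Qed.

(* Approximations: the composition of w with simple functions converging to the
   identity of [0, 1], cut off at time t. *)
Lemma continuous_strongly_measurable (w : R -> V) (t : R) :
  {within I01, continuous w} ->
  strongly_measurable (fun s => if s <= t then w s else 0).
Proof.
move=> wc.
(* The approximations of s given by [approximation_sfun] are not known to stay in [0, 1], outside of
   which w is not controlled; they are clamped. *)
pose cl (s : R) : R := Num.max 0 (Num.min 1 s).
have cl01 s : I01 (cl s).
  rewrite /= in_itv/= /cl le_max lexx/= ge_max ler01/= ge_min.
  by rewrite lexx.
have clid s : I01 s -> cl s = s.
  rewrite /= in_itv/= => /andP[s0 s1]; rewrite /cl (min_idPr s1).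
  by rewrite (max_idPr s0).
have [g gE] := @approximation_sfun _ _ R (fun s : R => s%:E) I01 (measurable_itv _)
   (@EFin_measurable R I01).
exists (fun k s => if s <= t then w (cl (g k s)) else 0); split; last first.
  move=> s Is; have [st|st] := boolP (s <= t); last exact: cvg_cst.
  have gs : g k s @[k --> \oo] --> s.
    by have /fine_cvgP[_] := gE s Is.
  have cgs : cl (g k s) @[k --> \oo] --> s.
    rewrite -[X in _ --> X](clid _ Is); apply: (@continuous_cvg _ _ _ _ _ _ cl) => //.
    apply: (@continuous_max R R (fun=> 0) (fun s => Num.min 1 s)); first exact: cst_continuous.
    by apply: (@continuous_min R R (fun=> 1) id); [exact: cst_continuous|exact: cvg_id].
  have wcs : w x @[x --> within I01 (nbhs s)] --> w s.
    by move: wc => /(_ s); rewrite /continuous_at nbhs_subspace_in//; exact.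
  move=> U /wcs => wU; have /cgs := wU; rewrite /within/= => Hk.
  have {}Hk : \forall k \near \oo, cl (g k s) \in `[0, 1] -> U (w (cl (g k s))) := Hk.
  suff : \forall k \near \oo, U (w (cl (g k s))) by [].
  by apply: filterS Hk => k h; apply: h; exact: cl01.
move=> k; have gfin : finite_set (range (g k)) by exact: fimfunP.
split.
  apply: (@sub_finite_set _ _ ((w \o cl) @` range (g k) `|` [set 0])).
    move=> _ [s _ <-]; case: ifP => _; [left|by right].
    by exists (g k s); [exists s|].
  by rewrite finite_setU; split; [exact: finite_image|exact: finite_set1].
have mt : measurable [set s : R | s <= t].
  by rewrite -set_itvNyc; exact: measurable_itv.
move=> y.
have -> : (fun s => if s <= t then w (cl (g k s)) else 0) @^-1` [set y] =
  ([set s | s <= t] `&` \bigcup_(r in [set r | range (g k) r /\ w (cl r) = y]) (g k @^-1` [set r]))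
  `|` (~` [set s | s <= t] `&` [set s | 0 = y]).
  apply/seteqP; split=> s /=; case: ifPn => st.
  - by move=> wy; left; split=> //; exists (g k s) => //; split=> //; exists s.
  - by move=> wy; right; split=> //; exact/negP.
  - by case=> [[_ [r [_ <-] /= ->]]//|[/(_ isT)]].
  - by case=> [[]|[]].
apply: measurableU; apply: measurableI => //.
- apply: fin_bigcup_measurable => [|r _]; last exact: measurable_sfunP.
  by apply: sub_finite_set gfin => r [].
- exact: measurableC.
- have [->|y0] := eqVneq 0 y; first by rewrite (_ : [set _ | _] = setT)//; apply/seteqP; split.
  rewrite (_ : [set _ | _] = set0)//; apply/seteqP; split=> // s /= /eqP.
  by rewrite (negbTE y0).
Qed.

End strong_measurability.

Section L2_functions.
Context {R : realType} {V : hilbertType R}.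
Local Notation leb := (@lebesgue_measure R).
Local Notation I01 := (`[0, 1]%classic : set R).
Implicit Types v w : L2 V.

Lemma L2P v : L2 V (set_val v).
Proof. exact: set_valP. Qed.

Lemma L2_strongly_measurable v : strongly_measurable (set_val v).
Proof. by have [] := L2P v. Qed.

Lemma L2_sqr_integrable v :
  leb.-integrable I01 (EFin \o (fun s => `|set_val v s| ^+ 2)).
Proof.
have [vm vfin] := L2P v; apply/integrableP; split.
  apply/measurable_EFinP; apply: measurable_funX.
  exact: strongly_measurable_norm.
by under eq_integral do rewrite /= ger0_norm ?sqr_ge0//.
Qed.

Lemma L2_inner_integrable v w :
  leb.-integrable I01 (EFin \o (fun s => inner (set_val v s) (set_val w s))).
Proof.
apply: (@dominated_integrable _ _ R leb _ _
  (fun s => 2^-1 * (`|set_val v s| ^+ 2 + `|set_val w s| ^+ 2))) => //.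
- by apply: strongly_measurable_inner; exact: L2_strongly_measurable.
- by apply: integrable_RZ => //; apply: integrable_RD => //; exact: L2_sqr_integrable.
- by move=> s _; exact: inner_AMGM.
Qed.

Lemma L2_sqnorm_ge0 v : 0 <= L2_sqnorm v.
Proof. by apply: Rintegral_ge0 => s _; exact: sqr_ge0. Qed.

Lemma L2_dotvv v : L2_dot v v = L2_sqnorm v.
Proof. by apply: eq_Rintegral => s _; rewrite inner_normE. Qed.

(** From |v - w|^2 >= 0. The left side is affine and weakly continuous in v, with equality at v = w:
    this is the weak lower semicontinuity of the norm. *)
Lemma L2_sqnorm_ge v w : 2 * L2_dot v w - L2_sqnorm w <= L2_sqnorm v.
Proof.
rewrite -RintegralZl//; last exact: L2_inner_integrable.
rewrite -RintegralB//; [|by apply: integrable_RZ => //; exact: L2_inner_integrable|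
  exact: L2_sqr_integrable].
apply: le_Rintegral => //; last 1 first.
- move=> s _; have := sqr_ge0 `|set_val v s - set_val w s|.
  by rewrite sqr_normB; lra.
- apply: integrable_RB => //; last exact: L2_sqr_integrable.
  by apply: integrable_RZ => //; exact: L2_inner_integrable.
- exact: L2_sqr_integrable.
Qed.

Lemma strongly_measurable_L2 (f : R -> V) (B : R) : strongly_measurable f ->
  (forall s, I01 s -> `|f s| <= B) -> L2 V f.
Proof.
move=> fm fB; split=> //.
have : leb.-integrable I01 (EFin \o (fun s => `|f s| ^+ 2)).
  apply: measurable_bounded_integrable => //.
  - by rewrite /= lebesgue_measure_itv/= lte_fin ltr01 -EFinD ltry.
  - by apply: measurable_funX; exact: strongly_measurable_norm.
  - exists (B ^+ 2); split; first exact: num_real.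
    move=> x Bx s Is /=; apply: le_trans (ltW Bx).
    by rewrite ger0_norm ?sqr_ge0// lerXn2r ?nnegrE ?fB// (le_trans _ (fB _ Is)).
case/integrableP => _.
by under eq_integral do rewrite /= ger0_norm ?sqr_ge0//.
Qed.

Lemma L2_weak_nbhs (v : weakL2 V) (w : L2 V) (e : R) : 0 < e ->
  \forall u \near v, `|L2_dot (u : L2 V) w - L2_dot (v : L2 V) w| < e.
Proof.
move=> e0.
have c1 : continuous (fun u : weakL2 V => L2_dot (u : L2 V) w).
  move=> u; apply: (@continuous_comp _ _ _
    (fun v : weakL2 V => L2_dot (v : L2 V) : {ptws L2 V -> R}) (fun h => h w)).
    exact: initial_continuous.
  exact: (@proj_continuous _ (fun=> R) w).
have /cvgrPdist_lt/(_ e e0) := c1 v.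
by apply: filterS => u; rewrite distrC.
Qed.

End L2_functions.

(** * Flows *)

Lemma lipschitz_continuous {R : realType} {U W : normedModType R} (f : U -> W) (L : R) :
  (forall p q, `|f p - f q| <= L * `|p - q|) -> continuous f.
Proof.
move=> fL p; apply/cvgrPdist_le => e e0.
have L1 : 0 < `|L| + 1 by rewrite ltr_wpDl.
near=> q; apply: le_trans (fL _ _) _.
apply: (@le_trans _ _ ((`|L| + 1) * `|p - q|)).
  by rewrite ler_wpM2r// (le_trans (ler_norm _))// lerDl.
rewrite mulrC -ler_pdivlMr; last exact: L1.
by near: q; apply: cvgr_dist_le; [exact: cvg_id|exact: divr_gt0].
Unshelve. all: by end_near. Qed.

Section row_vectors.
Context {R : realType} {n : nat}.
Implicit Types x : 'rV[R]_n.

Lemma coord_le x i : `|x 0 i| <= `|x|.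
Proof.
rewrite [leRHS]/Num.Def.normr/= mx_normrE.
exact: (@le_bigmax _ _ _ (0 : R) (fun j => `|x j.1 j.2|) (0, i)).
Qed.

Lemma norm_row_le x (r : R) : 0 <= r -> (forall i, `|x 0 i| <= r) -> `|x| <= r.
Proof.
move=> r0 xr; rewrite [leLHS]/Num.Def.normr/= mx_normrE.
by apply: bigmax_le => // -[i j] _ /=; rewrite (ord1 i).
Qed.

Lemma within_continuous_row (A : set R) (y : R -> 'rV[R]_n) :
  (forall i, {within A, continuous (fun t => y t 0 i)}) -> {within A, continuous y}.
Proof.
move=> yc t; apply/cvgrPdist_le => e e0.
have : \forall s \near nbhs (t : subspace A), forall i, `|y t 0 i - y s 0 i| <= e.
  apply: filter_forall => i; move: (yc i t) => /cvgrPdist_le; exact.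
apply: filterS => s h; apply: norm_row_le; first exact: ltW.
by move=> i; rewrite !mxE; exact: h.
Qed.

End row_vectors.

Section row_integrals.
Context {R : realType} {n : nat}.
Local Notation leb := (@lebesgue_measure R).
Local Notation I01 := (`[0, 1]%classic : set R).
Implicit Types (g h : R -> 'rV[R]_n).

Definition rint (a b : R) g : 'rV[R]_n := \row_i \int[leb]_(s in `[a, b]) g s 0 i.

Definition rintegrable g := forall i, leb.-integrable I01 (EFin \o (fun s => g s 0 i)).

Lemma rintegrableD g h : rintegrable g -> rintegrable h -> rintegrable (fun s => g s + h s).
Proof.
move=> gi hi i; have := @integrable_RD _ _ R leb I01 _ _ (measurable_itv _) (gi i) (hi i).
by apply: eq_integrable => // s _ /=; rewrite mxE.
Qed.

Lemma rintegrableZ (a : R) g : rintegrable g -> rintegrable (fun s => a *: g s).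
Proof.
move=> gi i; have := @integrable_RZ _ _ R leb I01 a _ (measurable_itv _) (gi i).
by apply: eq_integrable => // s _ /=; rewrite mxE.
Qed.

Lemma rintegrableB g h : rintegrable g -> rintegrable h -> rintegrable (fun s => g s - h s).
Proof.
move=> gi hi; have := rintegrableD gi (rintegrableZ (-1) hi).
by under [fun s => _ + _]eq_fun do rewrite scaleN1r.
Qed.

Variables (a b : R).
Hypotheses (a0 : 0 <= a) (b1 : b <= 1).

Lemma rintD g h : rintegrable g -> rintegrable h ->
  rint a b (fun s => g s + h s) = rint a b g + rint a b h.
Proof.
move=> gi hi; apply/rowP => i; rewrite !mxE.
under eq_Rintegral do rewrite mxE.
by rewrite RintegralD//; apply: integrable_subitv.
Qed.

Lemma rintZ (c : R) g : rintegrable g -> rint a b (fun s => c *: g s) = c *: rint a b g.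
Proof.
move=> gi; apply/rowP => i; rewrite !mxE.
under eq_Rintegral do rewrite mxE.
by rewrite RintegralZl//; apply: integrable_subitv.
Qed.

Lemma rintB g h : rintegrable g -> rintegrable h ->
  rint a b (fun s => g s - h s) = rint a b g - rint a b h.
Proof.
move=> gi hi; rewrite -scaleN1r -rintZ// -rintD//; last exact: rintegrableZ.
by under [in RHS]eq_fun do rewrite scaleN1r.
Qed.

Lemma norm_rint_le g (c : R -> R) : rintegrable g ->
  leb.-integrable `[a, b]%classic (EFin \o c) ->
  (forall s, I01 s -> `|g s| <= c s) ->
  `|rint a b g| <= \int[leb]_(s in `[a, b]) c s.
Proof.
move=> gi ci gc; have sub := subitv_I01 a0 b1; apply: norm_row_le.
  by apply: Rintegral_ge0 => s /sub Is; exact: le_trans (gc _ Is).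
move=> i; rewrite mxE; apply: norm_Rintegral_le => //.
  by apply: measurable_subitv => //; apply/measurable_EFinP; case/integrableP: (gi i).
by move=> s /sub Is; apply: le_trans (coord_le _ _) _; exact: gc.
Qed.

End row_integrals.

Section flows.
Context {R : realType} {n : nat} {V : hilbertType R}.
Variable ev : V -> 'rV[R]_n -> 'rV[R]_n.
Local Notation leb := (@lebesgue_measure R).
Local Notation I01 := (`[0, 1]%classic : set R).

(** All that the flows use of the embedding in C_0^2. Only values and finite differences appear, so
    the estimates are integral inequalities with coefficient B |v_s|, without derivatives in
    space. *)
Record C11_fields (B : R) : Prop := {
  field_linear : forall a h k (p : 'rV[R]_n), ev (a *: h + k) p = a *: ev h p + ev k p;
  field_bounded : forall h (p : 'rV[R]_n), `|ev h p| <= B * `|h|;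
  field_lipschitz : forall h (p q : 'rV[R]_n), `|ev h p - ev h q| <= B * `|h| * `|p - q|;
  field_diff2 : forall h (p q : 'rV[R]_n),
    `|ev h (p + q) + ev h (p - q) - 2 *: ev h p| <= B * `|h| * `|q| ^+ 2 }.

Variable B : R.
Hypothesis B0 : 0 <= B.
Hypothesis evP : C11_fields B.

Lemma fieldB h k p : ev (h - k) p = ev h p - ev k p.
Proof. by rewrite addrC -scaleN1r (field_linear evP) scaleN1r addrC. Qed.

Lemma continuous_field_coord h i : continuous (fun p : 'rV[R]_n => ev h p 0 i).
Proof.
apply: (@lipschitz_continuous _ _ _ _ (B * `|h|)) => p q.
apply: le_trans (field_lipschitz evP _ _ _).
by have := coord_le (ev h p - ev h q) i; rewrite !mxE.
Qed.

Lemma continuous_field_vector p i : continuous (fun h => ev h p 0 i).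
Proof.
apply: (@lipschitz_continuous _ _ _ _ B) => h k.
apply: le_trans (field_bounded evP _ p); rewrite fieldB.
by have := coord_le (ev h p - ev k p) i; rewrite !mxE.
Qed.

Definition bound (v : L2 V) s : R := B * `|set_val v s|.

(** The factor B^2 makes M a bound for the integral of [bound v] squared, so that [rate M] serves
    all admissible v at once. *)
Definition admissible (M : R) (v : L2 V) := B ^+ 2 * L2_sqnorm v <= M.

Let c_ge0 v s : 0 <= bound v s.
Proof. by rewrite mulr_ge0. Qed.

Let c_meas v : measurable_fun I01 (bound v).
Proof.
by apply: measurable_funM => //; apply: strongly_measurable_norm; exact: L2_strongly_measurable.
Qed.

Let c2_int v : leb.-integrable I01 (EFin \o (fun s => bound v s ^+ 2)).
Proof.
have := @integrable_RZ _ _ R leb I01 (B ^+ 2) _ (measurable_itv _) (L2_sqr_integrable v).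
by apply: eq_integrable => // s _ /=; rewrite exprMn.
Qed.

Let c2_le M v : admissible M v -> \int[leb]_(s in `[0, 1]) bound v s ^+ 2 <= M.
Proof.
move=> vM; under eq_Rintegral do rewrite exprMn.
by rewrite RintegralZl//; exact: L2_sqr_integrable.
Qed.

Let c_int v : leb.-integrable I01 (EFin \o bound v).
Proof.
apply: (@dominated_integrable _ _ R leb _ _
  (fun s => 2^-1 * (bound v s ^+ 2 + 1))) => //.
- exact: c_meas.
- apply: integrable_RZ => //; apply: integrable_RD => //; exact: integrable_cst_itv.
- move=> s _; rewrite ger0_norm//; have := sqr_ge0 (bound v s - 1).
  by rewrite sqrrB -[_ *+ 2]mulr_natl; lra.
Qed.

Let Mge0 M v : admissible M v -> 0 <= M.
Proof. by apply: le_trans; rewrite mulr_ge0 ?sqr_ge0 ?L2_sqnorm_ge0. Qed.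

Let rate0 M v : admissible M v -> 0 < rate M.
Proof. by move=> /Mge0 M0; rewrite /rate mulr_gt0// ltr_wpDl. Qed.

Let wE_int (v : L2 V) (N k a b : R) : 0 <= a -> b <= 1 ->
  leb.-integrable `[a, b]%classic (EFin \o (fun s => bound v s * (N * expR (k * s)))).
Proof.
move=> a0 b1; apply: integrable_subitv => //.
have wc : continuous (fun s : R => N * expR (k * s)).
  move=> s; apply: (@continuous_comp _ _ _ (fun s : R => expR (k * s)) ( *%R N)).
    exact: continuous_expRM.
  exact: mulrl_continuous.
apply: (@dominated_integrable _ _ R leb _ _
  (fun s => 2^-1 * (bound v s ^+ 2 + (N * expR (k * s)) ^+ 2))) => //.
- apply: measurable_funM; first exact: c_meas.
  by apply: measurable_funTS; exact: continuous_measurable_fun.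
- apply: integrable_RZ => //; apply: integrable_RD => //.
  by apply: integrable_continuous_itv => s; exact: (continuousM (wc s) (wc s)).
- move=> s _; have := sqr_ge0 (bound v s - `|N * expR (k * s)|).
  set z := N * _; rewrite (normrM (bound v s)) (ger0_norm (c_ge0 v s)).
  rewrite -[X in _ -> _ <= _ * (_ + X)]real_normK ?num_real//.
  by rewrite sqrrB -[_ *+ 2]mulr_natl; lra.
Qed.

Let rint_forward M v N (g : R -> 'rV[R]_n) t : admissible M v -> 0 <= N ->
  rintegrable g -> 0 <= t <= 1 ->
  (forall s, I01 s -> `|g s| <= bound v s * (N * expR (rate M * s))) ->
  `|rint 0 t g| <= 2^-1 * N * expR (rate M * t).
Proof.
move=> vM N0 gi t01 gB; have /andP[t0 t1] := t01.
apply: le_trans (norm_rint_le _ _ gi _ gB) _ => //; first exact: wE_int.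
under eq_Rintegral do rewrite mulrCA.
rewrite RintegralZl//; last first.
  have := @wE_int v 1 (rate M) 0 t (lexx _) t1.
  by apply: eq_integrable => // s _ /=; rewrite mul1r.
rewrite -mulrA mulrCA ler_wpM2l//.
apply: forward_weight => //; exact: c2_le.
Qed.

Let rint_backward M v N (g : R -> 'rV[R]_n) t : admissible M v -> 0 <= N ->
  rintegrable g -> 0 <= t <= 1 ->
  (forall s, I01 s -> `|g s| <= bound v s * (N * expR (rate M * (1 - s)))) ->
  `|rint t 1 g| <= 2^-1 * N * expR (rate M * (1 - t)).
Proof.
move=> vM N0 gi t01 gB; have /andP[t0 t1] := t01.
have iE N' : leb.-integrable `[t, 1]%classic
    (EFin \o (fun s => bound v s * (N' * expR (rate M * (1 - s))))).
  have := @wE_int v (N' * expR (rate M)) (- rate M) t 1 t0 (lexx _).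
  apply: eq_integrable => // s _ /=; rewrite -mulrA -expRD.
  by congr (_ * (_ * expR _))%:E; ring.
apply: le_trans (norm_rint_le _ _ gi _ gB) _ => //.
under eq_Rintegral do rewrite mulrCA.
rewrite RintegralZl//; last first.
  by have := iE 1; apply: eq_integrable => // s _ /=; rewrite mul1r.
rewrite -mulrA mulrCA ler_wpM2l//.
apply: backward_weight => //; exact: c2_le.
Qed.

Lemma continuous_curve_measurable (v : L2 V) (y : R -> 'rV[R]_n) i :
  {within I01, continuous y} -> measurable_fun I01 (fun s => ev (set_val v s) (y s) 0 i).
Proof.
move=> yc; apply: (@caratheodory_measurable R V (fun h s => ev h (y s) 0 i)).
- exact: L2_strongly_measurable.
- move=> h; apply: subspace_continuous_measurable_fun => //.
  move=> s; apply: (@continuous_comp _ _ _ (y : subspace I01 -> _) (fun p => ev h p 0 i)).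
    exact: yc.
  exact: continuous_field_coord.
- by move=> s _ h; exact: continuous_field_vector.
Qed.

Section existence.
Variables (v : L2 V) (x : 'rV[R]_n).

Let meas (y : R -> 'rV[R]_n) := forall i,
  measurable_fun I01 (fun s => ev (set_val v s) (y s) 0 i).

Let meas_int y : meas y -> rintegrable (fun s => ev (set_val v s) (y s)).
Proof.
move=> my i; apply: (@dominated_integrable _ _ R leb _ _ (bound v)).
- by [].
- exact: my.
- exact: c_int.
move=> s _; exact: le_trans (coord_le _ _) (field_bounded evP _ _).
Qed.

Let cont_meas (y : R -> 'rV[R]_n) : {within I01, continuous y} -> meas y.
Proof. by move=> yc i; exact: continuous_curve_measurable. Qed.

Let step (y : R -> 'rV[R]_n) (t : R) : 'rV[R]_n :=
  x + rint 0 t (fun s => ev (set_val v s) (y s)).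

Let step_cont y : meas y -> {within I01, continuous (step y)}.
Proof.
move=> my; apply: within_continuous_row => i.
have h := parameterized_integral_continuous (@ler01 R) (meas_int my i).
have -> : (fun t => step y t 0 i) = (fun t => x 0 i +
    parameterized_integral leb 0 t (fun s => ev (set_val v s) (y s) 0 i)).
  by apply/funext => t; rewrite !mxE.
by move=> t; apply: cvgD; [exact: cvg_cst|exact: h].
Qed.

Let M := B ^+ 2 * L2_sqnorm v.
Let vM : admissible M v. Proof. exact: lexx. Qed.
Let w t := expR (rate M * t).

Let step_diff y z N : meas y -> meas z -> 0 <= N ->
  (forall s, I01 s -> `|y s - z s| <= N * w s) ->
  forall t, I01 t -> `|step y t - step z t| <= 2^-1 * N * w t.
Proof.
move=> my mz N0 yz t /=; rewrite in_itv/= => t01; have /andP[t0 t1] := t01.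
rewrite /step opprD addrACA subrr add0r -rintB//; try exact: meas_int.
apply: (rint_forward (v := v)) => //.
  by apply: rintegrableB; exact: meas_int.
move=> s Is; apply: le_trans (field_lipschitz evP _ _ _) _.
by rewrite ler_wpM2l ?c_ge0//; exact: yz.
Qed.

Let y k := iter k step (fun=> x).

Let y_meas k : meas (y k).
Proof.
case: k => [|k]; apply: cont_meas.
  by apply: continuous_subspaceT; exact: cst_continuous.
elim: k => [|k IH]; apply: step_cont.
  by apply: cont_meas; apply: continuous_subspaceT; exact: cst_continuous.
exact: cont_meas.
Qed.

Let N0 := \int[leb]_(s in `[0, 1]) bound v s.

Let N0_ge0 : 0 <= N0. Proof. by apply: Rintegral_ge0 => s _. Qed.

Let w1 t : I01 t -> 1 <= w t.
Proof.
rewrite /= in_itv/= => /andP[t0 _]; rewrite -expR0 ler_expR mulr_ge0// ltW//.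
exact: rate0 vM.
Qed.

Let y_diff k t : I01 t -> `|y k.+1 t - y k t| <= N0 * w t * 2^-1 ^+ k.
Proof.
elim: k t => [|k IH] t It.
  rewrite /y/= /step addrAC subrr add0r expr0 mulr1.
  move: (It); rewrite /= in_itv/= => /andP[t0 t1].
  apply: (@le_trans _ _ N0); last by rewrite ler_peMr// w1.
  apply: le_trans (norm_rint_le _ _ (meas_int (y_meas 0)) (c := bound v) _ _) _ => //.
  - exact: integrable_subitv.
  - by move=> s _; exact: field_bounded.
  - exact: Rintegral_subitv_le.
rewrite [y k.+2]/= [y k.+1]/= exprS mulrCA mulrA.
have := @step_diff (y k.+1) (y k) (N0 * 2^-1 ^+ k) (@y_meas _) (@y_meas _) _ _ t It.
rewrite mulr_ge0 ?exprn_ge0// => /(_ isT) h.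
apply: le_trans (h _) _; last by rewrite !mulrA mulrAC.
by move=> s Is; rewrite mulrAC; exact: IH.
Qed.

(** Picard iteration. In the weighted norm the ratio is 1/2 on the whole of [0, 1], so no local
    solutions have to be glued. *)
Lemma flow_curve_exists : exists z : R -> 'rV[R]_n,
  rintegrable (fun s => ev (set_val v s) (z s)) /\
  forall t, I01 t -> z t = x + rint 0 t (fun s => ev (set_val v s) (z s)).
Proof.
have lim t : exists l : 'rV[R]_n, I01 t -> (y ^~ t) @ \oo --> l /\
    forall k, `|l - y k t| <= 2 * (N0 * w t) * 2^-1 ^+ k.
  have [It|It] := pselect (I01 t); last by exists 0.
  by have [l lP] := @geometric_increments_cvg R _ (y ^~ t) _ (fun k => @y_diff k t It); exists l.
have [z zP] := choice lim.
(* Measurability along z is obtained as a limit of that along the iterates, before anything is known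
   about the continuity of z. *)
have mz : meas z.
  move=> i; apply: (measurable_fun_cvg (fun k => @y_meas k i)) => s Is.
  apply: (@continuous_cvg _ _ _ _ _ _ (fun p => ev (set_val v s) p 0 i) (z s)).
    exact: continuous_field_coord.
  by have [] := zP s Is.
exists z; split; first exact: meas_int.
move=> t It; have [yz _] := zP t It.
have yz' : y k.+1 t @[k --> \oo] --> z t by rewrite (cvg_shiftS (y ^~ t)).
suff ys : y k.+1 t @[k --> \oo] --> step z t.
  exact: (cvg_unique (@norm_hausdorff _ _) yz' ys).
apply/cvgrPdist_le => e e0.
have : geometric (N0 * w t) (2^-1 : R) @ \oo --> (0 : R).
  by apply: cvg_geometric; rewrite ger0_norm ?invr_ge0// invf_lt1// ltr1n.
move=> /cvgrPdist_le/(_ e e0); apply: filterS => k.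
rewrite sub0r normrN /geometric/= => /(le_trans (ler_norm _)); apply: le_trans.
have := @step_diff z (y k) (2 * N0 * 2^-1 ^+ k) mz (@y_meas _) _ _ t It.
rewrite !mulr_ge0 ?exprn_ge0// => /(_ isT) h.
apply: le_trans (h _) _.
  move=> s Is; have [_ /(_ k)] := zP s Is.
  by move/le_trans; apply; rewrite -!mulrA (mulrC (w s)) lexx.
by rewrite -!mulrA mulKf ?pnatr_eq0// (mulrC (w t)).
Qed.

End existence.

Definition field_flow (v : L2 V) := flow (fun t => ev (set_val v t)).

(** Solutions from all starting points, assembled by choice, show that [xget] in [flow] does not
    return its default value. *)
Lemma flowP v x : rintegrable (fun s => ev (set_val v s) (field_flow v s x)) /\
  forall t, I01 t -> field_flow v t x = x + rint 0 t (fun s => ev (set_val v s) (field_flow v s x)).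
Proof.
have [phi phiP] := choice (flow_curve_exists v).
have : is_flow (fun t => ev (set_val v t)) (field_flow v).
  rewrite /field_flow /flow; case: xgetP => [p -> //|/(_ (fun t x => phi x t))[]].
  move=> z i; have [zi zE] := phiP z; split; first exact: zi.
  by move=> t t01; rewrite {1}zE ?in_itv//= !mxE.
move=> fl; split=> [i|t It]; first by have [] := fl x i.
by apply/rowP => i; have [_ ->] := fl x i; rewrite ?mxE.
Qed.

Lemma continuous_curve_rintegrable (u : L2 V) (y : R -> 'rV[R]_n) :
  {within I01, continuous y} -> rintegrable (fun s => ev (set_val u s) (y s)).
Proof.
move=> yc i; apply: (@dominated_integrable _ _ R leb _ _ (bound u)).
- by [].
- exact: continuous_curve_measurable.
- exact: c_int.
- by move=> s _; exact: le_trans (coord_le _ _) (field_bounded evP _ _).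
Qed.

Local Notation phi := field_flow.
Local Notation velocity v x := (fun s => ev (set_val v s) (phi v s x)).

Lemma flow_continuous v x : {within I01, continuous ((phi v)^~ x)}.
Proof.
have [fi fE] := flowP v x.
apply: (@subspace_eq_continuous _ _ _ (fun t => x + rint 0 t (velocity v x))).
  by move=> t /set_mem It; rewrite /from_subspace (fE _ It).
apply: within_continuous_row => i.
have h := parameterized_integral_continuous (@ler01 R) (fi i).
have -> : (fun t => (x + rint 0 t (velocity v x)) 0 i) = (fun t => x 0 i +
    parameterized_integral leb 0 t (fun s => velocity v x s 0 i)).
  by apply/funext => t; rewrite !mxE.
by move=> t; apply: cvgD; [exact: cvg_cst|exact: h].
Qed.

Let w1 M v t : admissible M v -> 0 <= t -> 1 <= expR (rate M * t).
Proof. by move=> /rate0 r t0; rewrite -expR0 ler_expR mulr_ge0// ltW. Qed.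

Lemma flow_dist v x t : I01 t -> `|phi v t x - x| <= \int[leb]_(s in `[0, 1]) bound v s.
Proof.
move=> It; have [fi fE] := flowP v x; rewrite fE// addrAC subrr add0r.
move: It; rewrite /= in_itv/= => /andP[t0 t1].
apply: le_trans (norm_rint_le _ _ fi (c := bound v) _ _) _ => //.
- exact: integrable_subitv.
- by move=> s _; exact: field_bounded.
- exact: Rintegral_subitv_le.
Qed.

Let E (M : R) : R := expR (rate M).

Let w_le M v t : admissible M v -> t <= 1 -> expR (rate M * t) <= E M.
Proof. by move=> /rate0 r t1; rewrite ler_expR ler_piMr// ltW. Qed.

(** The a priori bound from which the iteration of [weighted_gronwall] starts. *)
Let flow_diff_bounded v x y : exists N : R, 0 <= N /\
  forall t, I01 t -> `|phi v t x - phi v t y| <= N.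
Proof.
pose N0 := \int[leb]_(s in `[0, 1]) bound v s.
have N00 : 0 <= N0 by apply: Rintegral_ge0 => s _.
exists (N0 + `|x - y| + N0); split; first by rewrite !addr_ge0.
move=> t It.
have -> : phi v t x - phi v t y = (phi v t x - x) + (x - y) - (phi v t y - y).
  by rewrite addrA addrNK opprB addrA addrNK.
apply: le_trans (ler_normB _ _) _; apply: lerD; last exact: flow_dist.
by apply: le_trans (ler_normD _ _) _; rewrite lerD2r; exact: flow_dist.
Qed.

Lemma flow_lipschitz M v x y t : admissible M v -> I01 t ->
  `|phi v t x - phi v t y| <= 2 * `|x - y| * expR (rate M).
Proof.
move=> vM It.
have [fx xE] := flowP v x; have [fy yE] := flowP v y.
have [N0 [N00 N0P]] := flow_diff_bounded v x y.
apply: (@le_trans _ _ (2 * `|x - y| * expR (rate M * t))); last first.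
  rewrite ler_wpM2l ?mulr_ge0//; apply: (w_le vM).
  by move: It; rewrite /= in_itv/= => /andP[].
apply: (@weighted_gronwall R (fun t => `|phi v t x - phi v t y|)
  (fun t => expR (rate M * t)) _ N0 I01) => //.
- by move=> s /=; rewrite in_itv/= => /andP[s0 _]; exact: w1 vM _.
- move=> s Is; apply: le_trans (N0P s Is) _; rewrite ler_peMr//.
  by move: Is; rewrite /= in_itv/= => /andP[s0 _]; exact: w1 vM _.
move=> N N0' NP s Is; rewrite xE// yE// opprD addrACA -rintB//.
- apply: le_trans (ler_normD _ _) _; rewrite lerD2l.
  apply: (rint_forward vM) => //; first exact: rintegrableB.
  move=> r Ir; apply: le_trans (field_lipschitz evP _ _ _) _.
  by rewrite ler_wpM2l ?c_ge0//; exact: NP.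
- by move: Is; rewrite /= in_itv/= => /andP[].
Qed.

Let flow_end v x t : I01 t -> phi v t x = phi v 1 x - rint t 1 (velocity v x).
Proof.
move=> It; have [fi fE] := flowP v x.
rewrite !fE//; last by rewrite /= in_itv/= ler01 lexx.
have -> : rint 0 1 (velocity v x) = rint 0 t (velocity v x) + rint t 1 (velocity v x).
  move: It; rewrite /= in_itv/= => /andP[t0 t1].
  by apply/rowP => i; rewrite !mxE; apply: Rintegral_split.
by rewrite addrA addrK.
Qed.

Lemma flow0 v x : phi v 0 x = x.
Proof.
have [_ ->] := flowP v x; last by rewrite /= in_itv/= lexx ler01.
suff -> : rint 0 0 (velocity v x) = 0 by rewrite addr0.
by apply/rowP => i; rewrite !mxE set_itv1 Rintegral_set1.
Qed.

(** Gronwall run backwards from time 1. This makes the Jacobians of the flow invertible. *)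
Lemma flow_lower M v x y : admissible M v ->
  `|x - y| <= 2 * `|phi v 1 x - phi v 1 y| * expR (rate M).
Proof.
move=> vM; have [fx xE] := flowP v x; have [fy yE] := flowP v y.
have [N0 [N00 N0P]] := flow_diff_bounded v x y.
have I0 : I01 0 by rewrite /= in_itv/= lexx ler01.
have w1' s : I01 s -> 1 <= expR (rate M * (1 - s)).
  by rewrite /= in_itv/= => /andP[_ s1]; apply: (w1 vM); rewrite subr_ge0.
rewrite -[in leLHS](flow0 v x) -[in leLHS](flow0 v y).
have := @weighted_gronwall R (fun t => `|phi v t x - phi v t y|)
  (fun t => expR (rate M * (1 - t))) `|phi v 1 x - phi v 1 y| N0 I01 (normr_ge0 _) w1' _ _ 0 I0.
rewrite subr0 mulr1; apply.
  move=> s Is; apply: le_trans (N0P s Is) _; rewrite ler_peMr//.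
  exact: w1'.
move=> N N0' NP s Is; rewrite (flow_end v x Is) (flow_end v y Is).
rewrite opprD addrACA opprK; apply: le_trans (ler_normD _ _) _; rewrite lerD2l.
move: (Is); rewrite /= in_itv/= => s01; have /andP[s0 s1] := s01.
rewrite addrC -rintB//; apply: (rint_backward vM) => //; first exact: rintegrableB.
move=> r Ir; rewrite distrC; apply: le_trans (field_lipschitz evP _ _ _) _.
by rewrite ler_wpM2l ?c_ge0//; exact: NP.
Qed.

(** For the outer trajectories a = m + q and b = m - q and the middle one c, the second difference
    of velocities splits into that of the field at m, of order |q|^2, and 2 (ev m - ev c), of order
    |a + b - 2 c|. The Lipschitz bound on the flow makes the first of order |h|^2; the second is the
    Gronwall term. *)
Lemma flow_diff2 M v x h : admissible M v ->
  `|phi v 1 (x + h) + phi v 1 (x - h) - 2 *: phi v 1 x| <=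
  4 * expR (rate M) ^+ 4 * `|h| ^+ 2.
Proof.
move=> vM.
have [fa aE] := flowP v (x + h); have [fb bE] := flowP v (x - h).
have [fc cE] := flowP v x.
pose a t := phi v t (x + h); pose b t := phi v t (x - h); pose c t := phi v t x.
pose f t := `|a t + b t - 2 *: c t|.
pose G s := ev (set_val v s) (a s) + ev (set_val v s) (b s) - 2 *: ev (set_val v s) (c s).
have Gi : rintegrable G.
  by apply: rintegrableB; [exact: rintegrableD|exact: rintegrableZ].
have fE t : I01 t -> f t = `|rint 0 t G|.
  move=> It; move: (It); rewrite /= in_itv/= => /andP[t0 t1].
  rewrite /f /a /b /c aE// bE// cE// /G rintB//; last 2 first.
    exact: rintegrableD.
    exact: rintegrableZ.
  rewrite rintD// rintZ//; congr `|_|.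
  rewrite (addrACA (x + h)) scalerDr opprD (addrACA (x + h + (x - h))) (addrACA x h).
  by rewrite subrr addr0 [2 *: x]scaler_nat mulr2n subrr add0r.
have I1 : I01 1 by rewrite /= in_itv/= ler01 lexx.
have E1 : 1 <= E M by have := w1 vM (@ler01 R); rewrite mulr1.
(* The square is the bound of |q|^2 by the Lipschitz estimate, 1/2 is the contraction factor of
   [rint_forward], and the last factor dominates the weight. *)
pose A := 2^-1 * (2 * `|h| * E M) ^+ 2 * E M.
have A0 : 0 <= A by rewrite !mulr_ge0 ?sqr_ge0 ?expR_ge0.
have w1' s : I01 s -> 1 <= expR (rate M * s).
  by rewrite /= in_itv/= => /andP[s0 _]; exact: w1 vM _.
have [N0 [N00 N0P]] : exists N : R, 0 <= N /\ forall t, I01 t -> f t <= N.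
  have [N1 [N10 N1P]] := flow_diff_bounded v (x + h) x.
  have [N2 [N20 N2P]] := flow_diff_bounded v (x - h) x.
  exists (N1 + N2); split; first exact: addr_ge0.
  move=> t It; rewrite /f.
  have -> : a t + b t - 2 *: c t = (a t - c t) + (b t - c t).
    by rewrite scaler_nat mulr2n opprD addrACA.
  apply: le_trans (ler_normD _ _) _.
  by apply: lerD; [exact: N1P|exact: N2P].
have := @weighted_gronwall R f (fun t => expR (rate M * t)) A N0 I01 A0 w1' _ _ 1 I1.
rewrite mulr1 => /(_ _ _)/le_trans; apply; last first.
- rewrite /A -/(E M).
  have -> : 2 * (2^-1 * (2 * `|h| * E M) ^+ 2 * E M) * E M = 4 * E M ^+ 4 * `|h| ^+ 2 by field.
  exact: lexx.
- move=> N N0' NP t It; rewrite fE//.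
  move: (It); rewrite /= in_itv/= => t01; have /andP[t0 t1] := t01.
  have wt : expR (rate M * t) <= E M by exact: w_le vM _.
  apply: (@le_trans _ _ (2^-1 * ((2 * `|h| * E M) ^+ 2 + N) * expR (rate M * t))); last first.
    rewrite mulrDr mulrDl lerD2r /A ler_wpM2l// mulr_ge0 ?sqr_ge0//.
  apply: (rint_forward vM) => //; first by rewrite addr_ge0 ?sqr_ge0.
  move=> s Is.
  pose m := 2^-1 *: (a s + b s); pose q := 2^-1 *: (a s - b s).
  have half z : 2^-1 *: (z + z) = z :> 'rV[R]_n.
    by rewrite scalerDr -scalerDl (_ : 2^-1 + 2^-1 = 1 :> R) ?scale1r//; lra.
  have mq : m + q = a s by rewrite /m /q -scalerDr addrACA subrr addr0 half.
  have mq' : m - q = b s.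
    by rewrite /m /q -scalerBr opprB [b s - a s]addrC addrACA subrr add0r half.
  have ab : `|q| <= 2 * `|h| * E M.
    rewrite normrZ ger0_norm ?invr_ge0// ler_pdivrMl//.
    apply: le_trans (flow_lipschitz _ _ vM Is) _.
    have -> : x + h - (x - h) = h *+ 2 by rewrite opprB addrC addrA subrK mulr2n.
    by rewrite -/(E M) normrMn -[`|h| *+ 2]mulr_natl !mulrA.
  have d2 := field_diff2 evP (set_val v s) m q; rewrite mq mq' in d2.
  have d1 := field_lipschitz evP (set_val v s) m (c s).
  have -> : G s = (ev (set_val v s) (a s) + ev (set_val v s) (b s) - 2 *: ev (set_val v s) m) +
      2 *: (ev (set_val v s) m - ev (set_val v s) (c s)).
    by rewrite scalerBr addrA addrNK.
  apply: le_trans (ler_normD _ _) _.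
  have mc : 2 * `|m - c s| = f s.
    rewrite /f -[X in X * _ = _]ger0_norm// -normrZ scalerBr scalerA mulfV ?pnatr_eq0//.
    by rewrite scale1r.
  rewrite normrZ ger0_norm//.
  apply: (@le_trans _ _ (bound v s * (`|q| ^+ 2 + f s))).
    rewrite mulrDr; apply: lerD => //.
    by rewrite -mc mulrCA ler_wpM2l ?c_ge0.
  rewrite ler_wpM2l ?c_ge0// mulrDl; apply: lerD; last exact: NP.
  apply: (@le_trans _ _ ((2 * `|h| * E M) ^+ 2)).
    by rewrite lerXn2r ?nnegrE ?mulr_ge0 ?expR_ge0.
  by rewrite ler_peMr ?sqr_ge0// w1'.
- move=> s Is; apply: le_trans (N0P s Is) _; rewrite ler_peMr//.
  exact: w1'.
Qed.

Let drift (u v : L2 V) x s := ev (set_val u s) (phi v s x) - ev (set_val v s) (phi v s x).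

Let drift_int u v x : rintegrable (drift u v x).
Proof. by apply: rintegrableB; apply: continuous_curve_rintegrable; exact: flow_continuous. Qed.

(** The difference u(phi_u) - v(phi_v) is the drift u(phi_v) - v(phi_v) plus u(phi_u) - u(phi_v),
    which goes to Gronwall. The drift enters through its integral and not through its norm, and it
    lives on the trajectory of v: this is what weak convergence can make small. *)
Lemma flow_perturbation M u v x e : admissible M u -> 0 <= e ->
  (forall t, I01 t -> `|rint 0 t (drift u v x)| <= e) ->
  `|phi u 1 x - phi v 1 x| <= 2 * e * expR (rate M).
Proof.
move=> uM e0 De.
have [fu uE] := flowP u x; have [fv vE] := flowP v x.
have I1 : I01 1 by rewrite /= in_itv/= ler01 lexx.
have w1' s : I01 s -> 1 <= expR (rate M * s).
  by rewrite /= in_itv/= => /andP[s0 _]; exact: w1 uM _.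
pose N0 := \int[leb]_(s in `[0, 1]) bound u s + \int[leb]_(s in `[0, 1]) bound v s.
have N00 : 0 <= N0 by rewrite addr_ge0//; apply: Rintegral_ge0 => s _.
have := @weighted_gronwall R (fun t => `|phi u t x - phi v t x|)
  (fun t => expR (rate M * t)) e N0 I01 e0 w1' _ _ 1 I1.
rewrite mulr1; apply.
- move=> s Is; apply: (@le_trans _ _ N0); last by rewrite ler_peMr// w1'.
  rewrite -[phi u s x](subrK x) -addrA -[x - _]opprB.
  apply: le_trans (ler_normB _ _) _.
  by apply: lerD; exact: flow_dist.
move=> N N0' NP t It; move: (It); rewrite /= in_itv/= => t01; have /andP[t0 t1] := t01.
have gi : rintegrable (fun s => velocity u x s - ev (set_val u s) (phi v s x)).
  by apply: rintegrableB; [exact: fu|apply: continuous_curve_rintegrable; exact: flow_continuous].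
rewrite uE// vE// opprD addrACA subrr add0r -rintB//.
have -> : rint 0 t (fun s => velocity u x s - velocity v x s) =
    rint 0 t (drift u v x) + rint 0 t (fun s => velocity u x s - ev (set_val u s) (phi v s x)).
  rewrite -rintD//; congr rint; apply/funext => s.
  by rewrite /drift [RHS]addrC addrA addrNK.
apply: le_trans (ler_normD _ _) _; apply: lerD; first exact: De.
apply: (rint_forward uM) => // s Is; apply: le_trans (field_lipschitz evP _ _ _) _.
by rewrite ler_wpM2l ?c_ge0//; exact: NP.
Qed.

(* The i-th coordinate of the drift is a weakly continuous function of u: it is
   the L^2 product of u - v with the representers of the evaluations along the
   flow of v, cut off at time t. *)
Let drift_near_point (v : weakL2 V) x t e : I01 t -> 0 < e ->
  \forall u \near v, `|rint 0 t (drift u v x)| <= e.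
Proof.
move=> It e0.
have /choice[k kP] : forall pi : 'rV[R]_n * 'I_n, exists k : V,
    forall h, ev h pi.1 0 pi.2 = inner k h.
  move=> [p i]; apply: (@riesz _ _ (fun h => ev h p 0 i) B).
    by move=> a h l; rewrite (field_linear evP) !mxE.
  by move=> h; exact: le_trans (coord_le _ _) (field_bounded evP _ _).
have k_le pi : `|k pi| <= B.
  have [->|k0] := eqVneq (k pi) 0; first by rewrite normr0.
  have k0' : 0 < `|k pi| by rewrite normr_gt0.
  rewrite -(ler_pM2r k0') -expr2 -inner_normE -kP.
  apply: le_trans (ler_norm _) _.
  exact: le_trans (coord_le _ _) (field_bounded evP _ _).
have k_lip i p q : `|k (p, i) - k (q, i)| <= B * `|p - q|.
  set d := k (p, i) - k (q, i).
  have [->|k0] := eqVneq d 0; first by rewrite normr0 mulr_ge0.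
  have k0' : 0 < `|d| by rewrite normr_gt0.
  rewrite -(ler_pM2r k0') -expr2 -inner_normE {1}/d innerBl -!kP/=.
  rewrite mulrAC; apply: le_trans (ler_norm _) _; apply: le_trans (field_lipschitz evP d p q).
  by have := coord_le (ev d p - ev d q) i; rewrite !mxE.
pose w i s : V := if s <= t then k (phi v s x, i) else 0.
have wL2 i : L2 V (w i).
  apply: (@strongly_measurable_L2 _ _ _ B); last first.
    by move=> s _; rewrite /w; case: ifP => _//; rewrite normr0.
  apply: continuous_strongly_measurable => s.
  apply: (@continuous_comp _ _ _ ((phi v)^~ x : subspace I01 -> _) (fun p => k (p, i))).
    exact: flow_continuous.
  exact: (lipschitz_continuous (k_lip i)).
pose W i : L2 V := exist (fun f => f \in L2 V) (w i) (mem_set (wL2 i)).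
have dotW (u : L2 V) i : L2_dot u (W i) =
    \int[leb]_(s in `[0, t]) ev (set_val u s) (phi v s x) 0 i.
  have -> : (`[0, t]%classic : set R) = I01 `&` [set s | s <= t].
    apply/seteqP; split=> s /=; rewrite !in_itv/=.
      move: It; rewrite /= in_itv/= => /andP[_ t1] /andP[-> st]; split=> //=.
      exact: le_trans t1.
    by move=> [/andP[-> _] ->].
  rewrite Rintegral_mkcondr; apply: eq_Rintegral => s _.
  rewrite patchE (_ : set_val (W i) s = w i s)// /w.
  have [st|st] := boolP (s <= t); first by rewrite mem_set//= innerC -(kP (_, i)).
  by rewrite memNset 1?innerC ?inner0l//=; exact/negP.
have : \forall u \near v, forall i, `|L2_dot (u : L2 V) (W i) - L2_dot (v : L2 V) (W i)| < e.
  apply: (@filter_forall _ _ (fun i (u : weakL2 V) =>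
    `|L2_dot (u : L2 V) (W i) - L2_dot (v : L2 V) (W i)| < e) (nbhs v) (nbhs_filter v)) => i.
  exact: L2_weak_nbhs.
apply: filterS => u h; apply: norm_row_le; first exact: ltW.
move: It; rewrite /= in_itv/= => /andP[t0 t1].
have ci (z : L2 V) := continuous_curve_rintegrable z (@flow_continuous v x).
by move=> i; rewrite /drift rintB// !mxE -!dotW; exact: ltW.
Qed.

Let rint_increment (g : R -> 'rV[R]_n) (c : R -> R) (t s : R) :
  rintegrable g -> leb.-integrable I01 (EFin \o c) ->
  (forall r, I01 r -> `|g r| <= c r) -> 0 <= s -> s <= t -> t <= 1 ->
  `|rint 0 t g - rint 0 s g| <= \int[leb]_(r in `[s, t]) c r.
Proof.
move=> gi ci gc s0 st t1; have t0 := le_trans s0 st; have s1 := le_trans st t1.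
suff -> : rint 0 t g - rint 0 s g = rint s t g.
  by apply: norm_rint_le => //; exact: integrable_subitv.
apply/rowP => i; rewrite !mxE.
have git := integrable_subitv (lexx 0) t1 (gi i).
have giot : leb.-integrable `]s, t]%classic (EFin \o (fun r => g r 0 i)).
  apply: integrableS (gi i) => // r /=; rewrite !in_itv/= => /andP[sr rt].
  by rewrite (le_trans s0 (ltW sr)) (le_trans rt).
by rewrite -(Rintegral_itv_obnd_cbnd giot) -(@Rintegral_itvB _ _ (BLeft 0) (BRight t) s).
Qed.

(** From each t to all t: over a bounded set of fields the integrals of the drift are equicontinuous
    in t, and [0, 1] is compact. *)
Lemma drift_near (v : weakL2 V) x M e : 0 < e ->
  \forall u \near v, admissible M u -> forall t, I01 t -> `|rint 0 t (drift u v x)| <= e.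
Proof.
move=> e0.
pose M' := Num.max (Num.max 1 M) (B ^+ 2 * L2_sqnorm v).
have M'0 : 0 < M' by rewrite !lt_max ltr01.
(* With al M' = e / 8 and de / al = e / 8, an interval of length de contributes at most e / 4 for
   each of u and v; the remaining e / 2 is left for the center t0. *)
pose al := e / (8 * M').
have al0 : 0 < al by rewrite divr_gt0// mulr_gt0.
pose de := al * (e / 8).
have de0 : 0 < de by rewrite mulr_gt0// divr_gt0.
have small (u : L2 V) a b : admissible M' u -> 0 <= a -> a <= b -> b <= 1 -> b - a <= de ->
    \int[leb]_(s in `[a, b]) bound u s <= e / 4.
  move=> uM a0 ab b1 bade.
  apply: le_trans (integral_small_interval (c_meas u) (c_ge0 u) (c2_int u) (c2_le uM) a0 ab b1 al0) _.
  have -> : e / 4 = e / 8 + al^-1 * de by rewrite /de mulKf ?gt_eqF//; field.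
  apply: lerD; last by rewrite ler_pM2l ?invr_gt0.
  by rewrite /al; have -> : e / (8 * M') * M' = e / 8 by field; rewrite gt_eqF.
have := @segment_compact R 0 1; rewrite compact_near_coveringP => cov.
pose P (u : weakL2 V) t := admissible M u -> I01 t -> `|rint 0 t (drift u v x)| <= e.
suff : \forall u \near v, I01 `<=` P u.
  by apply: filterS => u h uM t It; exact: h.
apply: (cov _ (nbhs v) P (nbhs_filter v)) => t0 It0.
have e2 : 0 < e / 2 by rewrite divr_gt0.
exists ([set t | `|t - t0| < de], [set u : weakL2 V | `|rint 0 t0 (drift u v x)| <= e / 2]).
  split => /=; last exact: drift_near_point.
  by have := @nbhsx_ballx _ _ t0 de de0; apply: filterS => s; rewrite -ball_normE /ball_/= distrC.
move=> [t u] [/= tde uD] uM It; rewrite /P.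
have uM' : admissible M' u by apply: le_trans uM _; rewrite !le_max lexx orbT.
have vM' : admissible M' v by rewrite /admissible le_max lexx orbT.
pose c s := bound u s + bound v s.
have ci : leb.-integrable I01 (EFin \o c).
  by apply: integrable_RD => //; exact: c_int.
have Dc s : I01 s -> `|drift u v x s| <= c s.
  move=> _; apply: le_trans (ler_normB _ _) _.
  by apply: lerD; exact: field_bounded.
have incr a b : I01 a -> I01 b -> a <= b -> b - a <= de ->
    `|rint 0 b (drift u v x) - rint 0 a (drift u v x)| <= e / 2.
  rewrite /= !in_itv/= => /andP[a0 _] /andP[_ b1] ab bade.
  apply: le_trans (rint_increment (drift_int u v x) ci Dc a0 ab b1) _.
  rewrite RintegralD//; [|by apply: integrable_subitv..].
  have -> : e / 2 = e / 4 + e / 4 by field.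
  by apply: lerD; exact: small.
have inc : `|rint 0 t (drift u v x) - rint 0 t0 (drift u v x)| <= e / 2.
  have [tt|/ltW tt] := leP t0 t.
    by apply: incr => //; apply: le_trans (ltW tde); exact: ler_norm.
  rewrite distrC; apply: incr => //; apply: le_trans (ltW tde).
  by rewrite distrC; exact: ler_norm.
rewrite -[rint 0 t _](subrK (rint 0 t0 (drift u v x))).
apply: le_trans (ler_normD _ _) _.
by rewrite (splitr e); apply: lerD.
Qed.

(** From each x to all of K, by compactness and the Lipschitz constant common to admissible
    fields. *)
Lemma flow_weak_continuous (v : weakL2 V) (K : set 'rV[R]_n) M e : compact K -> 0 < e ->
  \forall u \near v, admissible M u -> forall x, K x -> `|phi u 1 x - phi v 1 x| <= e.
Proof.
move=> cK e0.
pose M' := Num.max M (B ^+ 2 * L2_sqnorm v).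
have vM' : admissible M' v by rewrite /admissible le_max lexx orbT.
have E0 := expR_gt0 (rate M').
(* Three terms of size 2 al exp (rate M') = e / 3: two from moving x to x0, one from the
   perturbation at x0. *)
pose al := e / (6 * expR (rate M')).
have al0 : 0 < al by rewrite divr_gt0// mulr_gt0.
move: cK; rewrite compact_near_coveringP => cov.
pose P (u : weakL2 V) x := admissible M u -> `|phi u 1 x - phi v 1 x| <= e.
suff : \forall u \near v, K `<=` P u.
  by apply: filterS => u h uM t It; exact: h.
apply: (cov _ (nbhs v) P (nbhs_filter v)) => x0 _.
exists ([set x | `|x - x0| < al], [set u : weakL2 V |
   admissible M' u -> forall t, I01 t -> `|rint 0 t (drift u v x0)| <= al]).
  split => /=; last exact: drift_near.
  by have := @nbhsx_ballx _ _ x0 al al0; apply: filterS => s; rewrite -ball_normE /ball_/= distrC.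
move=> [x u] [/= xal uD] uM; rewrite /P.
have uM' : admissible M' u by apply: le_trans uM _; rewrite le_max lexx.
have I1 : I01 1 by rewrite /= in_itv/= ler01 lexx.
have h0 := flow_perturbation uM' (ltW al0) (uD uM').
have hu := flow_lipschitz x x0 uM' I1; have hv := flow_lipschitz x0 x vM' I1.
rewrite distrC in xal.
have -> : phi u 1 x - phi v 1 x = (phi u 1 x - phi u 1 x0) + (phi u 1 x0 - phi v 1 x0) +
    (phi v 1 x0 - phi v 1 x) by rewrite !addrA !addrNK.
apply: le_trans (ler_normD _ _) _.
apply: le_trans (lerD (ler_normD _ _) (lexx _)) _.
apply: le_trans (lerD (lerD hu h0) hv) _.
rewrite (distrC x).
have -> : e = 2 * al * expR (rate M') + 2 * al * expR (rate M') + 2 * al * expR (rate M').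
  by rewrite /al; field; rewrite gt_eqF.
have l2 : 2 * `|x0 - x| * expR (rate M') <= 2 * al * expR (rate M').
  by rewrite ler_wpM2r ?(ltW E0)// ler_wpM2l// ltW.
by apply: lerD => //; apply: lerD.
Qed.

End flows.

(** * Jacobians of the flows *)

Lemma continuous_dist {R : realType} {U W : normedModType R} (f : U -> W) :
  (forall x e, 0 < e -> exists2 r, 0 < r & forall y, `|x - y| <= r -> `|f x - f y| <= e) ->
  continuous f.
Proof.
move=> fP x; apply/cvgrPdist_le => e /(fP x)[r r0 h].
by near=> y; apply: h; near: y; apply: cvgr_dist_le; [exact: cvg_id|].
Unshelve. all: by end_near. Qed.

(** * Mean value estimates along lines *)

Section mean_value.
Context {R : realType} {U : normedModType R}.

Lemma is_derive_line (f : U -> R) (q h : U) (t : R) :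
  differentiable f (t *: h + q) ->
  is_derive t 1 (fun t : R => f (t *: h + q)) ('d f (t *: h + q) h).
Proof.
move=> df; have dv : derivable f (t *: h + q) h by exact: diff_derivable.
rewrite -(deriveE h df).
have eq1 : (fun s : R => s^-1 *: (f ((s *: (1 : R) + t) *: h + q) - f (t *: h + q))) =
    (fun s : R => s^-1 *: (f (s *: h + (t *: h + q)) - f (t *: h + q))).
  by apply/funext => s; rewrite [s *: (1 : R)]mulr1 scalerDl addrA.
by split; [rewrite /derivable eq1|rewrite /derive eq1].
Qed.

Definition line_derivative (f : U -> R) (D : U -> U -> R) :=
  forall (q h : U) (t : R), is_derive t 1 (fun t : R => f (t *: h + q)) (D (t *: h + q) h).

Lemma mean_value_le f D (q h : U) (C : R) : line_derivative f D ->
  (forall x, `|D x h| <= C) -> `|f (q + h) - f q| <= C.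
Proof.
move=> fD DC; have dF := fD q h.
have [|c _] := @MVT_segment R (fun t : R => f (t *: h + q)) _ 0 1 ler01 (fun t _ => dF t).
  apply: continuous_subspaceT => t; apply: differentiable_continuous.
  by apply/derivable1_diffP; case: (dF t).
by rewrite scale1r scale0r add0r [h + q]addrC subr0 mulr1 => ->.
Qed.

(* The mean value theorem for t |-> f (p + t q) + f (p - t q). *)
Lemma mean_value_diff2 f D (p q : U) (C : R) : line_derivative f D ->
  (forall x, D x (- q) = - D x q) ->
  (forall x y, `|D x q - D y q| <= C * `|x - y|) -> 0 <= C ->
  `|f (p + q) + f (p - q) - 2 * f p| <= 2 * C * `|q|.
Proof.
move=> fD DN DC C0.
have dF1 := fD p q; have dF2 := fD p (- q).
have dF (t : R) := is_deriveD (dF1 t) (dF2 t).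
have [|c] := @MVT_segment R _ _ 0 1 ler01 (fun t _ => dF t).
  apply: continuous_subspaceT => t; apply: differentiable_continuous.
  by apply/derivable1_diffP; case: (dF t).
rewrite in_itv/= => /andP[c0 c1]; rewrite !fctE !scale1r !scale0r !add0r subr0 mulr1.
rewrite [q + p]addrC [- q + p]addrC DN => e.
have -> : f (p + q) + f (p - q) - 2 * f p = f (p + q) + f (p - q) - (f p + f p) by ring.
rewrite e; apply: le_trans (DC _ _) _.
rewrite opprD addrACA subrr addr0 scalerN opprK -scalerDl normrZ mulrA ler_wpM2r//.
by rewrite ger0_norm ?addr_ge0// mulrC ler_wpM2r//; lra.
Qed.

End mean_value.

Section matrix_norms.
Context {R : realType}.

Lemma entry_le m n (A : 'M[R]_(m, n)) i j : `|A i j| <= `|A|.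
Proof.
rewrite [leRHS]/Num.Def.normr/= mx_normrE.
exact: (@le_bigmax _ _ _ (0 : R) (fun ij => `|A ij.1 ij.2|) (i, j)).
Qed.

Lemma norm_matrix_le m n (A : 'M[R]_(m, n)) (r : R) : 0 <= r ->
  (forall i j, `|A i j| <= r) -> `|A| <= r.
Proof.
move=> r0 Ar; rewrite [leLHS]/Num.Def.normr/= mx_normrE.
by apply: bigmax_le => // -[i j] _ /=.
Qed.

Lemma norm_ball_compact n (r : R) : compact [set x : 'rV[R]_n | `|x| <= r].
Proof.
apply: bounded_closed_compact.
  exists r; split; first exact: num_real.
  by move=> b rb x /= h; apply: le_trans h (ltW rb).
rewrite (_ : [set _ | _] = (fun x : 'rV[R]_n => `|x|) @^-1` [set s : R | s <= r])//.
by apply: closed_comp; [move=> x _; exact: norm_continuous|exact: closed_le].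
Qed.

Lemma submxE m n (A A' : 'M[R]_(m, n)) i j : (A - A') i j = A i j - A' i j.
Proof. by rewrite !mxE. Qed.

Lemma norm_delta_le n (i : 'I_n) : `|delta_mx 0 i : 'rV[R]_n| <= 1.
Proof.
apply: norm_matrix_le => // k j; rewrite mxE.
by case: (_ && _); rewrite ?normr1 ?normr0.
Qed.

Lemma norm_mulmx_le m n p (A : 'M[R]_(m, n)) (M : 'M[R]_(n, p)) :
  `|A *m M| <= n%:R * `|A| * `|M|.
Proof.
apply: norm_matrix_le; first by rewrite !mulr_ge0.
move=> i j; rewrite mxE; apply: le_trans (ler_norm_sum _ _ _) _.
rewrite -mulrA mulr_natl -[X in _ *+ X]card_ord -sumr_const; apply: ler_sum => k _.
by rewrite normrM ler_pM// entry_le.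
Qed.

End matrix_norms.

Section C0_functions.
Context {R : realType}.

Lemma C0_bounded (T : topologicalType) (U : normedModType R) (f : T -> U) :
  C0 f -> exists M, forall x, `|f x| <= M.
Proof.
move=> [fc /(_ 1 ltr01)[K [cK Kf]]].
have [M [_ MP]] : bounded_set (f @` K).
  by apply: compact_bounded; apply: continuous_compact => //; exact: continuous_subspaceT.
exists (Num.max 1 (M + 1)) => x; rewrite le_max.
have [Kx|/Kf/ltW->//] := pselect (K x).
by apply/orP; right; apply: MP; [rewrite ltrDl|exists x].
Qed.

Lemma C0_sup_norm (T : topologicalType) (U : normedModType R) (f : T -> U) x :
  C0 f -> `|f x| <= sup_norm f.
Proof.
move=> /C0_bounded[M fM]; apply: sup_upper_bound; last by exists x.
by split; [exists `|f x|, x|exists M => _ [y _ <-]].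
Qed.

End C0_functions.

(** * From the embedding in C_0^2 to finite differences *)

Section embedding.
Context {R : realType} {n : nat} {V : hilbertType R}.
Variable evV : V -> 'rV[R]_n -> 'rV[R]_n.
Hypothesis rkhsV : is_rkhs evV.
Hypothesis embV : continuously_embedded_C0_2 evV.

Lemma embedded_bounds : exists A : R, 0 <= A /\ forall h,
  [/\ forall p, `|evV h p| <= A * `|h|,
      forall p, `|'J (evV h) p| <= A * `|h| &
      forall i p, `|jacobian_diff (evV h) i p| <= A * `|h|].
Proof.
have [evC [C CP]] := embV.
exists (Num.max 0 C); split; first by rewrite le_max lexx.
move=> h; have [_ _ c0 c1 c2] := evC h.
have s0 : 0 <= sup_norm (evV h) by apply: le_trans (normr_ge0 _) (C0_sup_norm 0 c0).
have s1 : 0 <= sup_norm (jacobian (evV h)).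
  by apply: le_trans (normr_ge0 _) (C0_sup_norm 0 c1).
have s2 i : 0 <= sup_norm (jacobian_diff (evV h) i).
  have := @C0_sup_norm R _ _ (jacobian_diff (evV h) i) (0 : 'rV[R]_n) (c2 i).
  by apply: le_trans; exact: normr_ge0.
have Ch : C0_2_norm (evV h) <= Num.max 0 C * `|h|.
  by apply: le_trans (CP h) _; rewrite ler_wpM2r// le_max lexx orbT.
have ss : 0 <= \sum_(i < n) sup_norm (jacobian_diff (evV h) i) by apply: sumr_ge0.
split=> [p|p|i p]; apply: le_trans Ch; rewrite /C0_2_norm.
- by apply: le_trans (C0_sup_norm p c0) _; rewrite -addrA lerDl addr_ge0.
- by apply: le_trans (C0_sup_norm p c1) _; rewrite addrAC lerDr addr_ge0.
- apply: le_trans (C0_sup_norm p (c2 i)) _; rewrite (bigD1 i)//= addrCA lerDl.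
  by rewrite !addr_ge0// sumr_ge0.
Qed.

Lemma embedded_C11_fields : exists2 B : R, 0 <= B & C11_fields evV B.
Proof.
have [evC _] := embV.
have [A [A0 AP]] := embedded_bounds.
have coordE h i (x k : 'rV[R]_n) : 'd (fun p => evV h p 0 i) x k = (k *m 'J (evV h) x) 0 i.
  have [df _ _ _ _] := evC h.
  have := @diff_comp _ _ _ _ (evV h) (fun M : 'rV[R]_n => M 0 i) x (df x)
    (differentiable_coord _ _ _).
  rewrite /comp => ->.
  have lin : linear (fun M : 'rV[R]_n => M 0 i : R^o) by move=> a M M'; rewrite !mxE.
  pose L := GRing.isLinear.Build _ _ _ _ _ lin.
  pose l : {linear 'rV[R]_n -> R^o} := HB.pack (fun M : 'rV[R]_n => M 0 i : R^o) L.
  have -> : 'd (fun M : 'rV[R]_n => M 0 i) (evV h x) = l :> (_ -> _).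
    by apply: (@diff_lin _ _ _ l); exact: coord_continuous.
  by rewrite /l/= -(mul_rV_lin1 ('d (evV h) x)).
have lineD h i : line_derivative (fun p => evV h p 0 i) (fun x k => (k *m 'J (evV h) x) 0 i).
  move=> q k t; have [df _ _ _ _] := evC h.
  rewrite -coordE; apply: is_derive_line.
  exact: (differentiable_comp (df _) (differentiable_coord _ _ _)).
(* One factor n comes from the product with k, the other from the sum over the coordinate directions
   of x - y. *)
have lip1 h i (x y k : 'rV[R]_n) : `|(k *m 'J (evV h) x) 0 i - (k *m 'J (evV h) y) 0 i| <=
    (n%:R ^+ 2 * A * `|h| * `|k|) * `|x - y|.
  have [_ dJ _ _ _] := evC h.
  rewrite -submxE -mulmxBr; apply: le_trans (entry_le _ _ _) _.
  apply: le_trans (norm_mulmx_le _ _) _.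
  have -> : n%:R ^+ 2 * A * `|h| * `|k| * `|x - y| =
    n%:R * `|k| * (n%:R * A * `|h| * `|x - y|) by ring.
  rewrite ler_wpM2l ?mulr_ge0//; apply: norm_matrix_le; first by rewrite !mulr_ge0.
  move=> a b.
  have lineJ : line_derivative (fun p => 'J (evV h) p a b)
      (fun z k => \sum_j k 0 j * jacobian_diff (evV h) j z a b).
    move=> q l t; set z := t *: l + q.
    have -> : \sum_j l 0 j * jacobian_diff (evV h) j z a b =
        'd (fun p => 'J (evV h) p a b) z l.
      have := @diff_comp _ _ _ _ (jacobian (evV h)) (fun M : 'M[R]_n => M a b) z (dJ z)
        (differentiable_coord _ _ _).
      rewrite /comp => ->.
      have lin : linear (fun M : 'M[R]_n => M a b : R^o) by move=> c M M'; rewrite !mxE.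
      pose L := GRing.isLinear.Build _ _ _ _ _ lin.
      pose l' : {linear 'M[R]_n -> R^o} := HB.pack (fun M : 'M[R]_n => M a b : R^o) L.
      have -> : 'd (fun M : 'M[R]_n => M a b) ('J (evV h) z) = l' :> (_ -> _).
        by apply: (@diff_lin _ _ _ l'); exact: coord_continuous.
      rewrite [in RHS](row_sum_delta l) linear_sum /l'/= summxE.
      by apply: eq_bigr => j _; rewrite linearZ !mxE.
    apply: is_derive_line.
    exact: (differentiable_comp (dJ z) (differentiable_coord _ _ _)).
  have := @mean_value_le _ _ _ _ y (x - y) (n%:R * A * `|h| * `|x - y|) lineJ.
  rewrite [y + _]addrC subrK submxE; apply => z.
  apply: le_trans (ler_norm_sum _ _ _) _.
  rewrite -!mulrA mulr_natl -[X in _ *+ X]card_ord -sumr_const; apply: ler_sum => j _.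
  rewrite normrM mulrA mulrC; apply: ler_pM => //; last exact: entry_le.
  by apply: le_trans (entry_le _ _ _) _; have [_ _ ] := AP h; exact.
have n0 : 0 <= n%:R :> R by [].
(* The three summands serve the values, the Lipschitz bound and the second differences. *)
exists (A + n%:R * A + 2 * n%:R ^+ 2 * A).
  by rewrite !addr_ge0 ?mulr_ge0 ?exprn_ge0.
have B1 : A <= A + n%:R * A + 2 * n%:R ^+ 2 * A.
  by rewrite -addrA lerDl addr_ge0 ?mulr_ge0 ?exprn_ge0.
have B2 : n%:R * A <= A + n%:R * A + 2 * n%:R ^+ 2 * A.
  by rewrite addrAC lerDr addr_ge0 ?mulr_ge0 ?exprn_ge0.
have B3 : 2 * n%:R ^+ 2 * A <= A + n%:R * A + 2 * n%:R ^+ 2 * A.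
  by rewrite lerDr addr_ge0 ?mulr_ge0.
have B0 := le_trans A0 B1.
split.
- by move=> a h k p; have [lin _ _] := rkhsV; rewrite lin.
- move=> h p; have [h1 _ _] := AP h; apply: le_trans (h1 p) _.
  by rewrite ler_wpM2r.
- move=> h p q; apply: norm_row_le; first by rewrite !mulr_ge0.
  move=> i; rewrite !mxE.
  have := @mean_value_le _ _ _ _ q (p - q)
    ((A + n%:R * A + 2 * n%:R ^+ 2 * A) * `|h| * `|p - q|) (lineD h i).
  rewrite [q + _]addrC subrK; apply => x.
  apply: le_trans (entry_le _ _ _) _; apply: le_trans (norm_mulmx_le _ _) _.
  rewrite mulrAC ler_wpM2r//; have [_ h2 _] := AP h.
  apply: le_trans (ler_wpM2l n0 (h2 x)) _.
  by rewrite mulrA ler_wpM2r.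
- move=> h p q; apply: norm_row_le; first by rewrite !mulr_ge0 ?exprn_ge0.
  move=> i; rewrite !mxE.
  have := @mean_value_diff2 _ _ _ _ p q (n%:R ^+ 2 * A * `|h| * `|q|) (lineD h i).
  move=> /(_ _ _ _)/le_trans; apply.
  + by move=> x; rewrite mulNmx mxE.
  + by move=> x y; exact: lip1.
  + by rewrite !mulr_ge0 ?exprn_ge0.
  + rewrite (_ : 2 * _ * _ = 2 * n%:R ^+ 2 * A * (`|h| * `|q| ^+ 2)); last by ring.
    by rewrite -[leRHS]mulrA ler_wpM2r// mulr_ge0 ?exprn_ge0.
Qed.

End embedding.

Section jacobians.
Context {R : realType} {n : nat}.
Implicit Types (f g : 'rV[R]_n -> 'rV[R]_n) (x y : 'rV[R]_n).

Definition quadratic_remainder (K : R) f x := differentiable f x /\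
  forall y, `|f y - f x - (y - x) *m 'J f x| <= K * `|y - x| ^+ 2.

(* Interpolation: difference quotients at scale r compare the two jacobians. *)
Lemma jacobian_dist f g x y (K r e : R) : 0 < r -> 0 <= e -> 0 <= K ->
  quadratic_remainder K f x -> quadratic_remainder K g y ->
  `|f x - g y| <= e ->
  (forall h, `|h| <= r -> `|f (x + h) - g (y + h)| <= e) ->
  `|'J f x - 'J g y| <= 2 * e / r + 2 * K * r.
Proof.
move=> r0 e0 K0 [_ +] [_ +]; move: ('J f x) ('J g y) => J J' fx gy fg0 fgh.
apply: norm_matrix_le.
  by rewrite addr_ge0 ?divr_ge0 ?mulr_ge0// ltW.
move=> i j.
pose h : 'rV[R]_n := r *: delta_mx 0 i.
have hr : `|h| <= r.
  by rewrite normrZ (ger0_norm (ltW r0)) ler_piMr ?(ltW r0)// norm_delta_le.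
have hJ (M : 'M[R]_n) : (h *m M) 0 j = r * M i j.
  by rewrite /h -scalemxAl mxE -rowE mxE.
have addK z : z + h - z = h by rewrite addrAC subrr add0r.
have := fx (x + h); have := gy (y + h); rewrite !addK => gh fh.
have Kh : K * `|h| ^+ 2 <= K * r ^+ 2.
  by rewrite ler_wpM2l// lerXn2r ?nnegrE// ltW.
rewrite -(ler_pM2l r0) -[X in X * `|_|](ger0_norm (ltW r0)) -normrM submxE mulrBr -!hJ.
rewrite -submxE; apply: le_trans (coord_le _ _) _.
have -> : h *m J - h *m J' = (f (x + h) - g (y + h)) - (f x - g y) +
   (g (y + h) - g y - h *m J') - (f (x + h) - f x - h *m J).
  by apply/rowP => k; rewrite !(submxE, mxE); ring.
have -> : r * (2 * e / r + 2 * K * r) = e + e + K * r ^+ 2 + K * r ^+ 2.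
  by field; rewrite gt_eqF.
apply: le_trans (ler_normB _ _) _; apply: lerD; last exact: le_trans Kh.
apply: le_trans (ler_normD _ _) _; apply: lerD; last exact: le_trans Kh.
apply: le_trans (ler_normB _ _) _; apply: lerD => //.
exact: fgh.
Qed.

Lemma jacobian_continuous f (K L : R) : (forall x, quadratic_remainder K f x) ->
  (forall x y, `|f x - f y| <= L * `|x - y|) -> continuous (jacobian f).
Proof.
move=> fK fL; apply: continuous_dist => x e e0.
have K1 : 0 < `|K| + 1 by rewrite ltr_wpDl.
have L1 : 0 < `|L| + 1 by rewrite ltr_wpDl.
(* In [jacobian_dist] with f = g, this r makes the curvature term e / 2; then de makes the
   increments of f at most e r / 4, and the quotient term e / 2. *)
pose r := e / (4 * (`|K| + 1)).
have r0 : 0 < r by rewrite divr_gt0// mulr_gt0.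
pose de := e * r / (4 * (`|L| + 1)).
have de0 : 0 < de by rewrite divr_gt0 ?mulr_gt0.
have fK' z : quadratic_remainder (`|K| + 1) f z.
  have [df h] := fK z; split=> // y; apply: le_trans (h y) _.
  by rewrite ler_wpM2r ?exprn_ge0// (le_trans (ler_norm _))// lerDl.
exists de => // y xy.
have fLe a b : `|a - b| <= de -> `|f a - f b| <= e * r / 4.
  move=> ab; apply: le_trans (fL _ _) _.
  have -> : e * r / 4 = (`|L| + 1) * de by rewrite /de; field; rewrite gt_eqF.
  apply: (@le_trans _ _ (`|L| * `|a - b|)); first by rewrite ler_wpM2r// ler_norm.
  by apply: ler_pM => //; rewrite lerDl.
have := @jacobian_dist f f x y (`|K| + 1) r (e * r / 4) r0 _ (ltW K1) (fK' x) (fK' y).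
move=> /(_ _ _ _)/le_trans; apply.
- by rewrite divr_ge0// mulr_ge0// ltW.
- exact: fLe.
- by move=> h _; apply: fLe; rewrite opprD addrACA subrr addr0.
- by rewrite /r le_eqVlt; apply/orP; left; apply/eqP; field; rewrite !gt_eqF.
Qed.

(** Along a kernel vector h the increment of f is quadratic in t, against the linear lower bound; t
    is chosen so that the quadratic bound is half of t |h|. *)
Lemma jacobian_unit f x (K c : R) : 0 < c -> quadratic_remainder K f x ->
  (forall y, `|y - x| <= c * `|f y - f x|) -> 'J f x \in unitmx.
Proof.
move=> c0 [_ fK] fc; rewrite -row_free_unit; apply: inj_row_free => h hJ.
apply/eqP; rewrite -normr_le0 leNgt; apply/negP => h0.
have K1 : 0 < `|K| + 1 by rewrite ltr_wpDl.
pose t := (2 * c * (`|K| + 1) * `|h|)^-1.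
have t0 : 0 < t by rewrite invr_gt0 !mulr_gt0.
have xh : x + t *: h - x = t *: h by rewrite addrAC subrr add0r.
have := fK (x + t *: h); rewrite xh -scalemxAl hJ scaler0 subr0 => fh.
have := fc (x + t *: h); rewrite xh => ch.
have := le_trans ch (ler_wpM2l (ltW c0) fh).
rewrite normrZ (ger0_norm (ltW t0)) => bad.
have : t * `|h| <= c * ((`|K| + 1) * (t * `|h|) ^+ 2).
  apply: le_trans bad _; rewrite ler_wpM2l ?(ltW c0)// ler_wpM2r ?sqr_ge0//.
  by rewrite (le_trans (ler_norm _))// lerDl.
have -> : c * ((`|K| + 1) * (t * `|h|) ^+ 2) = 2^-1 * (t * `|h|).
  by rewrite /t; field; rewrite !gt_eqF.
have : 0 < t * `|h| by rewrite mulr_gt0.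
lra.
Qed.

End jacobians.

Section flow_jacobians.
Context {R : realType} {n : nat} {V : hilbertType R}.
Variables (ev : V -> 'rV[R]_n -> 'rV[R]_n) (B : R).
Hypotheses (B0 : 0 <= B) (evP : C11_fields ev B).
Implicit Types (v : L2 V) (M : R).
Local Notation phi v := (field_flow ev v 1).

Let I1 : (`[0, 1]%classic : set R) 1.
Proof. by rewrite /= in_itv/= ler01 lexx. Qed.

Lemma flow_lip M v x y : admissible B M v ->
  `|phi v x - phi v y| <= 2 * expR (rate M) * `|x - y|.
Proof. by move=> vM; rewrite mulrAC; exact: (flow_lipschitz B0 evP). Qed.

Definition flow_curvature M : R := 4 * expR (rate M) ^+ 4.

Lemma flow_curvature_ge0 M : 0 <= flow_curvature M.
Proof. by rewrite mulr_ge0// exprn_ge0// expR_ge0. Qed.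

Lemma flow_quadratic M v x : admissible B M v ->
  quadratic_remainder (flow_curvature M) (phi v) x.
Proof.
move=> vM.
have [|df dfE] := @diff2_differentiable R _ _ (phi v) _ (flow_curvature M)
  (fun x y => flow_lip x y vM) _ x.
  by move=> y h; exact: (flow_diff2 B0 evP).
split=> // y; have := dfE y.
by rewrite /jacobian mul_rV_lin1.
Qed.

Lemma flow_jacobian_unit v x : 'J (phi v) x \in unitmx.
Proof.
have vM : admissible B (B ^+ 2 * L2_sqnorm v) v by exact: lexx.
apply: (@jacobian_unit _ _ _ _ _ (2 * expR (rate (B ^+ 2 * L2_sqnorm v))) _
  (flow_quadratic x vM)).
  by rewrite mulr_gt0// expR_gt0.
by move=> y; rewrite mulrAC; exact: (flow_lower B0 evP).
Qed.

Lemma flow_jacobian_continuous v : continuous (jacobian (phi v)).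
Proof.
have vM : admissible B (B ^+ 2 * L2_sqnorm v) v by exact: lexx.
exact: (jacobian_continuous (fun x => flow_quadratic x vM) (fun x y => flow_lip x y vM)).
Qed.

Lemma flow_space_continuous v : continuous (phi v).
Proof.
have vM : admissible B (B ^+ 2 * L2_sqnorm v) v by exact: lexx.
exact: (lipschitz_continuous (fun x y => flow_lip x y vM)).
Qed.

Lemma flow_jacobian_bounded v : exists C : R, forall x, `|'J (phi v) x| <= C.
Proof.
set M := B ^+ 2 * L2_sqnorm v.
have vM : admissible B M v by exact: lexx.
exists (2 * expR (rate M) + flow_curvature M) => x.
have [_ q] := flow_quadratic x vM.
apply: norm_matrix_le => [|i j]; first by rewrite addr_ge0 ?mulr_ge0 ?exprn_ge0 ?expR_ge0.
have xh : x + delta_mx 0 i - x = delta_mx 0 i by rewrite addrAC subrr add0r.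
have := q (x + delta_mx 0 i); rewrite xh -rowE; move: ('J (phi v) x) => J h.
have -> : J i j = row i J 0 j by rewrite mxE.
apply: le_trans (coord_le _ _) _.
set a := phi v (x + _) - phi v x in h.
rewrite -[row _ _](subKr a).
apply: le_trans (ler_normB _ _) _; apply: lerD.
  apply: le_trans (flow_lip _ _ vM) _; rewrite xh.
  by rewrite ler_piMr ?norm_delta_le// mulr_ge0// expR_ge0.
apply: le_trans h _; rewrite ler_piMr ?flow_curvature_ge0// expr_le1// ?norm_delta_le//.
Qed.

(** Interpolation between uniform closeness of the flows and their common curvature bound. *)
Lemma flow_C1_weak_continuous (v : weakL2 V) (K : set 'rV[R]_n) M e : compact K -> 0 < e ->
  \forall u \near v, admissible B M u -> forall x, K x ->
    `|phi u x - phi v x| <= e /\ `|'J (phi u) x - 'J (phi v) x| <= e.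
Proof.
move=> cK e0.
pose M' := Num.max M (B ^+ 2 * L2_sqnorm v).
have vM' : admissible B M' v by rewrite /admissible le_max lexx orbT.
have C0 := flow_curvature_ge0 M'.
have C1 : 0 < flow_curvature M' + 1 by rewrite ltr_wpDl.
pose r := e / (4 * (flow_curvature M' + 1)).
have r0 : 0 < r by rewrite divr_gt0// mulr_gt0.
pose e' := Num.min e (e * r / 4).
have e'0 : 0 < e' by rewrite lt_min e0 divr_gt0// mulr_gt0.
have [M0 [_ M0P]] := compact_bounded cK.
(* Difference quotients at scale r based in K reach points outside K. *)
pose K' := [set x : 'rV[R]_n | `|x| <= `|M0| + 1 + r].
have cK' : compact K' by exact: norm_ball_compact.
have KM x : K x -> `|x| <= `|M0| + 1.
  by move=> Kx; apply: M0P => //; rewrite (le_lt_trans (ler_norm _))// ltrDl.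
have := @flow_weak_continuous _ _ _ _ _ B0 evP v _ M' _ cK' e'0.
apply: filterS => u h uM x Kx.
have uM' : admissible B M' u by apply: le_trans uM _; rewrite le_max lexx.
have h0 k : `|k| <= r -> `|phi u (x + k) - phi v (x + k)| <= e'.
  move=> kr; apply: h => //=; apply: le_trans (ler_normD _ _) _.
  by apply: lerD => //; exact: KM.
have h1 : `|phi u x - phi v x| <= e' by have := h0 0; rewrite normr0 addr0; apply; exact: ltW.
split; first by apply: le_trans h1 _; rewrite ge_min lexx.
have h2 : 0 <= e * r / 4 by rewrite divr_ge0// mulr_ge0// ltW.
have q w : admissible B M' w -> quadratic_remainder (flow_curvature M' + 1) (phi w) x.
  move=> wM; have [dw hw] := flow_quadratic x wM; split=> // y.
  by apply: le_trans (hw y) _; rewrite ler_wpM2r ?exprn_ge0// lerDl.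
have e'4 : e' <= e * r / 4 by rewrite ge_min lexx orbT.
have := @jacobian_dist _ _ (phi u) (phi v) x x (flow_curvature M' + 1) r (e * r / 4) r0 h2
  (ltW C1) (q _ uM') (q _ vM').
move=> /(_ (le_trans h1 e'4) (fun k kr => le_trans (h0 k kr) e'4))/le_trans; apply.
by rewrite /r le_eqVlt; apply/orP; left; apply/eqP; field; rewrite !gt_eqF.
Qed.

End flow_jacobians.

(** * Oriented planes *)

Section euclidean_theory.
Context {R : realType} {m : nat}.
Implicit Types x y : 'rV[R]_m.

Lemma dotE x y : dot x y = \sum_i x 0 i * y 0 i.
Proof. by rewrite /dot mxE; apply: eq_bigr => i _; rewrite mxE. Qed.

Lemma dotxx_ge0 x : 0 <= dot x x.
Proof. by rewrite dotE sumr_ge0// => i _; exact: sqr_ge0. Qed.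

Lemma dotxx_eq0 x : (dot x x == 0) = (x == 0).
Proof.
apply/eqP/eqP => [|->]; last by rewrite dotE big1// => i _; rewrite mxE mul0r.
rewrite dotE => /psumr_eq0P h; apply/rowP => i; rewrite mxE.
by apply/eqP; rewrite -sqrf_eq0 expr2 h// => j _; exact: sqr_ge0.
Qed.

Lemma dotZZ a x : dot (a *: x) (a *: x) = a ^+ 2 * dot x x.
Proof. by rewrite !dotE mulr_sumr; apply: eq_bigr => i _; rewrite !mxE; ring. Qed.

Lemma enormZ a x : enorm (a *: x) = `|a| * enorm x.
Proof. by rewrite /enorm dotZZ sqrtrM ?sqr_ge0// sqrtr_sqr. Qed.

Lemma enormN x : enorm (- x) = enorm x.
Proof. by rewrite -scaleN1r enormZ normrN normr1 mul1r. Qed.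

Lemma enorm_gt0 x : (0 < enorm x) = (x != 0).
Proof. by rewrite sqrtr_gt0 lt_neqAle dotxx_ge0 andbT eq_sym dotxx_eq0. Qed.

Lemma sqr_enorm x : enorm x ^+ 2 = dot x x.
Proof. by rewrite sqr_sqrtr// dotxx_ge0. Qed.

Lemma unitizeN x : unitize (- x) = - unitize x.
Proof. by rewrite /unitize enormN scalerN. Qed.

End euclidean_theory.

Section orthonormalization.
Context {R : realType} {n : nat}.

(** Gram-Schmidt by induction on the number of rows, the first row being orthogonalized last. *)
Lemma orthonormalize d (U : 'M[R]_(d, n)) : row_free U ->
  exists P : 'M[R]_d, P \in unitmx /\ (P *m U) *m (P *m U)^T = 1%:M.
Proof.
elim: d U => [|d IH] U Uf.
  by exists 1%:M; split; [exact: unitmx1|apply/matrixP => -[]].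
pose V : 'M[R]_(1 + d, n) := U.
have Vf : row_free V := Uf.
rewrite -[V]vsubmxK in Vf; move: (usubmx V) (dsubmx V) Vf (vsubmxK V) => u U' Vf VE.
have inj := row_free_inj Vf.
have U'f : row_free U'.
  apply: inj_row_free => v vU.
  have : row_mx (0 : 'M[R]_(1, 1)) v *m col_mx u U' = 0 *m col_mx u U'.
    by rewrite mul_row_col !mul0mx vU addr0.
  by move/inj => /eqP; rewrite -[0 in X in _ == X]row_mx0 => /eqP/eq_row_mx[].
have [P' [P'u]] := IH _ U'f; set Q := P' *m U' => QQ.
pose e := u - u *m Q^T *m Q.
have e0 : e != 0.
  apply/eqP => e0.
  have : row_mx (1%:M : 'M[R]_(1, 1)) (- (u *m Q^T *m P')) *m col_mx u U' = 0 *m col_mx u U'.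
    by rewrite mul_row_col mul1mx mul0mx mulNmx -(mulmxA (u *m Q^T)) -/Q -[LHS]/e e0.
  by move/inj => /eqP; rewrite -[0 in X in _ == X]row_mx0 => /eqP/eq_row_mx[] /eqP;
    rewrite oner_eq0.
have ne : 0 < enorm e by rewrite enorm_gt0.
pose c := (enorm e)^-1.
have eQ : e *m Q^T = 0 by rewrite mulmxBl -(mulmxA (u *m Q^T)) QQ mulmx1 subrr.
pose P : 'M[R]_(1 + d) := block_mx c%:M (- c *: (u *m Q^T *m P')) 0 P'.
have PV : P *m col_mx u U' = col_mx (c *: e) Q.
  rewrite /P mul_block_col mul0mx add0r mul_scalar_mx; congr col_mx.
  by rewrite -scalemxAl -(mulmxA (u *m Q^T)) scaleNr -scalerBr.
exists P; split.
  rewrite unitmxE [\det P]det_ublock det_scalar1 unitrM -unitmxE P'u andbT.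
  by rewrite unitfE invr_neq0// gt_eqF.
have -> : P *m U = col_mx (c *: e) Q by rewrite -PV VE.
suff : col_mx (c *: e) Q *m (col_mx (c *: e) Q)^T = 1%:M :> 'M[R]_(1 + d) by [].
rewrite tr_col_mx mul_col_row QQ.
have -> : c *: e *m (c *: e)^T = 1%:M.
  rewrite [LHS]mx11_scalar -/(dot _ _) dotZZ -sqr_enorm -exprMn mulVf ?expr1n//.
  by rewrite gt_eqF.
have -> : c *: e *m Q^T = 0 by rewrite -scalemxAl eQ scaler0.
have -> : Q *m (c *: e)^T = 0 by rewrite -[LHS]trmxK trmx_mul trmxK -scalemxAl eQ scaler0 trmx0.
by rewrite -scalar_mx_block.
Qed.

End orthonormalization.

Section planes.
Context {R : realType} {n : nat} {d : 'I_n.+1}.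
Implicit Types (T : oGrass R d) (U : 'M[R]_(d, n)) (A : 'M[R]_n).

Lemma wedge_mull (P : 'M[R]_d) U : wedge (P *m U) = \det P *: wedge U.
Proof.
apply/rowP => k; rewrite !mxE -det_mulmx; congr (\det _).
by apply/matrixP => i j; rewrite !mxE; apply: eq_bigr => l _; rewrite mxE.
Qed.

Lemma wedge_neq0 U : row_free U -> wedge U != 0.
Proof.
move=> /orthonormalize[P [Pu PU]]; apply/eqP => w0.
have := dot_wedge (P *m U) (P *m U); rewrite PU det1 wedge_mull w0 scaler0.
by rewrite dotE big1 => [/eqP|i _]; rewrite ?mxE ?mul0r// eq_sym oner_eq0.
Qed.

Lemma orthonormal_row_free U : U *m U^T = 1%:M -> row_free U.
Proof. by move=> UU; apply/row_freeP; exists U^T. Qed.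

Lemma orthonormal_wedge U : U *m U^T = 1%:M -> unitize (wedge U) = wedge U.
Proof.
move=> UU; have h : dot (wedge U) (wedge U) = 1 by rewrite dot_wedge UU det1.
by rewrite /unitize /enorm h sqrtr1 invr1 scale1r.
Qed.

(** Orthonormal frames dispose of the normalization: the set becomes the union of two continuous
    images of a compact set of matrices. *)
Lemma oriented_planesE : @oriented_planes R n d =
  [set T | exists2 U : 'M[R]_(d, n), U *m U^T = 1%:M & T = wedge U \/ T = - wedge U].
Proof.
apply/seteqP; split=> T [U]; last first.
  move=> UU TU; exists U; split; first exact: orthonormal_row_free.
  by rewrite orthonormal_wedge.
move=> [Uf TU]; have [P [Pu PU]] := orthonormalize Uf.
have := dot_wedge (P *m U) (P *m U); rewrite PU det1 wedge_mull dotZZ -sqr_enorm => e1.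
have w0 : 0 < enorm (wedge U) by rewrite enorm_gt0 wedge_neq0.
have {}e1 : `|\det P| * enorm (wedge U) = 1.
  apply/eqP; rewrite -(@pexpr_eq1 _ _ 2)// ?mulr_ge0 ?(ltW w0)//.
  by rewrite exprMn real_normK ?num_real// e1.
have uE : unitize (wedge U) = `|\det P| *: wedge U.
  by rewrite /unitize; congr (_ *: _); apply/eqP; rewrite -(mulr1_eq e1) invrK.
exists (P *m U) => //; rewrite wedge_mull -scaleNr; move: TU; rewrite uE -scaleNr.
(* A change of frame with negative determinant exchanges the two signs. *)
have [d0|d0] := leP 0 (\det P); first by rewrite ger0_norm.
by rewrite ltr0_norm// opprK => -[]; [right|left].
Qed.

Lemma planeP T : @oriented_planes R n d (set_val T).
Proof. exact: set_valP. Qed.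

Lemma orthonormal_basis_nonempty T : orthonormal_basis T !=set0.
Proof.
have := planeP T; rewrite /orthonormal_basis; move: (set_val T) => x.
by rewrite oriented_planesE => -[U UU TU]; exists U.
Qed.

Lemma dot_plane T : dot (set_val T) (set_val T) = 1.
Proof.
have [U [UU TU]] := orthonormal_basis_nonempty T.
have h : dot (wedge U) (wedge U) = 1 by rewrite dot_wedge UU det1.
case: TU => ->//; rewrite -h !dotE; apply: eq_bigr => i _.
by rewrite !mxE mulrNN.
Qed.

(** Removes the frame chosen by [xget], leaving an expression visibly continuous in A and T. *)
Lemma tangent_jacobianE A T : tangent_jacobian A T = enorm (set_val T *m ext_map d A).
Proof.
rewrite /tangent_jacobian; case: xgetP => [U _ [UU TU]|]; last first.
  by have [U TU] := orthonormal_basis_nonempty T => /(_ U).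
rewrite -dot_wedge wedge_mulmx -/(enorm _).
by case: TU => ->//; rewrite mulNmx enormN.
Qed.

Lemma ext_map_neq0 A T : A \in unitmx -> set_val T *m ext_map d A != 0.
Proof.
move=> Au; have [U [UU TU]] := orthonormal_basis_nonempty T.
have : wedge (U *m A) != 0.
  apply: wedge_neq0; rewrite /row_free mxrankMfree ?row_free_unit//.
  exact: orthonormal_row_free.
by rewrite wedge_mulmx; case: TU => ->//; rewrite mulNmx oppr_eq0.
Qed.

Lemma oGrass_actE A T : A \in unitmx ->
  set_val (oGrass_act A T) = unitize (set_val T *m ext_map d A).
Proof.
move=> Au; rewrite /oGrass_act; apply: (insubdK (T : @oriented_planes R n d)).
rewrite inE; have [U [UU TU]] := orthonormal_basis_nonempty T.
exists (U *m A); split.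
  rewrite /row_free mxrankMfree ?row_free_unit//; exact: orthonormal_row_free.
rewrite wedge_mulmx; case: TU => ->; first by left.
by right; rewrite mulNmx unitizeN.
Qed.

End planes.

(** * Continuity of determinants, wedge products and exterior powers *)

Section matrix_continuity.
Context {R : realType}.

Lemma continuous_matrix (T : topologicalType) m n (f : T -> 'M[R]_(m, n)) (x : T) :
  (forall i j, {for x, continuous (fun t => f t i j)}) -> {for x, continuous f}.
Proof.
move=> fc; apply/cvgrPdist_le => e e0.
have : \forall s \near x, forall ij : 'I_m * 'I_n, `|f x ij.1 ij.2 - f s ij.1 ij.2| <= e.
  apply: filter_forall => -[i j] /=; move: (fc i j) => /cvgrPdist_le; exact.
apply: filterS => s h; apply: norm_matrix_le; first exact: ltW.
by move=> i j; rewrite submxE; exact: (h (i, j)).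
Qed.

Lemma continuous_sum (T : topologicalType) (I : Type) (r : seq I) (F : I -> T -> R) (x : T) :
  (forall i, {for x, continuous (F i)}) -> {for x, continuous (fun t => \sum_(i <- r) F i t)}.
Proof.
move=> Fc; elim: r => [|i r IH].
  have -> : (fun t => \sum_(i <- [::]) F i t) = (fun=> 0).
    by apply/funext => t; rewrite big_nil.
  exact: cst_continuous.
have -> : (fun t => \sum_(j <- i :: r) F j t) = (fun t => F i t + \sum_(j <- r) F j t).
  by apply/funext => t; rewrite big_cons.
exact: continuousD.
Qed.

Lemma continuous_prod (T : topologicalType) (I : Type) (r : seq I) (F : I -> T -> R) (x : T) :
  (forall i, {for x, continuous (F i)}) -> {for x, continuous (fun t => \prod_(i <- r) F i t)}.
Proof.
move=> Fc; elim: r => [|i r IH].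
  have -> : (fun t => \prod_(i <- [::]) F i t) = (fun=> 1).
    by apply/funext => t; rewrite big_nil.
  exact: cst_continuous.
have -> : (fun t => \prod_(j <- i :: r) F j t) = (fun t => F i t * \prod_(j <- r) F j t).
  by apply/funext => t; rewrite big_cons.
exact: continuousM.
Qed.

Lemma continuous_det (T : topologicalType) n (f : T -> 'M[R]_n) (x : T) :
  (forall i j, {for x, continuous (fun t => f t i j)}) -> {for x, continuous (fun t => \det (f t))}.
Proof.
move=> fc; apply: continuous_sum => s; apply: continuousM; first exact: cst_continuous.
by apply: continuous_prod => i.
Qed.

Lemma continuous_mulmx (T : topologicalType) m n p (f : T -> 'M[R]_(m, n)) (g : T -> 'M[R]_(n, p)) (x : T) :
  {for x, continuous f} -> {for x, continuous g} -> {for x, continuous (fun t => f t *m g t)}.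
Proof.
move=> fc gc; apply: continuous_matrix => i j.
have -> : (fun t => (f t *m g t) i j) = (fun t => \sum_k f t i k * g t k j).
  by apply/funext => t; rewrite mxE.
apply: continuous_sum => k; apply: continuousM.
  exact: (continuous_comp fc (@coord_continuous _ _ _ i k (f x))).
exact: (continuous_comp gc (@coord_continuous _ _ _ k j (g x))).
Qed.

Lemma continuous_enorm m : continuous (@enorm R m).
Proof.
move=> x; apply: continuous_comp; last exact: sqrt_continuous.
have -> : (fun x : 'rV[R]_m => dot x x) = (fun x => \sum_i x 0 i * x 0 i).
  by apply/funext => y; exact: dotE.
by apply: continuous_sum => i; apply: continuousM; exact: coord_continuous.
Qed.

Lemma ext_map_continuous n d : continuous (@ext_map R n d).
Proof.
move=> A; apply: continuous_matrix => i j.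
have -> : (fun A : 'M[R]_n => ext_map d A i j) =
    (fun A => \det (colsub (ext_index j) (rowsub (ext_index i) A))).
  by apply/funext => B; rewrite !mxE.
apply: continuous_det => k l.
have -> : (fun A : 'M[R]_n => colsub (ext_index j) (rowsub (ext_index i) A) k l) =
    (fun A => A (ext_index i k) (ext_index j l)).
  by apply/funext => B; rewrite !mxE.
exact: coord_continuous.
Qed.

Lemma wedge_continuous n d : continuous (@wedge R n d).
Proof.
move=> U; apply: continuous_matrix => i j.
have -> : (fun U : 'M[R]_(d, n) => wedge U i j) = (fun U => \det (colsub (ext_index j) U)).
  by apply/funext => B; rewrite !mxE.
apply: continuous_det => k l.
have -> : (fun U : 'M[R]_(d, n) => colsub (ext_index j) U k l) = (fun U => U k (ext_index j l)).
  by apply/funext => B; rewrite !mxE.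
exact: coord_continuous.
Qed.

Lemma vec_mx_continuous m n : continuous (@vec_mx R m n).
Proof.
move=> x; apply: continuous_matrix => i j.
have -> : (fun x : 'rV[R]_(m * n) => vec_mx x i j) = (fun x => x 0 (mxvec_index i j)).
  by apply/funext => y; rewrite mxE.
exact: coord_continuous.
Qed.

End matrix_continuity.

(** * Compactness of the oriented Grassmannian *)

Section grassmannian_topology.
Context {R : realType} {n : nat} {d : 'I_n.+1}.

Lemma orthonormal_compact : compact [set U : 'M[R]_(d, n) | U *m U^T = 1%:M].
Proof.
set O := [set U | _].
have -> : O = vec_mx @` (vec_mx @^-1` O).
  by apply/seteqP; split=> [U OU|_ [x Ox <-]//]; exists (mxvec U); rewrite /= mxvecK.
apply: continuous_compact; first by apply: continuous_subspaceT; exact: vec_mx_continuous.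
apply: bounded_closed_compact.
  exists 1; split; first exact: num_real.
  move=> b b1 x; rewrite /= => Ox; apply: norm_matrix_le => [|i j].
    by rewrite (le_trans ler01)// ltW.
  apply: le_trans (ltW b1).
  rewrite -[x]vec_mxK (ord1 i); case/mxvec_indexP: j => k l.
  rewrite mxvecE; move: Ox; move: (vec_mx x) => U UU.
  have : (U *m U^T) k k = 1 by rewrite UU mxE eqxx.
  rewrite mxE (bigD1 l)//= mxE => e1.
  rewrite -(ler_pXn2r (_ : 0 < 2)%N)// ?nnegrE// real_normK ?num_real// expr1n -e1 expr2.
  by rewrite lerDl sumr_ge0// => j _; rewrite mxE; exact: sqr_ge0.
apply: closed_comp; first by move=> x _; exact: vec_mx_continuous.
rewrite (_ : O = (fun U : 'M[R]_(d, n) => `|U *m U^T - 1%:M|) @^-1` [set 0]); last first.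
  apply/seteqP; split=> U /=; first by move=> ->; rewrite subrr normr0.
  by move=> /eqP; rewrite normr_eq0 subr_eq0 => /eqP.
apply: closed_comp; last exact: closed_eq.
move=> U _; apply: continuous_comp; last exact: norm_continuous.
apply: continuousB; last exact: cst_continuous.
apply: continuous_mulmx; first by move=> ?; exact.
apply: continuous_matrix => i j.
have -> : (fun U : 'M[R]_(d, n) => U^T i j) = (fun U => U j i).
  by apply/funext => V; rewrite mxE.
exact: coord_continuous.
Qed.

Lemma oriented_planes_compact : compact (@oriented_planes R n d).
Proof.
rewrite (_ : @oriented_planes R n d =
    (@wedge R n d) @` [set U : 'M[R]_(d, n) | U *m U^T = 1%:M] `|`
    (fun U => - wedge U) @` [set U : 'M[R]_(d, n) | U *m U^T = 1%:M]); last first.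
  rewrite oriented_planesE; apply/seteqP; split=> [T [U UU [->|->]]|T [|] [U UU <-]].
  - by left; exists U.
  - by right; exists U.
  - by exists U => //; left.
  - by exists U => //; right.
apply: compactU; apply: continuous_compact; try exact: orthonormal_compact.
  by apply: continuous_subspaceT; exact: wedge_continuous.
apply: continuous_subspaceT => U; apply: continuousN; exact: wedge_continuous.
Qed.

Lemma set_val_continuous : continuous (set_val : oGrass R d -> ext R n d).
Proof. exact: initial_continuous. Qed.

Lemma oGrass_nbhs (T : oGrass R d) (U : set (oGrass R d)) : nbhs T U ->
  exists2 e : R, 0 < e & forall S, `|set_val T - set_val S| < e -> U S.
Proof.
move=> [B [[C oC CB] BT BU]].
have CT : C (set_val T) by move: BT; rewrite -CB.
have /nbhs_ballP[e /= e0 eC] := open_nbhs_nbhs (conj oC CT).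
exists e => // S TS; apply: BU; rewrite -CB /=; apply: eC.
by rewrite -ball_normE.
Qed.

Lemma oGrass_compact : compact [set: oGrass R d].
Proof.
apply/compact_near_coveringP => I F P FF cov.
have /compact_near_coveringP ncov := oriented_planes_compact.
(* Quantifying over membership proofs turns a property of points of the subtype into one of ambient
   vectors, to which the compactness of the set applies. *)
pose P' i x := forall (h : x \in @oriented_planes R n d), P i (exist _ x h).
suff : \forall i \near F, @oriented_planes R n d `<=` P' i.
  apply: filterS => i h [x xO] _; apply: h; by rewrite inE in xO.
apply: (ncov _ F P' FF) => x xO.
have [[A B] [/= nA FB] AB] := cov (exist _ x (mem_set xO)) Logic.I.
have [e e0 eA] := oGrass_nbhs nA.
exists (ball x e, B); first by split=> //; exact: nbhsx_ballx.
move=> [y i] [/= xy Bi] h; apply: (AB (exist _ y h, i)); split=> //=.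
by apply: eA; move: xy; rewrite -ball_normE.
Qed.

End grassmannian_topology.

(** * Varifolds *)

Section position_plane_topology.
Context {R : realType} {n : nat} {d : 'I_n.+1}.
Local Notation X := (position_plane R d).
Implicit Types z w : X.

Lemma position_continuous : continuous (fun w : X => w.1).
Proof.
move=> w U nU; exists (U, setT) => /=; first by split=> //; exact: filterT.
by move=> [a b] [].
Qed.

Lemma plane_continuous : continuous (fun w : X => w.2).
Proof.
move=> w U nU; exists (setT, U) => /=; first by split=> //; exact: filterT.
by move=> [a b] [].
Qed.

Lemma plane_val_continuous : continuous (fun w : X => set_val w.2).
Proof. by move=> w; apply: continuous_comp (@plane_continuous w) (@set_val_continuous _ _ _ w.2). Qed.

(** [position_plane] carries only a topology; this distance describes its neighbourhoods and
    provides the bumps of the partitions of unity. *)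
Definition pdist z w : R := Num.max `|z.1 - w.1| `|set_val z.2 - set_val w.2|.

Lemma pdistxx z : pdist z z = 0.
Proof. by rewrite /pdist !subrr !normr0 maxxx. Qed.

Lemma pdist_continuous z : continuous (pdist z).
Proof.
move=> w; apply: (@continuous_max R X (fun w => `|z.1 - w.1|)
    (fun w => `|set_val z.2 - set_val w.2|)).
  apply: (@continuous_comp X _ _ (fun w => z.1 - w.1) (fun x => `|x|)).
    by apply: continuousB; [exact: cst_continuous|exact: position_continuous].
  exact: norm_continuous.
apply: (@continuous_comp X _ _ (fun w => set_val z.2 - set_val w.2) (fun x => `|x|)).
  by apply: continuousB; [exact: cst_continuous|exact: plane_val_continuous].
exact: norm_continuous.
Qed.

Lemma pdist_nbhs z (U : set X) : nbhs z U ->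
  exists2 e : R, 0 < e & forall w, pdist z w < e -> U w.
Proof.
move=> [[A B] [/= nA nB] AB].
have /nbhs_ballP[e1 /= e10 e1A] := nA; have [e2 e20 e2B] := oGrass_nbhs nB.
exists (Num.min e1 e2); first by rewrite lt_min e10.
move=> w; rewrite /pdist lt_min !gt_max => /andP[/andP[h1 _] /andP[_ h2]].
by apply: AB; split; [apply: e1A; rewrite -ball_normE|exact: e2B].
Qed.

Lemma pdist_ball_open z (r : R) : open [set w : X | pdist z w < r].
Proof.
rewrite (_ : [set _ | _] = pdist z @^-1` [set s : R | s < r])//.
by apply: open_comp; [move=> w _; exact: pdist_continuous|exact: open_lt].
Qed.

Lemma cylinder_compact (K : set 'rV[R]_n) : compact K -> compact (K `*` setT : set X).
Proof. by move=> cK; apply: compact_setX; [exact: cK|exact: oGrass_compact]. Qed.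

(* Equal to 1 on the ball of radius r and to 0 off the ball of radius 2r. *)
Definition tent z (r : R) w : R := Num.max 0 (Num.min 1 (2 - r^-1 * pdist z w)).

Lemma tent_ge0 z r w : 0 <= tent z r w.
Proof. by rewrite le_max lexx. Qed.

Lemma tent_continuous z r : continuous (tent z r).
Proof.
move=> w; apply: (@continuous_max R X (fun=> 0) (fun w => Num.min 1 (2 - r^-1 * pdist z w))).
  exact: cst_continuous.
apply: (@continuous_min R X (fun=> 1) (fun w => 2 - r^-1 * pdist z w)).
  exact: cst_continuous.
apply: continuousB; first exact: cst_continuous.
by apply: continuousM; [exact: cst_continuous|exact: pdist_continuous].
Qed.

Lemma tent1 z r w : 0 < r -> pdist z w <= r -> tent z r w = 1.
Proof.
move=> r0 zw; rewrite /tent; have -> : Num.min 1 (2 - r^-1 * pdist z w) = 1.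
  apply/min_idPl; have : r^-1 * pdist z w <= 1 by rewrite ler_pdivrMl// mulr1.
  lra.
by apply/max_idPr; exact: ler01.
Qed.

Lemma tent0 z r w : 0 < r -> 2 * r <= pdist z w -> tent z r w = 0.
Proof.
move=> r0 zw; apply/max_idPl; rewrite ge_min; apply/orP; right.
by rewrite subr_le0 ler_pdivlMl// mulrC.
Qed.

(* A sum divided by max(1, sum) is at most 1, and equal to 1 where the plateaus cover. *)
Lemma partition_of_unity (W : normedModType R) (F : X -> W) (C : set X) (e : R) :
  compact C -> 0 < e -> (forall z, C z -> {for z, continuous F}) ->
  exists (s : seq X) (chi : X -> X -> R),
  [/\ forall z, z \in s -> C z,
      forall z, z \in s -> C0 (chi z),
      forall z w, 0 <= chi z w,
      forall w, C w -> \sum_(z <- s) chi z w = 1 &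
      forall z w, z \in s -> chi z w != 0 -> `|F w - F z| <= e].
Proof.
move=> cC e0 Fc.
have rP z : exists r : R, C z -> 0 < r /\ forall w, pdist z w < 2 * r -> `|F w - F z| <= e.
  have [Cz|nCz] := pselect (C z); last by exists 0.
  have /cvgrPdist_le/(_ e e0) := Fc z Cz => /pdist_nbhs[r r0 rF].
  exists (r / 2) => _; split; first by rewrite divr_gt0.
  by move=> w zw; rewrite distrC; apply: rF; rewrite mulrC divfK ?pnatr_eq0 in zw.
have [r rC] := choice rP.
move: cC; rewrite compact_cover => cC.
have [||D DC CD] := cC X C (fun z => [set w : X | pdist z w < r z]).
- by move=> z _; exact: pdist_ball_open.
- by move=> z Cz; exists z => //=; rewrite pdistxx; have [] := rC z Cz.
pose s : seq X := finmap.enum_fset D.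
have sC z : z \in s -> C z by move=> zs; have := DC z zs; rewrite inE.
pose S w := \sum_(z <- s) tent z (r z) w.
have S0 w : 0 <= S w by apply: sumr_ge0 => z _; exact: tent_ge0.
have m1 w : 0 < Num.max 1 (S w) by rewrite lt_max ltr01.
pose chi z w : R := tent z (r z) w / Num.max 1 (S w).
have chic z : continuous (chi z).
  move=> w; apply: continuousM; first exact: tent_continuous.
  apply: continuousV; first by rewrite gt_eqF.
  apply: (@continuous_max R X (fun=> 1) S); first exact: cst_continuous.
  by apply: continuous_sum => y; exact: tent_continuous.
exists s, chi; split.
- exact: sC.
- move=> z zs; have [r0 rF] := rC z (sC z zs); split; first exact: chic.
  move=> e' e'0; exists ([set x : 'rV[R]_n | `|x| <= `|z.1| + 2 * r z] `*` setT).
  split; first by apply: cylinder_compact; exact: norm_ball_compact.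
  move=> w nw; rewrite /chi tent0 ?mul0r ?normr0// leNgt; apply/negP => zw.
  apply: nw; split=> //=; rewrite -[w.1](subrK z.1) addrC.
  apply: le_trans (ler_normD _ _) _; rewrite lerD2l distrC.
  by apply: le_trans (ltW zw); rewrite /pdist le_max lexx.
- by move=> z w; rewrite divr_ge0 ?tent_ge0// ltW.
- move=> w Cw; have [z zD zw] := CD w Cw.
  have zs : z \in s by [].
  have [r0 _] := rC z (sC z zs).
  have S1 : 1 <= S w.
    rewrite /S (big_rem z)//= tent1 ?(ltW zw)// lerDl.
    by apply: sumr_ge0 => y _; exact: tent_ge0.
  rewrite -mulr_suml -/(S w); have -> : Num.max 1 (S w) = S w by apply/max_idPr.
  by rewrite mulfV// gt_eqF// (lt_le_trans ltr01).
- move=> z w zs zw; have [r0 rF] := rC z (sC z zs); apply: rF.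
  rewrite ltNge; apply/negP => h; move: zw.
  by rewrite /chi tent0// mul0r eqxx.
Qed.

End position_plane_topology.

(** * Integration against varifolds *)

Section varifold_integrals.
Context {R : realType} {n : nat} {d : 'I_n.+1}.
Local Notation X := (position_plane R d).
Local Notation borel := (g_sigma_algebraType (@open X)).
Implicit Types (mu : varifold R d) (K : set 'rV[R]_n) (f g : X -> R).

Lemma open_borel (U : set X) : open U -> measurable (U : set borel).
Proof. by move=> oU; exact: sub_sigma_algebra. Qed.

Lemma continuous_borel f : continuous f -> measurable_fun (setT : set borel) (f : borel -> R).
Proof.
move=> /continuousP cf; apply: (measurability _ (RGenOpens.measurableE R)).
move=> _ [_ [a [b ->] <-]]; rewrite setTI; apply: open_borel.
exact/cf/interval_open.
Qed.

Definition total_mass mu : R := fine (mu setT).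

Lemma total_mass_ge0 mu : 0 <= total_mass mu.
Proof. by rewrite fine_ge0. Qed.

Lemma varifold_finite mu : (mu setT < +oo)%E.
Proof. by rewrite ltey_eq fin_num_measure. Qed.

Definition bounded_continuous f := continuous f /\ exists M : R, forall z, `|f z| <= M.

Lemma bounded_continuous_integrable mu f : bounded_continuous f ->
  mu.-integrable (setT : set borel) (EFin \o f).
Proof.
move=> [fc [M fM]]; apply: measurable_bounded_integrable => //.
- exact: varifold_finite.
- exact: continuous_borel.
- exists M; split; first exact: num_real.
  by move=> x Mx z _; exact: le_trans (fM z) (ltW Mx).
Qed.

Lemma bounded_continuousD f g : bounded_continuous f -> bounded_continuous g ->
  bounded_continuous (fun z => f z + g z).
Proof.
move=> [fc [M fM]] [gc [N gN]]; split; first by move=> z; apply: continuousD; [exact: fc|exact: gc].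
by exists (M + N) => z; apply: le_trans (ler_normD _ _) _; exact: lerD.
Qed.

Lemma bounded_continuousZ a f : bounded_continuous f -> bounded_continuous (fun z => a * f z).
Proof.
move=> [fc [M fM]]; split.
  by move=> z; apply: continuousM; [exact: cst_continuous|exact: fc].
by exists (`|a| * M) => z; rewrite normrM ler_wpM2l.
Qed.

Lemma bounded_continuous_cst (a : R) : bounded_continuous (fun=> a).
Proof. by split; [exact: cst_continuous|exists `|a|]. Qed.

Lemma bounded_continuousB f g : bounded_continuous f -> bounded_continuous g ->
  bounded_continuous (fun z => f z - g z).
Proof.
move=> fb /(bounded_continuousZ (-1)) gb; have := bounded_continuousD fb gb.
by under eq_fun do rewrite mulN1r.
Qed.

Lemma bounded_continuous_sum (I : eqType) (r : seq I) (F : I -> X -> R) :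
  (forall i, i \in r -> bounded_continuous (F i)) ->
  bounded_continuous (fun z => \sum_(i <- r) F i z).
Proof.
elim: r => [|i r IH] Fb.
  by under eq_fun do rewrite big_nil; exact: bounded_continuous_cst.
under eq_fun do rewrite big_cons; apply: bounded_continuousD.
  by apply: Fb; rewrite mem_head.
by apply: IH => j jr; apply: Fb; rewrite in_cons jr orbT.
Qed.

Lemma C0_bounded_continuous f : C0 (f : X -> R^o) -> bounded_continuous f.
Proof. by move=> f0; split; [case: f0|exact: C0_bounded f0]. Qed.

Lemma pairingD mu f g : bounded_continuous f -> bounded_continuous g ->
  pairing mu (fun z => f z + g z) = pairing mu f + pairing mu g.
Proof. by move=> fb gb; rewrite /pairing RintegralD//; exact: bounded_continuous_integrable. Qed.

Lemma pairingB mu f g : bounded_continuous f -> bounded_continuous g ->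
  pairing mu (fun z => f z - g z) = pairing mu f - pairing mu g.
Proof. by move=> fb gb; rewrite /pairing RintegralB//; exact: bounded_continuous_integrable. Qed.

Lemma pairingZ mu a f : bounded_continuous f ->
  pairing mu (fun z => a * f z) = a * pairing mu f.
Proof. by move=> fb; rewrite /pairing RintegralZl//; exact: bounded_continuous_integrable. Qed.

Lemma pairing_cst mu a : pairing mu (fun=> a) = a * total_mass mu.
Proof. by rewrite /pairing Rintegral_cst. Qed.

Lemma pairing_sum mu (I : eqType) (r : seq I) (F : I -> X -> R) :
  (forall i, i \in r -> bounded_continuous (F i)) ->
  pairing mu (fun z => \sum_(i <- r) F i z) = \sum_(i <- r) pairing mu (F i).
Proof.
elim: r => [|i r IH] Fb.
  under eq_fun do rewrite big_nil.
  by rewrite pairing_cst mul0r big_nil.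
under eq_fun do rewrite big_cons; rewrite big_cons pairingD.
- by congr (_ + _); apply: IH => j jr; apply: Fb; rewrite in_cons jr orbT.
- by apply: Fb; rewrite mem_head.
- by apply: bounded_continuous_sum => j jr; apply: Fb; rewrite in_cons jr orbT.
Qed.

(** For closed K this is equivalent to the support of the mass lying in K; it is the form in which
    integrals are estimated. *)
Definition concentrated mu K := mu (~` (K `*` setT)) = 0%E.

Lemma norm_pairing_le mu f K (e : R) : bounded_continuous f -> closed K ->
  concentrated mu K -> 0 <= e -> (forall z, K z.1 -> `|f z| <= e) ->
  `|pairing mu f| <= e * total_mass mu.
Proof.
move=> fb cK muK e0 fe.
have fi := bounded_continuous_integrable mu fb.
have oK : open (~` (K `*` setT) : set X).
  rewrite (_ : ~` _ = (fun z : X => z.1) @^-1` (~` K)).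
    by apply: open_comp; [move=> z _; exact: position_continuous|exact: closed_openC].
  by apply/seteqP; split=> z /=; [move=> h Kz; apply: h|move=> h []].
have mN := open_borel oK.
have := le_normr_Rintegral (@measurableT _ borel) fi => /le_trans; apply.
have nfi : mu.-integrable (setT : set borel) (EFin \o (fun z => `|f z|)).
  exact: (integrable_norm fi).
rewrite -lee_fin /Rintegral fineK; last exact: integrable_fin_num.
rewrite (negligible_integral mN _ nfi muK)// setTD setCK.
have mC : measurable (K `*` setT : set borel) by rewrite -[X in measurable X]setCK; exact: measurableC.
apply: (@le_trans _ _ (\int[mu]_(z in K `*` setT) (cst e%:E z))%E).
  apply: ge0_le_integral => //=.
  - by apply: measurable_funTS; case/integrableP: nfi.
  - by move=> z [Kz _]; rewrite lee_fin; exact: fe.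
rewrite integral_cst// EFinM lee_wpmul2l ?lee_fin// /total_mass fineK ?fin_num_measure//.
by apply: le_measure; rewrite ?inE.
Qed.

Lemma row_rat_dense (x : 'rV[R]_n) (e : R) : 0 < e ->
  exists q : 'rV[rat]_n, `|x - map_mx ratr q| < e.
Proof.
move=> e0; have e2 : 0 < e / 2 by rewrite divr_gt0.
have /choice[q qP] (i : 'I_n) : exists q : rat, `|x 0 i - ratr q| <= e / 2.
  have : x 0 i - e / 2 < x 0 i + e / 2 by lra.
  move=> /rat_in_itvoo[q]; rewrite in_itv/= => /andP[h1 h2].
  by exists q; rewrite ler_norml; apply/andP; split; lra.
exists (\row_i q i); apply: le_lt_trans (_ : e / 2 < e); last by lra.
by apply: norm_row_le => [|i]; [exact: ltW|rewrite !mxE].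
Qed.

(* Rational balls provide a countable cover of the complement of the support by null sets. *)
Lemma support_concentrated mu K : closed K -> msupport (mass mu) `<=` K -> concentrated mu K.
Proof.
move=> cK suppK.
pose B (qk : 'rV[rat]_n * nat) : set X :=
  [set z | `|map_mx ratr qk.1 - z.1| < qk.2.+1%:R^-1].
have oB qk : open (B qk).
  pose c : 'rV[R]_n := map_mx ratr qk.1.
  have -> : B qk = (fun z : X => `|c - z.1|) @^-1` [set s : R | s < qk.2.+1%:R^-1] by [].
  apply: open_comp; last exact: open_lt.
  move=> z _; apply: (@continuous_comp X _ _ (fun w => c - w.1) (fun x => `|x|)).
    by apply: continuousB; [exact: cst_continuous|exact: position_continuous].
  exact: norm_continuous.
(* Indices that code no ball, or a ball of positive measure, contribute the empty set. *)
pose F (i : nat) : set borel := if unpickle i is Some qk then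
  (if mu (B qk) == 0%E then B qk else set0) else set0.
have Fnull i : mu.-negligible (F i).
  rewrite /F; case: (unpickle i) => [qk|]; last exact: negligible_set0.
  case: eqP => [e|_]; last exact: negligible_set0.
  by apply/negligibleP => //; exact: open_borel.
have sub : (~` (K `*` setT) : set borel) `<=` \bigcup_i F i.
  move=> z nz; have nKz : ~ K z.1 by move=> Kz; apply: nz.
  have [U [oU Uz] U0] : exists2 U, open_nbhs z.1 U & ~ (0 < mass mu U)%E.
    apply: contrapT => h; apply: nKz; apply: suppK => U oU.
    by apply: contrapT => h'; apply: h; exists U.
  have /nbhs_ballP[e /= e0 eU] := open_nbhs_nbhs (conj oU Uz).
  (* The rational center q will be within 1 / (k + 1) of z, and two such radii stay below e, so the
     ball around q lies in U. *)
  pose k := Num.trunc (2 / e).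
  have ke : k.+1%:R^-1 < e / 2.
    rewrite -[e / 2]invrK ltf_pV2 ?posrE ?invr_gt0 ?divr_gt0//.
    by rewrite invf_div; apply: truncnS_gt; rewrite divr_ge0// ltW.
  have [q qz] := @row_rat_dense z.1 k.+1%:R^-1 (ltac:(by rewrite invr_gt0)).
  exists (pickle (q, k)) => //; rewrite /F pickleK.
  have BU : B (q, k) `<=` U `*` setT.
    move=> w /= Bw; split=> //; apply: eU; rewrite -ball_normE /ball_/=.
    rewrite -[z.1](subrK (map_mx ratr q)) -addrA.
    apply: le_lt_trans (ler_normD _ _) _; rewrite (splitr e).
    by apply: ltrD; [exact: lt_trans ke|exact: lt_trans ke].
  have oUT : open (U `*` setT : set X).
    rewrite (_ : _ `*` _ = (fun z : X => z.1) @^-1` U).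
      by apply: open_comp => // w _; exact: position_continuous.
    by apply/seteqP; split=> w /=; [case|].
  have muU : mu (U `*` setT) = 0%E.
    by apply/eqP; rewrite eq_le measure_ge0 andbT leNgt; exact/negP.
  have -> : mu (B (q, k)) == 0%E.
    rewrite eq_le measure_ge0 andbT -muU; apply: le_measure => //; rewrite inE; exact: open_borel.
  by rewrite /B/= distrC.
have oK : open (~` (K `*` setT) : set X).
  rewrite (_ : ~` _ = (fun z : X => z.1) @^-1` (~` K)).
    by apply: open_comp; [move=> z _; exact: position_continuous|exact: closed_openC].
  by apply/seteqP; split=> z /=; [move=> h Kz; apply: h|move=> h []].
apply/negligibleP; first exact: open_borel.
exact: negligibleS sub (negligible_bigcup Fnull).
Qed.

Lemma concentrated_support mu K : closed K -> concentrated mu K -> msupport (mass mu) `<=` K.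
Proof.
move=> cK muK x xs; apply: contrapT => nKx.
have := xs (~` K) (conj (closed_openC cK) nKx).
rewrite /mass (_ : ~` K `*` setT = ~` (K `*` setT)) ?muK ?ltxx//.
by apply/seteqP; split=> z /=; [move=> [h _] []|move=> h; split=> // Kz; apply: h].
Qed.

End varifold_integrals.

(** * Finite sums of Dirac masses *)

Section discrete_measures.
Context {R : realType} {n : nat} {d : 'I_n.+1}.
Local Notation X := (position_plane R d).
Local Notation borel := (g_sigma_algebraType (@open X)).
Variables (r : nat -> {nonneg R}) (z : nat -> X) (N : nat).

Definition discrete_measure : set borel -> \bar R :=
  msum (fun k => mscale (r k) (dirac (z k : borel))) N.

HB.instance Definition _ := Measure.on discrete_measure.

Lemma discrete_measureE (A : set borel) :
  discrete_measure A = (\sum_(i < N) (r i)%:num%:E * \d_(z i : borel) A)%E.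
Proof. by rewrite /discrete_measure /msum. Qed.

Fact discrete_measure_finite : fin_num_fun discrete_measure.
Proof.
move=> A mA; rewrite discrete_measureE sum_fin_num; apply/allP => x /mapP[i _ ->].
by apply: fin_numM; rewrite // diracE.
Qed.

HB.instance Definition _ := Measure_isFinite.Build _ _ _ discrete_measure discrete_measure_finite.

Lemma discrete_pairing (f : X -> R) : bounded_continuous f ->
  pairing (discrete_measure : varifold R d) f = \sum_(i < N) (r i)%:num * f (z i).
Proof.
move=> fb; have [fc [M fM]] := fb.
(* Additivity in the measure is first used for non-negative integrands; f is then shifted by its
   bound M. *)
have pos (g : X -> R) : continuous g -> (forall w, 0 <= g w) ->
    pairing (discrete_measure : varifold R d) g = \sum_(i < N) (r i)%:num * g (z i).
  move=> gc g0; have mg : measurable_fun (setT : set borel) (EFin \o g).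
    by apply/measurable_EFinP; exact: continuous_borel.
  rewrite /pairing /Rintegral ge0_integral_measure_sum//=; last by move=> w _; rewrite lee_fin.
  under eq_bigr => i _.
    rewrite ge0_integral_mscale//; last by move=> w _; rewrite lee_fin.
    rewrite integral_dirac// diracT mul1e -EFinM.
    over.
  by rewrite sumEFin.
have M0 : 0 <= M by apply: le_trans (fM (z 0%N)).
have h1 : pairing (discrete_measure : varifold R d) (fun w => f w + M) =
    \sum_(i < N) (r i)%:num * (f (z i) + M).
  apply: (pos (fun w => f w + M)).
    by move=> w; apply: continuousD; [exact: fc|exact: cst_continuous].
  by move=> w; have := fM w; rewrite ler_norml => /andP[h _]; rewrite -lerBlDr sub0r.
have h2 := pos (fun=> M) (@cst_continuous _ _ M) (fun=> M0).
move: h1; rewrite pairingD//; last exact: bounded_continuous_cst.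
rewrite h2; under [in RHS]eq_bigr do rewrite mulrDr.
by rewrite big_split/= => /addIr.
Qed.

End discrete_measures.

(** * Pushforwards as integrals with values in W *)

Section dual_norms.
Context {R : realType} {X : Type} {H : hilbertType R}.
Variable ev : H -> X -> R.
Implicit Types l : (X -> R) -> R.

(** [dual_norm] is a real [sup], which takes a default value on unbounded sets; it dominates the
    values of l only under this condition. *)
Definition dual_bounded l := exists B : R, forall h : H, `|h| <= 1 -> `|l (ev h)| <= B.

Lemma dual_norm_le l (B : R) : (forall h, `|h| <= 1 -> `|l (ev h)| <= B) -> dual_norm ev l <= B.
Proof.
move=> lB; apply: ge_sup => [|_ [h /= h1 <-]]; last exact: lB.
by exists `|l (ev 0)|, 0; rewrite //= normr0.
Qed.

Lemma dual_norm_ge l h : dual_bounded l -> `|h| <= 1 -> `|l (ev h)| <= dual_norm ev l.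
Proof.
move=> [B lB] h1; apply: ub_le_sup; last by exists h.
by exists B => _ [g /= g1 <-]; exact: lB.
Qed.

Lemma dual_norm_ge0 l : dual_bounded l -> 0 <= dual_norm ev l.
Proof. by move=> lB; apply: le_trans (dual_norm_ge (h := 0) lB _); rewrite ?normr0. Qed.

Lemma dual_norm_dist l l' (e : R) : dual_bounded l -> dual_bounded l' ->
  (forall h, `|h| <= 1 -> `|l (ev h) - l' (ev h)| <= e) ->
  `|dual_norm ev l - dual_norm ev l'| <= e.
Proof.
move=> lB l'B ll'.
have half l1 l2 : dual_bounded l2 -> (forall h, `|h| <= 1 -> `|l1 (ev h) - l2 (ev h)| <= e) ->
    dual_norm ev l1 <= dual_norm ev l2 + e.
  move=> l2B d; apply: dual_norm_le => h h1.
  rewrite -[l1 _](subrK (l2 (ev h))) addrC; apply: le_trans (ler_normD _ _) _.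
  by apply: lerD; [exact: dual_norm_ge|exact: d].
rewrite ler_norml lerBrDr addrC lerBlDr (half l' l)//=; last first.
  by move=> h h1; rewrite distrC; exact: ll'.
by rewrite lerBlDl half.
Qed.

End dual_norms.

Section feature_map.
Context {R : realType} {n : nat} {d : 'I_n.+1} {W : hilbertType R}.
Local Notation X := (position_plane R d).
Variables (evW : W -> X -> R) (k : X -> W) (c : R).
Hypothesis kP : forall h z, evW h z = inner (k z) h.
Hypothesis k_norm : forall z, `|k z| = c.
Hypothesis evW_C0 : forall h, C0 (evW h : X -> R^o).

(** Since |k z| is constant, |k z - k w|^2 = 2 (k(z, z) - k(z, w)): continuity of the single
    function k(z, .) at z is enough. *)
Lemma feature_continuous : continuous k.
Proof.
move=> z; apply/cvgrPdist_le => e e0.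
have [kc _] := evW_C0 (k z).
have e2 : 0 < e ^+ 2 / 2 by rewrite divr_gt0// exprn_gt0.
have /cvgrPdist_le/(_ _ e2) := kc z; apply: filterS => w.
rewrite !kP inner_normE k_norm => h.
rewrite -(ler_pXn2r (_ : 0 < 2)%N)// ?nnegrE// ?(ltW e0)// sqr_normB !k_norm.
by move: h; rewrite ler_norml (innerC (k w)) => /andP[_ h]; lra.
Qed.

(** A map phi enters the pushforward at a point only through its value and Jacobian there. On
    triples, continuity is a finite-dimensional question independent of the flow. *)
Definition theta (p : 'rV[R]_n * 'M[R]_n * oGrass R d) : W :=
  tangent_jacobian p.1.2 p.2 *: k (p.1.1, oGrass_act p.1.2 p.2).

Local Notation P3 := ('rV[R]_n * 'M[R]_n * oGrass R d)%type.

Lemma theta_continuous (p : P3) : p.1.2 \in unitmx -> {for p, continuous theta}.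
Proof.
move=> Au.
have c1 : {for p, continuous (fun p : P3 => p.1.1)}.
  by apply: (@continuous_comp P3 _ _ (fun p => p.1) fst); exact: cvg_fst.
have c2 : {for p, continuous (fun p : P3 => p.1.2)}.
  by apply: (@continuous_comp P3 _ _ (fun p => p.1) snd); [exact: cvg_fst|exact: cvg_snd].
have c3 : {for p, continuous (fun p : P3 => set_val p.2)}.
  by apply: continuous_comp; [exact: cvg_snd|exact: set_val_continuous].
have cT : {for p, continuous (fun p : P3 => set_val p.2 *m ext_map d p.1.2)}.
  apply: continuous_mulmx => //.
  by apply: (@continuous_comp P3 _ _ (fun p => p.1.2) (ext_map d)) => //; exact: ext_map_continuous.
have cJ : {for p, continuous (fun p : P3 => enorm (set_val p.2 *m ext_map d p.1.2))}.
  apply: (@continuous_comp P3 _ _ (fun p => set_val p.2 *m ext_map d p.1.2) (@enorm R _)) => //.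
  exact: continuous_enorm.
have J0 : enorm (set_val p.2 *m ext_map d p.1.2) != 0.
  by rewrite gt_eqF// enorm_gt0 ext_map_neq0.
have cU : {for p, continuous (fun p : P3 => unitize (set_val p.2 *m ext_map d p.1.2))}.
  by apply: cvgZ => //; apply: cvgV.
(* [oGrass_actE] gives the action by a formula at invertible matrices only, hence on a neighbourhood
   of p. *)
have nu : \forall q \near p, q.1.2 \in unitmx.
  have cdet : {for p, continuous (fun p : P3 => \det p.1.2)}.
    apply: (@continuous_det R P3 n (fun p => p.1.2)) => i j.
    by apply: (@continuous_comp P3 _ _ (fun p => p.1.2) (fun A => A i j)) => //; exact: coord_continuous.
  have d0 : 0 < `|\det p.1.2| by rewrite normr_gt0 -unitfE -unitmxE.
  have /cvgrPdist_lt/(_ _ d0) := cdet; apply: filterS => q.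
  rewrite unitmxE unitfE; apply: contraTneq => ->.
  by rewrite subr0 ltxx.
have cA : {for p, continuous (fun p : P3 => (p.1.1, oGrass_act p.1.2 p.2) : X)}.
  move=> U /pdist_nbhs[e e0 eU].
  have /cvgrPdist_lt/(_ _ e0) h1 := c1; have /cvgrPdist_lt/(_ _ e0) h2 := cU.
  suff : \forall q \near p, U (q.1.1, oGrass_act q.1.2 q.2) by [].
  near=> q; apply: eU; rewrite /pdist gt_max; apply/andP; split=> /=.
    by near: q; exact: h1.
  by rewrite !oGrass_actE//; [near: q; exact: h2|near: q; exact: nu].
rewrite /theta; apply: cvgZ.
  have -> : (fun p : P3 => tangent_jacobian p.1.2 p.2) =
    (fun p => enorm (set_val p.2 *m ext_map d p.1.2)).
    by apply/funext => q; exact: tangent_jacobianE.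
  by rewrite tangent_jacobianE; exact: cJ.
apply: (@continuous_comp P3 _ _ (fun p => (p.1.1, oGrass_act p.1.2 p.2) : X) k) => //.
exact: feature_continuous.
Unshelve. all: by end_near. Qed.

Lemma theta_close (y : 'rV[R]_n) (A : 'M[R]_n) (T : oGrass R d) (e : R) : A \in unitmx -> 0 < e ->
  exists2 r : R, 0 < r & forall y' A' T', `|y - y'| < r -> `|A - A'| < r ->
    `|set_val T - set_val T'| < r -> `|theta (y, A, T) - theta (y', A', T')| <= e.
Proof.
move=> Au e0; have /cvgrPdist_le/(_ _ e0) := @theta_continuous (y, A, T) Au.
move=> [[B1 B2] [/= [[B11 B12] [/= n11 n12] B1s] n2] Bs].
have /nbhs_ballP[r1 /= r10 r1B] := n11; have /nbhs_ballP[r2 /= r20 r2B] := n12.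
have [r3 r30 r3B] := oGrass_nbhs n2.
exists (Num.min r1 (Num.min r2 r3)); first by rewrite !lt_min r10 r20.
move=> y' A' T'; rewrite !lt_min => /and3P[h1 _ _] /and3P[_ h2 _] /and3P[_ _ h3].
apply: (Bs (y', A', T')); split=> /=; last exact: r3B.
by apply: (B1s (y', A')); split=> /=; [apply: r1B|apply: r2B]; rewrite -ball_normE.
Qed.

Definition push (phi : 'rV[R]_n -> 'rV[R]_n) (z : X) : W := theta (phi z.1, 'J phi z.1, z.2).

Lemma pushforward_pairingE phi (mu : varifold R d) h :
  pushforward_pairing phi mu (evW h) = pairing mu (fun z => inner (push phi z) h).
Proof.
apply: eq_Rintegral => z _.
by rewrite /push /theta innerZl -kP mulrC.
Qed.

Section regular_maps.
Variable phi : 'rV[R]_n -> 'rV[R]_n.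
Hypothesis phi_cont : continuous phi.
Hypothesis phi_jac : continuous (jacobian phi).
Hypothesis phi_unit : forall x, 'J phi x \in unitmx.

Lemma near_map_jacobian (z : X) (r : R) : 0 < r -> \forall w \near z,
  [/\ `|phi z.1 - phi w.1| < r, `|'J phi z.1 - 'J phi w.1| < r & `|set_val z.2 - set_val w.2| < r].
Proof.
move=> r0; have cphi : {for z, continuous (fun z : X => phi z.1)}.
  apply: (@continuous_comp X _ _ (fun w => w.1) phi); last exact: phi_cont.
  exact: position_continuous.
have cJ : {for z, continuous (fun z : X => 'J phi z.1)}.
  apply: (@continuous_comp X _ _ (fun w => w.1) (jacobian phi)); last exact: phi_jac.
  exact: position_continuous.
have /cvgrPdist_lt/(_ _ r0) h1 := cphi; have /cvgrPdist_lt/(_ _ r0) h2 := cJ.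
have /cvgrPdist_lt/(_ _ r0) h3 := @plane_val_continuous _ _ _ z.
by near=> w; split; near: w; [exact: h1|exact: h2|exact: h3].
Unshelve. all: by end_near. Qed.

Lemma push_continuous : continuous (push phi).
Proof.
move=> z; apply/cvgrPdist_le => e e0.
have [r r0 rP] := theta_close (phi z.1) z.2 (phi_unit z.1) e0.
by apply: filterS (near_map_jacobian z r0) => w [h1 h2 h3]; exact: rP.
Qed.

(** Compactness of K times the Grassmannian makes the radius of [theta_close] uniform; the near
    covering is taken over radii r tending to 0 from the right. *)
Lemma push_close (K : set 'rV[R]_n) (e : R) : compact K -> 0 < e ->
  exists2 r : R, 0 < r & forall psi (z : X), K z.1 -> `|psi z.1 - phi z.1| <= r ->
    `|'J psi z.1 - 'J phi z.1| <= r -> `|push psi z - push phi z| <= e.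
Proof.
move=> cK e0; have e2 : 0 < e / 2 by rewrite divr_gt0.
have := @cylinder_compact R n d K cK; rewrite compact_near_coveringP => cov.
pose P (r : R) (z : X) := forall y A, `|y - phi z.1| <= r -> `|A - 'J phi z.1| <= r ->
  `|theta (y, A, z.2) - push phi z| <= e.
suff : \forall r \near 0^'+, (K `*` setT : set X) `<=` P r.
  move=> h; have [r [r0 rP]] : exists r : R, 0 < r /\ (K `*` setT : set X) `<=` P r.
    near (0 : R)^'+ => r; exists r; split; first by near: r; exact: nbhs_right_gt.
    by near: r; exact: h.
  by exists r => // psi z Kz h1 h2; exact: rP.
apply: cov => z0 _.
have [r r0 rP] := theta_close (phi z0.1) z0.2 (phi_unit z0.1) e2.
have r2 : 0 < r / 2 by rewrite divr_gt0.
have h := near_map_jacobian z0 r2.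
exists ([set z : X | [/\ `|phi z0.1 - phi z.1| < r / 2, `|'J phi z0.1 - 'J phi z.1| < r / 2 &
    `|set_val z0.2 - set_val z.2| < r / 2]], [set s | s < r / 2]).
  by split=> /=; [exact: h|exact: nbhs_right_lt].
have r2r : r / 2 < r by lra.
move=> [z s] [/= [z1 z2 /lt_trans/(_ r2r) z3] sr] y A yz Az.
rewrite -[theta _](subrK (theta (phi z0.1, 'J phi z0.1, z0.2))) -addrA.
apply: le_trans (ler_normD _ _) _; rewrite (splitr e); apply: lerD.
  rewrite distrC; apply: rP => //.
    rewrite -[phi z0.1](subrK (phi z.1)) -addrA; apply: le_lt_trans (ler_normD _ _) _.
    by rewrite (splitr r); apply: ltr_leD => //; rewrite distrC (le_trans yz)// ltW.
  rewrite -['J phi z0.1](subrK ('J phi z.1)) -addrA; apply: le_lt_trans (ler_normD _ _) _.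
  by rewrite (splitr r); apply: ltr_leD => //; rewrite distrC (le_trans Az)// ltW.
by apply: rP => //; exact: lt_trans r2r.
Unshelve. all: by end_near. Qed.

(** A bound over all of R^n: the tangent Jacobian is continuous on the compact product of a ball of
    matrices with the Grassmannian. *)
Lemma push_bounded (C : R) : (forall x, `|'J phi x| <= C) -> exists M, forall z, `|push phi z| <= M.
Proof.
move=> phiC.
pose g (p : 'rV[R]_(n * n) * oGrass R d) : R := enorm (set_val p.2 *m ext_map d (vec_mx p.1)).
have gc : continuous g.
  move=> p; apply: (@continuous_comp _ _ _
    (fun p : 'rV[R]_(n * n) * oGrass R d => set_val p.2 *m ext_map d (vec_mx p.1)) (@enorm R _)).
    apply: continuous_mulmx.
      by apply: continuous_comp; [exact: cvg_snd|exact: set_val_continuous].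
    apply: (@continuous_comp _ _ _ (fun p : 'rV[R]_(n * n) * oGrass R d => vec_mx p.1) (ext_map d)).
      by apply: continuous_comp; [exact: cvg_fst|exact: vec_mx_continuous].
    exact: ext_map_continuous.
  exact: continuous_enorm.
have cc := compact_setX (@norm_ball_compact R (n * n) C) (@oGrass_compact R n d).
have [M [_ MP]] : bounded_set (g @` ([set x | `|x| <= C] `*` setT)).
  by apply: compact_bounded; apply: continuous_compact => //; exact: continuous_subspaceT.
exists ((M + 1) * c) => z; rewrite /push /theta normrZ k_norm ler_wpM2r//.
  by rewrite -(k_norm z).
rewrite tangent_jacobianE; apply: MP; first by rewrite ltrDl.
exists (mxvec ('J phi z.1), z.2); last by rewrite /g/= mxvecK.
split=> //=; apply: norm_row_le; first by apply: le_trans (phiC 0).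
move=> i; case/mxvec_indexP: i => a b; rewrite mxvecE.
exact: le_trans (entry_le _ _ _) (phiC _).
Qed.

End regular_maps.

End feature_map.

(** * Quantization *)

Lemma C0_sum {R : realType} {T : topologicalType} {I : eqType} (r : seq I) (F : I -> T -> R) :
  (forall i, i \in r -> C0 (F i : T -> R^o)) -> C0 ((fun x => \sum_(i <- r) F i x) : T -> R^o).
Proof.
elim: r => [|i r IH] FC.
  have -> : (fun x : T => \sum_(i <- [::]) F i x) = fun=> 0 by apply/funext => x; rewrite big_nil.
  split; first exact: cst_continuous.
  by move=> e e0; exists set0; split=> [|x _]; [exact: compact0|rewrite normr0].
have [ic iC] := FC i (mem_head i r).
have [|rc rC] := IH; first by move=> j jr; apply: FC; rewrite inE jr orbT.
have -> : (fun x : T => \sum_(i <- i :: r) F i x) = fun x => F i x + \sum_(i <- r) F i x.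
  by apply/funext => x; rewrite big_cons.
split; first by move=> x; apply: (@continuousD R R^o T); [exact: ic|exact: rc].
move=> e e0; have e2 : 0 < e / 2 by rewrite divr_gt0.
have [K1 [cK1 K1P]] := iC _ e2; have [K2 [cK2 K2P]] := rC _ e2.
exists (K1 `|` K2); split=> [|x /not_orP[nK1 nK2]]; first exact: compactU.
by apply: le_lt_trans (ler_normD _ _) _; rewrite (splitr e) ltrD//; [exact: K1P|exact: K2P].
Qed.

Section quantization.
Context {R : realType} {n : nat} {d : 'I_n.+1} {W : hilbertType R}.
Local Notation X := (position_plane R d).
Local Notation borel := (g_sigma_algebraType (@open X)).
Variables (evW : W -> X -> R) (k : X -> W) (c : R).
Hypothesis kP : forall h z, evW h z = inner (k z) h.
Hypothesis k_norm : forall z, `|k z| = c.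
Hypothesis evW_univ : C0_universal (evW : W -> X -> R).
Implicit Types (mu nu : varifold R d) (K : set 'rV[R]_n) (F : X -> W).

Lemma evW_C0 h : C0 (evW h : X -> R^o).
Proof. by case: evW_univ. Qed.

Lemma inner_bounded_continuous F h (M : R) : continuous F -> (forall z, `|F z| <= M) ->
  bounded_continuous (fun z => inner (F z) h).
Proof.
move=> Fc FM; split; last first.
  by exists (M * `|h|) => z; apply: le_trans (inner_le _ _) _; rewrite ler_wpM2r.
move=> z; apply/cvgrPdist_le => e e0.
have h1 : 0 < `|h| + 1 by rewrite ltr_wpDl.
have e1 : 0 < e / (`|h| + 1) by rewrite divr_gt0.
have /cvgrPdist_le/(_ _ e1) := Fc z; apply: filterS => w Fw.
rewrite -innerBl; apply: le_trans (inner_le _ _) _.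
apply: (le_trans (y := e / (`|h| + 1) * `|h|)); first by rewrite ler_wpM2r.
by rewrite mulrAC ler_pdivrMr// ler_wpM2l ?(ltW e0)//; lra.
Qed.

Lemma norm_inner_unit (x h : W) : `|h| <= 1 -> `|inner x h| <= `|x|.
Proof. by move=> h1; apply: le_trans (inner_le _ _) _; rewrite ler_piMr. Qed.

(** Up to the oscillation e, the pairing depends on mu only through the finitely many numbers
    [pairing mu (chi z)], which do not involve h. All uniformity in h stems from this. *)
Lemma pairing_partition mu K F (M e : R) (s : seq X) (chi : X -> X -> R) h :
  closed K -> concentrated mu K -> continuous F -> (forall z, `|F z| <= M) -> 0 <= e ->
  (forall z, z \in s -> C0 (chi z : X -> R^o)) -> (forall z w, 0 <= chi z w) ->
  (forall w, K w.1 -> \sum_(z <- s) chi z w = 1) ->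
  (forall z w, z \in s -> chi z w != 0 -> `|F w - F z| <= e) -> `|h| <= 1 ->
  `|pairing mu (fun w => inner (F w) h) - \sum_(z <- s) inner (F z) h * pairing mu (chi z)|
    <= e * total_mass mu.
Proof.
move=> cK muK Fc FM e0 chiC chi0 chi1 chiF h1.
have chib z : z \in s -> bounded_continuous (chi z).
  by move=> zs; apply: C0_bounded_continuous; exact: chiC.
have sumb : bounded_continuous (fun w => \sum_(z <- s) inner (F z) h * chi z w).
  by apply: bounded_continuous_sum => z zs; exact/bounded_continuousZ/chib.
have Fb := inner_bounded_continuous h Fc FM.
have -> : \sum_(z <- s) inner (F z) h * pairing mu (chi z) =
    pairing mu (fun w => \sum_(z <- s) inner (F z) h * chi z w).
  rewrite pairing_sum; last by move=> z zs; exact/bounded_continuousZ/chib.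
  by rewrite big_seq [RHS]big_seq; apply: eq_bigr => z zs; rewrite pairingZ//; exact: chib.
rewrite -pairingB//; apply: (norm_pairing_le _ cK muK) => //; first exact: bounded_continuousB.
move=> w Kw.
have -> : inner (F w) h - \sum_(z <- s) inner (F z) h * chi z w =
    \sum_(z <- s) chi z w * inner (F w - F z) h.
  rewrite -[inner (F w) h]mul1r -(chi1 w Kw) mulr_suml -sumrB; apply: eq_bigr => z _.
  by rewrite innerBl; ring.
rewrite -[e]mul1r -(chi1 w Kw) mulr_suml; apply: le_trans (ler_norm_sum _ _ _) _.
rewrite big_seq [leRHS]big_seq; apply: ler_sum => z zs.
rewrite normrM ger0_norm//; have [->|nz] := eqVneq (chi z w) 0; first by rewrite !mul0r.
by rewrite ler_wpM2l//; apply: le_trans (norm_inner_unit _ h1) _; exact: chiF.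
Qed.

Lemma pairing_bounded mu (f : X -> R) (M : R) : continuous f -> (forall z, `|f z| <= M) ->
  `|pairing mu f| <= M * total_mass mu.
Proof.
move=> fc fM; apply: (@norm_pairing_le _ _ _ mu f setT) => //.
- by split=> //; exists M.
- by rewrite /concentrated setXTT setCT measure0.
- exact: le_trans (fM point).
Qed.

Lemma dual_bounded_pairing mu F (M : R) : continuous F -> (forall z, `|F z| <= M) ->
  forall h, `|h| <= 1 -> `|pairing mu (fun z => inner (F z) h)| <= M * total_mass mu.
Proof.
move=> Fc FM h h1; have [fc _] := inner_bounded_continuous h Fc FM.
by apply: pairing_bounded => // z; apply: le_trans (norm_inner_unit _ h1) _.
Qed.

Lemma evWE h : evW h = fun z => inner (k z) h.
Proof. by apply/funext => z. Qed.

Lemma varifold_dist_bounded mu nu :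
  dual_bounded evW (fun omega => pairing mu omega - pairing nu omega).
Proof.
have kc := feature_continuous kP k_norm evW_C0.
have kM z : `|k z| <= c by rewrite k_norm.
exists (c * total_mass mu + c * total_mass nu) => h h1; rewrite evWE.
by apply: le_trans (ler_normB _ _) _; apply: lerD; exact: dual_bounded_pairing.
Qed.

Lemma pairing_varifold_dist mu nu h :
  `|pairing mu (evW h) - pairing nu (evW h)| <= `|h| * varifold_dist evW mu nu.
Proof.
have [->|h0] := eqVneq h 0.
  have -> : evW 0 = fun=> 0 by apply/funext => z; rewrite kP innerC inner0l.
  by rewrite !pairing_cst !mul0r subrr !normr0 mul0r.
have n0 : 0 < `|h| by rewrite normr_gt0.
have h1 : `|(`|h|^-1 *: h)| <= 1 by rewrite normrZ normfV normr_id mulVf ?gt_eqF.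
have := dual_norm_ge (varifold_dist_bounded mu nu) h1.
have -> : evW (`|h|^-1 *: h) = fun z => `|h|^-1 * evW h z.
  by apply/funext => z; rewrite !kP innerZr.
have hb := C0_bounded_continuous (evW_C0 h).
by rewrite !pairingZ// -mulrBr normrM normfV normr_id ler_pdivrMl.
Qed.

Lemma quantization mu K (e : R) : compact K -> concentrated mu K -> 0 < e ->
  exists N0, forall N, (N0 <= N)%N -> exists nu,
    [/\ discrete_varifolds N nu, concentrated nu K & varifold_dist evW nu mu <= e].
Proof.
move=> cK muK e0.
have m1 : 0 < total_mass mu + 1 by rewrite ltr_wpDl// total_mass_ge0.
have e1 : 0 < e / (total_mass mu + 1) by rewrite divr_gt0.
have kc := feature_continuous kP k_norm evW_C0.
have kM z : `|k z| <= c by rewrite k_norm.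
have [s [chi [sK chiC chi0 chi1 chik]]] :=
  partition_of_unity (@cylinder_compact R n d K cK) e1 (fun z _ => kc z).
pose z i := nth point s i.
(* Beyond the nodes the atoms sit at the default point with weight 0, so that every N >= [size s] is
   served. *)
pose w i := if (i < size s)%N then pairing mu (chi (z i)) else 0.
have w0 i : 0 <= w i.
  by rewrite /w; case: ifP => // _; apply: Rintegral_ge0 => x _; exact: chi0.
exists (size s) => N sN; exists (discrete_measure (fun i => NngNum (w0 i)) z N); split.
- exists (fun i => w i), (fun i => (z i).1), (fun i => (z i).2); split=> // A mA.
  by rewrite [LHS]discrete_measureE; apply: eq_bigr => i _; rewrite -surjective_pairing.
- rewrite /concentrated [LHS]discrete_measureE big1// => i _ /=.
  rewrite /w; case: ifPn => [si|_]; last by rewrite mul0e.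
  rewrite diracE memNset ?mule0//= => h; apply: h; apply: sK.
  exact: mem_nth.
apply: dual_norm_le => h h1.
have hb := C0_bounded_continuous (evW_C0 h).
rewrite discrete_pairing// distrC.
have -> : \sum_(i < N) (NngNum (w0 i))%:num * evW h (z i) =
    \sum_(x <- s) inner (k x) h * pairing mu (chi x).
  rewrite (big_nth point) big_mkord.
  rewrite (big_ord_widen N (fun i => inner (k (z i)) h * pairing mu (chi (z i))))//.
  rewrite [RHS]big_mkcond/=.
  apply: eq_bigr => i _; rewrite /w kP mulrC.
  by case: ifP => //; rewrite mulr0.
rewrite evWE; apply: le_trans
  (pairing_partition (compact_closed _ cK) muK kc kM (ltW e1) chiC chi0 _ chik h1) _.
- exact: norm_hausdorff.
- by move=> x Kx; exact: chi1.
by rewrite mulrAC ler_pdivrMr// ler_wpM2l ?(ltW e0)//; lra.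
Qed.

Lemma minimizers_close mu K (nu_ : nat -> varifold R d) : compact K -> concentrated mu K ->
  (forall N, (1 <= N)%N -> is_minimizer (varifold_dist evW ^~ mu)
    [set nu | discrete_varifolds N nu /\ msupport (mass nu) `<=` K] (nu_ N)) ->
  forall e : R, 0 < e -> \forall N \near \oo, varifold_dist evW (nu_ N) mu <= e.
Proof.
move=> cK muK nuP e e0; have [N0 N0P] := quantization cK muK e0.
exists (maxn 1 N0) => // N /=; rewrite geq_max => /andP[N1 /N0P[nu [nuN nuK nue]]].
have [_ h] := nuP N N1; apply: le_trans nue; apply: h; split=> //.
by apply: concentrated_support => //; apply: compact_closed => //; exact: norm_hausdorff.
Qed.

(** * Consequences of convergence in W^* *)

Section convergence.
Variables (mu : varifold R d) (K : set 'rV[R]_n) (mu_ : nat -> varifold R d).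
Hypotheses (cK : compact K) (muK : concentrated mu K).
Hypothesis mu_K : \forall N \near \oo, concentrated (mu_ N) K.
Hypothesis mu_cvg : forall e : R, 0 < e -> \forall N \near \oo, varifold_dist evW (mu_ N) mu <= e.

Let clK : closed K.
Proof. by apply: compact_closed => //; exact: norm_hausdorff. Qed.

(** The sum of a partition of unity is a C_0 function equal to 1 over K. An h in W within 1/2 of it
    has a pairing of at least half the mass, and convergence in W^* controls that pairing. *)
Lemma total_mass_bounded : exists2 A : R, 0 <= A & \forall N \near \oo, total_mass (mu_ N) <= A.
Proof.
have kc := feature_continuous kP k_norm evW_C0.
have [s [chi [_ chiC _ chi1 _]]] :=
  partition_of_unity (@cylinder_compact R n d K cK) ltr01 (fun z _ => kc z).
have fC : C0 ((fun w => \sum_(z <- s) chi z w) : X -> R^o) by exact: C0_sum.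
have fb := C0_bounded_continuous fC.
have h2 : 0 < 2^-1 :> R by rewrite invr_gt0.
have [h hf] := evW_univ.2 _ fC _ h2.
have hb := C0_bounded_continuous (evW_C0 h).
have massE nu : concentrated nu K -> total_mass nu <= 2 * `|pairing nu (evW h)|.
  move=> nuK; have cb := @bounded_continuous_cst R n d 1.
  have : `|pairing nu (fun z => evW h z - 1)| <= 2^-1 * total_mass nu.
    apply: (norm_pairing_le _ clK nuK) => [||z Kz]; [exact: bounded_continuousB|exact: ltW|].
    by have := hf z; rewrite (chi1 z (conj Kz I)) => /ltW.
  rewrite pairingB// pairing_cst mul1r ler_norml => /andP[h3 _].
  by have := ler_norm (pairing nu (evW h)); lra.
exists (2 * (`|pairing mu (evW h)| + `|h|)); first by rewrite mulr_ge0// addr_ge0.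
near=> N; apply: le_trans (massE _ _) _; first by near: N.
rewrite ler_pM2l// -[pairing (mu_ N) _](subrK (pairing mu (evW h))) addrC.
apply: le_trans (ler_normD _ _) _; rewrite lerD2l.
apply: le_trans (pairing_varifold_dist _ _ _) _; rewrite ler_piMr//.
by near: N; exact: mu_cvg.
Unshelve. all: by end_near. Qed.

Lemma pairing_cvg (f : X -> R) (e : R) : C0 (f : X -> R^o) -> 0 < e ->
  \forall N \near \oo, `|pairing (mu_ N) f - pairing mu f| <= e.
Proof.
move=> fC e0; have [A A0 massA] := total_mass_bounded.
have m0 := total_mass_ge0 mu.
(* Replacing f by [evW h] in both pairings will cost at most r (A + [total_mass mu]) <= e / 2; the
   other half is for the W^* distance. *)
have q0 : 0 < 2 * (A + total_mass mu + 1) by rewrite mulr_gt0// ltr_wpDl// addr_ge0.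
have [h hf] := evW_univ.2 _ fC _ (divr_gt0 e0 q0).
set r := e / _ in hf; have r0 : 0 < r by rewrite divr_gt0.
have rE : r * (A + total_mass mu + 1) = e / 2 by rewrite /r; field; rewrite gt_eqF// ltr_wpDl// addr_ge0.
have fb := C0_bounded_continuous fC; have hb := C0_bounded_continuous (evW_C0 h).
have near_f nu : `|pairing nu f - pairing nu (evW h)| <= r * total_mass nu.
  rewrite -pairingB//; apply: pairing_bounded => [|z]; first by case: (bounded_continuousB fb hb).
  by rewrite distrC ltW.
have n1 : 0 < 2 * (`|h| + 1) by rewrite mulr_gt0// ltr_wpDl.
near=> N.
have mN : total_mass (mu_ N) <= A by near: N.
have dN : `|h| * varifold_dist evW (mu_ N) mu <= e / 2.
  apply: (le_trans (y := `|h| * (e / (2 * (`|h| + 1))))).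
    by rewrite ler_wpM2l//; near: N; apply: mu_cvg; rewrite divr_gt0.
  by rewrite mulrA ler_pdivrMr// mulrC; have := normr_ge0 h; nra.
have h1 := near_f (mu_ N); have h2 := near_f mu.
have h3 := le_trans (pairing_varifold_dist (mu_ N) mu h) dN.
have h4 : r * total_mass (mu_ N) <= r * A by rewrite ler_pM2l.
move: h1 h2 h3; rewrite !ler_norml => /andP[h1 h1'] /andP[h2 h2'] /andP[h3 h3'].
by apply/andP; split; nra.
Unshelve. all: by end_near. Qed.

(** The functions chi z are fixed before h, and their coefficients [inner (F z) h] are bounded by M
    over the unit ball. *)
Lemma pairing_uniform_cvg F (M e : R) : continuous F -> (forall z, `|F z| <= M) -> 0 < e ->
  \forall N \near \oo, forall h, `|h| <= 1 ->
    `|pairing (mu_ N) (fun z => inner (F z) h) - pairing mu (fun z => inner (F z) h)| <= e.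
Proof.
move=> Fc FM e0; have [A A0 massA] := total_mass_bounded.
have m0 := total_mass_ge0 mu.
have M0 : 0 <= M by apply: le_trans (FM point).
have q0 : 0 < 2 * (A + total_mass mu + 1) by rewrite mulr_gt0// ltr_wpDl// addr_ge0.
have r0 := divr_gt0 e0 q0; set r := e / _ in r0.
have rE : r * (A + total_mass mu + 1) = e / 2 by rewrite /r; field; rewrite gt_eqF// ltr_wpDl// addr_ge0.
have [s [chi [_ chiC chi0 chi1 chiF]]] :=
  partition_of_unity (@cylinder_compact R n d K cK) r0 (fun z _ => Fc z).
have e2 : 0 < e / (2 * (M + 1)) by rewrite divr_gt0// mulr_gt0// ltr_wpDl.
have sum_cvg (t : seq X) (a : R) : 0 < a -> (forall z, z \in t -> C0 (chi z : X -> R^o)) ->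
    \forall N \near \oo, \sum_(z <- t) `|pairing (mu_ N) (chi z) - pairing mu (chi z)| <= a.
  elim: t a => [|z t IH] a a0 tC; first by near=> N; rewrite big_nil ltW.
  have a2 : 0 < a / 2 by rewrite divr_gt0.
  near=> N; rewrite big_cons (splitr a) lerD//; near: N.
    by apply: pairing_cvg => //; apply: tC; rewrite inE eqxx.
  by apply: IH => // w wt; apply: tC; rewrite inE wt orbT.
have sN := sum_cvg s _ e2 chiC.
near=> N; move=> h h1.
have chi1' w : K w.1 -> \sum_(z <- s) chi z w = 1 by move=> Kw; exact: chi1.
have muNK : concentrated (mu_ N) K by near: N.
have p1 := pairing_partition clK muNK Fc FM (ltW r0) chiC chi0 chi1' chiF h1.
have p2 := pairing_partition clK muK Fc FM (ltW r0) chiC chi0 chi1' chiF h1.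
have p3 : `|\sum_(z <- s) inner (F z) h * pairing (mu_ N) (chi z) -
    \sum_(z <- s) inner (F z) h * pairing mu (chi z)| <= e / 2.
  rewrite -sumrB; apply: le_trans (ler_norm_sum _ _ _) _.
  apply: (le_trans (y := M * (e / (2 * (M + 1))))); last first.
    by rewrite mulrA ler_pdivrMr ?mulr_gt0 ?ltr_wpDl//; nra.
  apply: (le_trans (y := M * \sum_(z <- s) `|pairing (mu_ N) (chi z) - pairing mu (chi z)|)).
    rewrite mulr_sumr; apply: ler_sum => z _; rewrite -mulrBr normrM ler_wpM2r//.
    exact: le_trans (norm_inner_unit _ h1) _.
  by rewrite ler_wpM2l//; near: N.
have mN : total_mass (mu_ N) <= A by near: N.
have h4 : r * total_mass (mu_ N) <= r * A by rewrite ler_pM2l.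
move: p1 p2 p3; rewrite !ler_norml => /andP[p1 p1'] /andP[p2 p2'] /andP[p3 p3'].
by apply/andP; split; nra.
Unshelve. all: by end_near. Qed.

End convergence.

End quantization.

(** * Gamma-convergence *)

Lemma limn_esup_le {R : realType} (u : nat -> \bar R) (a : \bar R) :
  (\forall N \near \oo, (u N <= a)%E) -> (limn_esup u <= a)%E.
Proof.
move=> ua; apply: (@le_trans _ _ (ereal_sup (u @` [set N | (u N <= a)%E]))).
  by apply: ereal_inf_lbound; exists [set N | (u N <= a)%E].
by apply: ge_ereal_sup => _ [N /= Na <-].
Qed.

Lemma limn_einf_ge {R : realType} (u : nat -> \bar R) (a : \bar R) :
  (\forall N \near \oo, (a <= u N)%E) -> (a <= limn_einf u)%E.
Proof.
move=> au; rewrite /limn_einf leeNr; apply: limn_esup_le.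
by apply: filterS au => N; rewrite leeN2.
Qed.

(** The kernel is constant on the diagonal, because oriented planes are unit vectors; hence the
    constant norm that [feature_continuous] requires. *)
Lemma kernel_feature {R : realType} {n : nat} {d : 'I_n.+1} (rho gamma : R -> R)
    {W : hilbertType R} (evW : W -> position_plane R d -> R) :
  is_rkhs_of (kprod rho gamma) evW ->
  exists k : position_plane R d -> W, (forall h z, evW h z = inner (k z) h) /\
    forall z, `|k z| = Num.sqrt (rho 0 * gamma 1).
Proof.
move=> [_ _ /choice[k kP]]; exists k; split=> [h z|z]; first by have [_ ->] := kP z.
have [kz /(_ (k z))] := kP z; rewrite kz inner_normE /kprod /kpos /kG subrr dot_plane.
have -> : enorm (0 : 'rV[R]_n) ^+ 2 = 0 by apply/eqP; rewrite sqr_enorm dotxx_eq0.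
by move=> ->; rewrite sqrtr_sqr normr_id.
Qed.

(** * The data term and the energies *)

Section fidelity.
Context {R : realType} {n : nat} {d : 'I_n.+1} {V W : hilbertType R}.
Local Notation X := (position_plane R d).
Variables (evV : V -> 'rV[R]_n -> 'rV[R]_n) (B : R).
Hypotheses (B0 : 0 <= B) (evP : C11_fields evV B).
Variables (evW : W -> X -> R) (k : X -> W) (c : R).
Hypothesis kP : forall h z, evW h z = inner (k z) h.
Hypothesis k_norm : forall z, `|k z| = c.
Hypothesis evW_univ : C0_universal (evW : W -> X -> R).
Variables (mu mutar : varifold R d) (K : set 'rV[R]_n) (mu_ : nat -> varifold R d).
Hypotheses (cK : compact K) (muK : concentrated mu K).
Hypothesis mu_K : \forall N \near \oo, concentrated (mu_ N) K.
Hypothesis mu_cvg : forall e : R, 0 < e -> \forall N \near \oo, varifold_dist evW (mu_ N) mu <= e.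
Local Notation phi v := (field_flow evV v 1).
Local Notation theta v := (push k (phi v)).

Definition discrepancy (nu : varifold R d) (v : L2 V) (omega : X -> R) : R :=
  pushforward_pairing (phi v) nu omega - pairing mutar omega.

Definition fidelity nu v := dual_norm evW (discrepancy nu v).

Let phi_cont v : continuous (phi v).
Proof. exact: (flow_space_continuous B0 evP). Qed.

Let phi_jac v : continuous (jacobian (phi v)).
Proof. exact: (flow_jacobian_continuous B0 evP). Qed.

Let phi_unit v x : 'J (phi v) x \in unitmx.
Proof. exact: (flow_jacobian_unit B0 evP). Qed.

Let theta_cont v : continuous (theta v).
Proof.
exact: (push_continuous kP k_norm (evW_C0 evW_univ) (@phi_cont v) (@phi_jac v) (@phi_unit v)).
Qed.

Let theta_bounded v : exists M, forall z, `|theta v z| <= M.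
Proof. by have [C] := flow_jacobian_bounded B0 evP v; exact: push_bounded. Qed.

Lemma discrepancy_bounded nu v : dual_bounded evW (discrepancy nu v).
Proof.
have kc := feature_continuous kP k_norm (evW_C0 evW_univ).
have kM z : `|k z| <= c by rewrite k_norm.
have [M vM] := theta_bounded v.
exists (M * total_mass nu + c * total_mass mutar) => h h1.
rewrite /discrepancy (pushforward_pairingE kP) (evWE kP).
by apply: le_trans (ler_normB _ _) _; apply: lerD; exact: dual_bounded_pairing.
Qed.

Lemma fidelity_ge0 nu v : 0 <= fidelity nu v.
Proof. exact/dual_norm_ge0/discrepancy_bounded. Qed.

(** N0 comes from the measures tested against the fixed map [theta v], the neighbourhood from the
    flows. Replacing [theta u] by [theta v] costs their distance over K times the mass of [mu_ N],
    which is bounded; so N0 can precede u. *)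
Lemma fidelity_cvg (v : weakL2 V) (M e : R) : 0 < e ->
  exists N0, \forall u \near v, admissible B M u -> forall N, (N0 <= N)%N ->
    `|fidelity (mu_ N) u - fidelity mu v| <= e.
Proof.
move=> e0.
have [A A0 massA] := total_mass_bounded kP k_norm evW_univ cK mu_K mu_cvg.
have e1 : 0 < e / (2 * (A + 1)) by rewrite divr_gt0// mulr_gt0// ltr_wpDl.
have [r r0 rP] := 
  push_close kP k_norm (evW_C0 evW_univ) (@phi_cont v) (@phi_jac v) (@phi_unit v) cK e1.
have [M' vM'] := theta_bounded v.
have e2 : 0 < e / 2 by rewrite divr_gt0.
have unif := pairing_uniform_cvg kP k_norm evW_univ cK muK mu_K mu_cvg (@theta_cont v) vM' e2.
have [N0 _ N0P] : \forall N \near \oo, [/\ concentrated (mu_ N) K, total_mass (mu_ N) <= A &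
    forall h, `|h| <= 1 -> `|pairing (mu_ N) (fun z => inner (theta v z) h) -
      pairing mu (fun z => inner (theta v z) h)| <= e / 2].
  by near=> N; split; near: N.
exists N0; have := flow_C1_weak_continuous B0 evP v M cK r0; apply: filterS => u uv uM N NN0.
have [muNK mN uN] := N0P N NN0.
apply: dual_norm_dist; [exact: discrepancy_bounded|exact: discrepancy_bounded|move=> h h1].
rewrite /discrepancy opprB addrA subrK !(pushforward_pairingE kP).
set a := pairing _ _; set b := pairing mu _.
rewrite -[a](subrK (pairing (mu_ N) (fun z => inner (theta v z) h))) -addrA.
apply: le_trans (ler_normD _ _) _; rewrite (splitr e); apply: lerD; last exact: uN.
have [Mu uMu] := theta_bounded u.
have ub := inner_bounded_continuous h (@theta_cont u) uMu.
have vb := inner_bounded_continuous h (@theta_cont v) vM'.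
rewrite -pairingB//; apply: (le_trans (y := e / (2 * (A + 1)) * total_mass (mu_ N))).
  apply: (norm_pairing_le _ (compact_closed _ cK) muNK) => [||| z Kz].
  - exact: bounded_continuousB.
  - exact: norm_hausdorff.
  - exact: ltW.
  rewrite -innerBl; apply: le_trans (norm_inner_unit _ h1) _.
  by have [u1 u2] := uv uM z.1 Kz; exact: rP.
apply: (le_trans (y := e / (2 * (A + 1)) * A)); first by rewrite ler_pM2l.
by rewrite mulrAC ler_pdivrMr ?mulr_gt0 ?ltr_wpDl//; nra.
Unshelve. all: by end_near. Qed.

Variable lambda : R.
Hypothesis lambda0 : 0 < lambda.
Local Notation E := (energy evV evW lambda mu mutar).
Local Notation EN := (fun N => energy evV evW lambda (mu_ N) mutar).

Lemma energyE nu v : energy evV evW lambda nu mutar v =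
  2^-1 * L2_sqnorm v + lambda * fidelity nu v ^+ 2.
Proof. by []. Qed.

Lemma sqnorm_energy nu v : 2^-1 * L2_sqnorm v <= energy evV evW lambda nu mutar v.
Proof. by rewrite energyE lerDl mulr_ge0 ?sqr_ge0// ltW. Qed.

(** If the squared norm of u exceeds 2 E(v), its kinetic term alone suffices; otherwise u is
    admissible for a constant M that depends on v only. *)
Lemma energy_lower (v : weakL2 V) (e : R) : 0 < e ->
  exists N0, \forall u \near v, forall N, (N0 <= N)%N -> E v - e <= EN N u.
Proof.
move=> e0; have f0 := fidelity_ge0 mu v.
(* This r keeps the loss in lambda times the squared data term within e / 2; the kinetic term loses
   at most e / 2 by [L2_sqnorm_ge]. *)
have q0 : 0 < 4 * lambda * (fidelity mu v + 1) by rewrite !mulr_gt0// ltr_wpDl.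
have r0 := divr_gt0 e0 q0; set r := e / _ in r0.
have rE : lambda * (2 * r * (fidelity mu v + 1)) = e / 2.
  by rewrite /r; field; rewrite !gt_eqF// ltr_wpDl.
have [N0 N0P] := fidelity_cvg v (B ^+ 2 * (2 * E v)) r0.
exists N0; have e2 : 0 < e / 2 by rewrite divr_gt0.
have weak := L2_weak_nbhs v v e2.
apply: filterS2 N0P weak => u fid_u nu N NN0.
have uE := sqnorm_energy (mu_ N) u.
have [uv|vu] := leP (L2_sqnorm u) (2 * E v); last by lra.
have uM : admissible B (B ^+ 2 * (2 * E v)) u by rewrite /admissible ler_wpM2l ?sqr_ge0.
have fN := fidelity_ge0 (mu_ N) u.
move: (fid_u uM N NN0); rewrite ler_norml => /andP[fr _].
move: nu; rewrite L2_dotvv ltr_norml => /andP[uvr _].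
have uv2 := L2_sqnorm_ge u v.
have sq : fidelity mu v ^+ 2 - 2 * r * fidelity mu v <= fidelity (mu_ N) u ^+ 2.
  have := sqr_ge0 (fidelity (mu_ N) u - (fidelity mu v - r)); nra.
rewrite !energyE; nra.
Qed.

Lemma energy_cvg (v : weakL2 V) : EN N v @[N --> \oo] --> E v.
Proof.
apply/cvgrPdist_le => e e0; have f0 := fidelity_ge0 mu v.
have q0 : 0 < lambda * (2 * fidelity mu v + 1) by rewrite mulr_gt0// ltr_wpDl// mulr_ge0.
have r0 := divr_gt0 e0 q0; set r := e / _ in r0.
have rE : lambda * (r * (2 * fidelity mu v + 1)) = e.
  by rewrite /r; field; rewrite !gt_eqF// ltr_wpDl// mulr_ge0.
(* In the difference of squares, closeness 1 bounds the sum of the two data terms by 2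
   [fidelity mu v] + 1, and closeness r controls their difference. *)
have s0 : 0 < Num.min 1 r by rewrite lt_min ltr01.
have [N0 /nbhs_singleton N0P] := fidelity_cvg v (B ^+ 2 * L2_sqnorm v) s0.
exists N0 => // N /= /(N0P (lexx _)); rewrite le_min => /andP[f1 fr].
have fN := fidelity_ge0 (mu_ N) v.
rewrite !energyE opprD addrACA subrr add0r -mulrBr normrM gtr0_norm// -rE ler_pM2l//.
rewrite subr_sqr normrM distrC; apply: ler_pM => //.
move: f1; rewrite ger0_norm ?addr_ge0// ler_norml => /andP[_ f1]; lra.
Qed.

Lemma energy_Gamma_cvg : Gamma_cvg EN E.
Proof.
split=> [u v uv|v].
  apply/lee_addgt0Pr => e e0; rewrite -leeBlDr//; apply: limn_einf_ge.
  have [N0 N0P] := energy_lower v e0.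
  have [N1 _ N1P] := uv _ N0P; exists (maxn N0 N1) => // N /=; rewrite geq_max => /andP[NN0 NN1].
  by rewrite -EFinB lee_fin; exact: (N1P N NN1).
exists (fun=> v); split; first exact: cvg_cst.
have /cvg_limn_einf_sup[_ ->//] : (EN N v)%:E @[N --> \oo] --> (E v)%:E.
by apply: cvg_EFin; [exact: nearW|exact: energy_cvg].
Qed.

(** * Global minimizers and their cluster points *)

Section minimizers.
Variable vN : nat -> weakL2 V.
Hypothesis vN_min : forall N, (1 <= N)%N -> is_minimizer (EN N) setT (vN N).

Lemma minimizers_bounded : exists C, forall N, (1 <= N)%N -> L2_norm (vN N) <= C.
Proof.
(* The first minimizer serves as a fixed competitor: its energies converge, so they are bounded in
   N. *)
have : cvgn (fun N => EN N (vN 1%N)) by apply/cvg_ex; exists (E (vN 1%N)); exact: energy_cvg.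
move=> /cvg_seq_bounded/pinfty_ex_gt0[M M0 /= EM].
exists (Num.sqrt (2 * M)) => N N1; rewrite ler_sqrt ?mulr_ge0 ?(ltW M0)//.
have [_ /(_ (vN 1%N) I) h] := vN_min N1.
rewrite -ler_pdivrMl//; apply: le_trans (sqnorm_energy (mu_ N) (vN N)) _.
exact: le_trans h (le_trans (ler_norm _) (EM N I)).
Qed.

(** A single minimizer with large index in the neighbourhood of [energy_lower] is enough: E(vbar) -
    e/2 <= E_N(v^N) <= E_N(w) <= E(w) + e/2. *)
Lemma minimizers_cluster (vbar : weakL2 V) : cluster (vN @ \oo) vbar -> is_minimizer E setT vbar.
Proof.
move=> vc; split=> [|w _]; first exact: I.
apply/ler_addgt0Pr => e e0.
have e2 : 0 < e / 2 by rewrite divr_gt0.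
have [N0 N0P] := energy_lower vbar e2.
have /cvgrPdist_le/(_ _ e2)[N1 _ N1P] := @energy_cvg w.
pose A := [set N | (maxn N0 (maxn N1 1) <= N)%N].
have vA : (vN @ \oo) (vN @` A) by exists (maxn N0 (maxn N1 1)) => // N /= h; exists N.
have [u [[N /= AN uE] Pu]] := vc _ _ vA N0P.
move: AN Pu; rewrite /A/= !geq_max -uE => /and3P[NN0 NN1 N1'] /(_ N NN0) h1.
have [_ /(_ w I) h2] := vN_min N1'.
have := N1P N NN1; rewrite /= distrC => /(le_trans (ler_norm _)); rewrite lerBlDl => h3.
have := le_trans h1 (le_trans h2 h3).
by rewrite lerBlDr -addrA -splitr.
Qed.

End minimizers.

End fidelity.

Theorem theorem5p6 (R : realType) (n : nat) (d : 'I_n.+1)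
    (rho gamma : R -> R)
    (V : hilbertType R) (evV : V -> 'rV[R]_n -> 'rV[R]_n)
    (W : hilbertType R) (evW : W -> position_plane R d -> R)
    (mu0 mutar : varifold R d) (K : set 'rV[R]_n) (lambda : R)
    (muK : nat -> varifold R d) :
  {within `[0, +oo[, continuous rho} ->
  {within `[-1, 1], continuous gamma} ->
  0 < rho 0 -> 0 < gamma 1 ->
  positive_definite (@kpos R n rho) ->
  positive_definite (@kG R n d gamma) ->
  (forall x : 'rV[R]_n, C0 (kpos rho x)) ->
  is_rkhs_of (kprod rho gamma) evW ->
  C0_universal evW ->
  (forall s, 0 <= s -> 0 <= rho s) ->
  (forall s, -1 <= s <= 1 -> 0 <= gamma s) ->
  is_rkhs evV ->
  continuously_embedded_C0_2 evV ->
  compact (msupport mu0) ->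
  compact K ->
  msupport (mass mu0) `<=` K ->
  0 < lambda ->
  (forall N, (1 <= N)%N ->
     is_minimizer (varifold_dist evW ^~ mu0)
       [set nu | discrete_varifolds N nu /\ msupport (mass nu) `<=` K] (muK N)) ->
  let E := energy evV evW lambda mu0 mutar in
  let EN N := energy evV evW lambda (muK N) mutar in
  Gamma_cvg EN E /\
  forall vN : nat -> weakL2 V,
    (forall N, (1 <= N)%N -> is_minimizer (EN N) setT (vN N)) ->
    (exists C, forall N, (1 <= N)%N -> L2_norm (vN N) <= C) /\
    forall vbar : weakL2 V, cluster (vN @ \oo) vbar -> is_minimizer E setT vbar.
Proof.
move=> _ _ _ _ _ _ _ rkhsW univ _ _ rkhsV embV _ cK suppK lambda0 muK_min E EN.
have [k [kP k_norm]] := kernel_feature rkhsW.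
have [B B0 evP] := embedded_C11_fields rkhsV embV.
have clK : closed K by apply: compact_closed => //; exact: norm_hausdorff.
have mu0K := support_concentrated clK suppK.
have muK_conc : \forall N \near \oo, concentrated (muK N) K.
  by exists 1%N => // N /= /muK_min[[_ suppN] _]; exact: support_concentrated.
have muK_cvg := minimizers_close kP k_norm univ cK mu0K muK_min.
split; first exact: (energy_Gamma_cvg B0 evP kP k_norm univ mutar cK mu0K muK_conc muK_cvg lambda0).
move=> vN vN_min; split.
  exact: (minimizers_bounded B0 evP kP k_norm univ cK mu0K muK_conc muK_cvg lambda0 vN_min).
exact: (minimizers_cluster B0 evP kP k_norm univ cK mu0K muK_conc muK_cvg lambda0 vN_min).
Qed.
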